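(* Let $\delta > 0$. There exist positive constants $C_0 = C_0(\delta)$ and $\epsilon_0 = \epsilon_0(\delta)$, depending only on $\delta$, such that the following statements hold for all $\mathbf{v} \in S_\delta \cap \mathbb{Z}_{>0}^2$, $p \ge 1$, $w > 0$ and $z < 1$. (a) If $w \ge \zeta_{\mathbf{v}}-\epsilon_0 \min \{p^{1/3}\|\mathbf{v}\|^{-1/3}, 1\}$ then $$\mathbf{E}[|G^{w, \mathrm{hor}}_{\mathbf{v}}-\gamma_{\mathbf{v}}|^p] \le C_0^p p^{2p/3} (\max \{p, \|\mathbf{v}\|\})^{p/3}.$$ (b) If $z \le \zeta_{\mathbf{v}}+\epsilon_0 \min \{p^{1/3}\|\mathbf{v}\|^{-1/3}, 1\}$ then $$\mathbf{E}[|G^{z, \mathrm{ver}}_{\mathbf{v}}-\gamma_{\mathbf{v}}|^p] \le C_0^p p^{2p/3} (\max \{p, \|\mathbf{v}\|\})^{p/3}.$$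
   Context: $\mathrm{Exp}(\lambda)$ is the exponential distribution with rate $\lambda$. For $w>0$ and $z<1$, let $\{\omega^{w,z}_{\mathbf{v}}:\mathbf{v}\in\mathbb{Z}_{\ge0}^2\}$ be independent weights with $\omega^{w,z}_{\mathbf{v}}\sim\mathrm{Exp}(1)$ for $\mathbf{v}\in\mathbb{Z}_{>0}^2$, $\omega^{w,z}_{(i,0)}\sim\mathrm{Exp}(w)$ for $i\in\mathbb{Z}_{>0}$, $\omega^{w,z}_{(0,j)}\sim\mathrm{Exp}(1-z)$ for $j\in\mathbb{Z}_{>0}$, and $\omega^{w,z}_{(0,0)}=0$. $\Pi_{\mathbf{u},\mathbf{v}}$ is the set of up-right lattice paths from $\mathbf{u}$ to $\mathbf{v}$ with steps $(1,0)$ and $(0,1)$, viewed as vertex sets including both endpoints. Put $G^{w,\mathrm{hor}}_{\mathbf{v}}=\max_{\pi\in\Pi_{(1,0),\mathbf{v}}}\sum_{\mathbf{p}\in\pi}\omega^{w,z}_{\mathbf{p}}$ (which does not depend on $z$) and $G^{z,\mathrm{ver}}_{\mathbf{v}}=\max_{\pi\in\Pi_{(0,1),\mathbf{v}}}\sum_{\mathbf{p}\in\pi}\omega^{w,z}_{\mathbf{p}}$ (which does not depend on $w$), for $\mathbf{v}\in\mathbb{Z}_{>0}^2$. For $\mathbf{x}=(x,y)\in\mathbb{R}_{>0}^2$, $\gamma_{\mathbf{x}}=(\sqrt{x}+\sqrt{y})^2$ and $\zeta_{\mathbf{x}}=\frac{\sqrt{x}}{\sqrt{x}+\sqrt{y}}$.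 $\|\cdot\|$ is the $L^1$ norm. $S_\delta = \{(x,y)\in\mathbb{R}_{>0}^2: x\ge \delta y,\ y\ge\delta x\}$. *)

(* Defs.v *)
From HB Require Import structures.
From mathcomp Require Import all_boot all_order all_algebra finmap.
From mathcomp Require Import all_classical all_reals all_analysis.

Set Implicit Arguments.
Unset Strict Implicit.
Unset Printing Implicit Defensive.

Import Order.TTheory GRing.Theory Num.Theory.
Import numFieldNormedType.Exports.

Local Open Scope classical_set_scope.
Local Open Scope ring_scope.

Section paths.

Definition up_right_step : rel (nat * nat) := fun p q =>
  (q == (p.1.+1, p.2)) || (q == (p.1, p.2.+1)).

(* A path is the list of its vertices in the order of traversal, endpoints
   included.  The vertices are pairwise distinct, so a sum over this list is the
   sum over the vertex set. *)
Definition up_right_paths (u v : nat * nat) : set (seq (nat * nat)) :=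
  [set pi | exists s, [/\ pi = u :: s, path up_right_step u s & last u s = v]].

End paths.

Section last_passage.
Context {R : realType}.

Definition last_passage (W : nat * nat -> R) (u v : nat * nat) : R :=
  sup [set \sum_(q <- pi) W q | pi in up_right_paths u v].

Lemma finite_step_paths n u :
  finite_set [set s : seq (nat * nat) | path up_right_step u s /\ size s = n].
Proof.
elim: n u => [|n IHn] u.
  by apply: (sub_finite_set _ (finite_set1 [::])) => s [_ /size0nil].
apply: (sub_finite_set (B := (cons (u.1.+1, u.2)) @`
    [set s | path up_right_step (u.1.+1, u.2) s /\ size s = n] `|`
    (cons (u.1, u.2.+1)) @`
    [set s | path up_right_step (u.1, u.2.+1) s /\ size s = n])).
  move=> [|x s] [] //= /andP[/orP[] /eqP -> ps] [sn]; [left|right];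
  by exists s.
by rewrite finite_setU; split; apply: finite_image; exact: IHn.
Qed.

Lemma up_right_path_size u s : path up_right_step u s ->
  ((last u s).1 + (last u s).2 = u.1 + u.2 + size s)%N.
Proof.
elim: s u => [|x s IHs] u /=; first by rewrite addn0.
by case/andP=> /orP[] /eqP -> /IHs ->; rewrite /= ?addSn ?addnS ?addSn.
Qed.

Lemma finite_up_right_paths u v : finite_set (up_right_paths u v).
Proof.
apply: (sub_finite_set _ (finite_image (cons u)
  (finite_step_paths (v.1 + v.2 - (u.1 + u.2)) u))).
move=> _ [s [-> ps <-]]; exists s => //; split=> //.
by rewrite up_right_path_size// addKn.
Qed.

Lemma up_right_paths_nonempty u v :
  (u.1 <= v.1)%N -> (u.2 <= v.2)%N -> up_right_paths u v !=set0.
Proof.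
case: u v => [a b] [c d] /= /subnK <- /subnK <-.
move: (c - a)%N (d - b)%N => m n.
suff [s [ps ls]] : exists s, path up_right_step (a, b) s /\
    last (a, b) s = (m + a, n + b)%N by exists ((a, b) :: s), s.
elim: m a => [|m IHm] a; last first.
  have [s [ps ls]] := IHm a.+1; exists ((a.+1, b) :: s) => /=.
  by rewrite ls addnS addSn; split=> //; rewrite /up_right_step/= eqxx.
elim: n b => [|n IHn] b; first by exists [::].
have [s [ps ls]] := IHn b.+1; exists ((a, b.+1) :: s) => /=.
by rewrite ls addnS addSn; split=> //; rewrite /up_right_step/= eqxx orbT.
Qed.

(* The supremum is a maximum: it is attained by some path. *)
Lemma last_passage_attained (W : nat * nat -> R) u v :
  (u.1 <= v.1)%N -> (u.2 <= v.2)%N ->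
  exists2 pi, up_right_paths u v pi & last_passage W u v = \sum_(q <- pi) W q.
Proof.
move=> uv1 uv2; have [pi0 pi0P] := up_right_paths_nonempty uv1 uv2.
have /finite_seqP[s sP] := finite_up_right_paths u v.
pose f (pi : seq (nat * nat)) := \sum_(q <- pi) W q.
have pi0s : pi0 \in s by move: pi0P; rewrite sP.
have [pi pis pimax] : exists2 pi, pi \in s & forall q, q \in s -> f q <= f pi.
  have [i _ imax] := @Order.TotalTheory.arg_maxP _ _ _
    (Ordinal (etrans (index_mem pi0 s) pi0s)) xpredT
    (fun i : 'I_(size s) => f (nth pi0 s i)) isT.
  exists (nth pi0 s i); first exact: mem_nth.
  move=> q qs; rewrite -(nth_index pi0 qs).
  by apply: (imax (Ordinal (etrans (index_mem q s) qs))).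
have piP : up_right_paths u v pi by rewrite sP.
exists pi => //; apply/eqP; rewrite eq_le; apply/andP; split.
  apply: ge_sup; first by exists (f pi), pi.
  by move=> _ [q + <-]; rewrite sP => /pimax.
apply: ub_le_sup; last by exists pi.
by exists (f pi) => _ [q + <-]; rewrite sP => /pimax.
Qed.

End last_passage.

Section plane.
Context {R : realType}.
Implicit Types x : R * R.

Definition toR2 (v : nat * nat) : R * R := (v.1%:R, v.2%:R).

Definition l1norm x : R := `|x.1| + `|x.2|.

Definition gamma x : R := (Num.sqrt x.1 + Num.sqrt x.2) ^+ 2.

Definition zeta x : R := Num.sqrt x.1 / (Num.sqrt x.1 + Num.sqrt x.2).

Definition cone (delta : R) : set (R * R) :=
  [set x | [/\ 0 < x.1, 0 < x.2, delta * x.2 <= x.1 & delta * x.1 <= x.2]].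

End plane.

Section weights.
Context {R : realType} d (T : measurableType d) (P : probability T R).

(* Mutual independence: the product rule for every finite subfamily. *)
Definition mutually_independent (I : choiceType) (X : I -> {RV P >-> R}) :=
  forall (J : {fset I}) (A : I -> set R), (forall i, measurable (A i)) ->
    P (\bigcap_(i in [set` J]) (X i @^-1` A i)) =
    (\prod_(i <- J) P (X i @^-1` A i))%E.

Definition exp_distributed (rate : R) (X : {RV P >-> R}) :=
  forall A : set R, measurable A -> distribution P X A = exponential_prob rate A.

Record boundary_weights (w z : R) (omega : nat * nat -> {RV P >-> R}) : Prop := {
  bw_indep : mutually_independent omega ;
  bw_bulk : forall i j, (0 < i)%N -> (0 < j)%N -> exp_distributed 1 (omega (i, j)) ;
  bw_hor : forall i, (0 < i)%N -> exp_distributed w (omega (i, 0%N)) ;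
  bw_ver : forall j, (0 < j)%N -> exp_distributed (1 - z) (omega (0%N, j)) ;
  bw_origin : forall t, omega (0%N, 0%N) t = 0 }.

Definition G_hor (omega : nat * nat -> {RV P >-> R}) (v : nat * nat) (t : T) : R :=
  last_passage (fun q => omega q t) (1%N, 0%N) v.

Definition G_ver (omega : nat * nat -> {RV P >-> R}) (v : nat * nat) (t : T) : R :=
  last_passage (fun q => omega q t) (0%N, 1%N) v.

End weights.

(* Main.v *)
From HB Require Import structures.
Require Import Defs.
From mathcomp Require Import all_boot all_order all_algebra finmap.
From mathcomp Require Import all_classical all_reals all_analysis.
From mathcomp Require Import measurable_realfun.
From mathcomp Require Import ring lra zify.

Set Implicit Arguments.
Unset Strict Implicit.
Unset Printing Implicit Defensive.

Import Order.TTheory GRing.Theory Num.Theory.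
Import numFieldNormedType.Exports.

Local Open Scope classical_set_scope.
Local Open Scope ring_scope.

(** Write N for the L1 norm of the end point (m, n) and F(w, z) for the passage
  time from the origin when the bottom row carries Exp(w) weights and the left
  column Exp(1 - z) weights; it is the maximum of the horizontal passage time of
  rate w and the vertical one of rate 1 - z.

  For w = z the model is stationary: the increments of the passage time along the
  top row and along the last column are independent, with the laws of the boundary
  weights ([burke_stationarity]).  Tilting the law of the bottom row from Exp(w) to
  Exp(z) turns an exponential moment of F(w, z) into a moment of such increments,
  whence E exp ((w - z) F(w, z)) = (w / z)^m ((1 - z) / (1 - w))^n
  ([from_origin_mgf]).  After centring by gamma the logarithm of the right side is
  gamma (f(w) - f(z)) with f'(u) = (u - zeta)^2 / (u (1 - u)): it is of third order
  near zeta, which is the source of the exponents 1/3 and 2/3 ([exponent_ge],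
  [exponent_le]).

  Upper deviations.  Put h = min ((p / N)^(1/3), 1).  For two rates z < w at
  distance of order h from zeta the formula bounds E exp (c h (F(w, z) - gamma)) by
  exp (C p), and F(w, z) dominates the horizontal passage time, which decreases in
  its rate.  Hence the p-th moment of the positive part is at most (C p / h)^p,
  which is the asserted bound ([scale_identity]).

  Lower deviations.  Both boundary passage times dominate the passage time B from
  (1, 1), so a lower tail for B suffices.  For w < z the formula shows that
  F(zeta - a, zeta + a) <= gamma has probability at most exp (- c a^3 N).  Outside
  this event, up to transposition, the horizontal passage time of rate zeta - a
  exceeds gamma, and it remains to conclude that B > gamma - C a^2 N outside
  another event of that probability ([hor_large_bulk_large]).  Let k be the column
  in which the maximal path leaves the bottom row.  Lowering the rate to
  zeta - 2 a adds an amount of order a k to the path, whereas the passage time of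
  that rate exceeds gamma by at most order a^2 N; so k is of order at most a N.
  The row segment contributes about k / (zeta - 2 a).  Starting the path at (1, 1)
  instead of (k, 1) recovers, after reversing the lattice, an increment of a bulk
  passage time, which dominates the increment of a stationary model of rate
  zeta + a, about k / (zeta + 2 a).  The two differ by order k a, hence by order
  a^2 N; the errors are maxima of two random walks with independent exponential
  steps ([walk_max_tail]).  Integrating the tail over geometric shells gives the
  moment ([shell_moment]).

  The vertical statement is the horizontal one for the transposed weights. *)

(** * Last passage along lattice paths *)

Section LastPassage.
Context {R : realType}.
Implicit Types (W : nat * nat -> R) (u v : nat * nat).

Lemma up_right_path_le u s : path up_right_step u s ->
  (u.1 <= (last u s).1)%N && (u.2 <= (last u s).2)%N.
Proof.
elim: s u => [|x s IH] [a b] /=; first by rewrite !leqnn.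
by move=> /andP[/orP[] /eqP -> /IH /=] /andP[h1 h2]; apply/andP; lia.
Qed.

Lemma path_weight_le W u v pi : up_right_paths u v pi ->
  \sum_(q <- pi) W q <= last_passage W u v.
Proof.
move=> hpi; apply: ub_le_sup; last by exists pi.
have /finite_seqP[l hlst] := finite_up_right_paths u v.
exists (\sum_(rho <- l) `|\sum_(q <- rho) W q|) => _ [rho hrho <-].
have rl : rho \in l by move: hrho; rewrite hlst.
rewrite (big_rem rho)//= (le_trans (ler_norm _))// lerDl.
by apply: sumr_ge0.
Qed.

Lemma last_passage_refl W u : last_passage W u u = W u.
Proof.
have [pi [s [-> hp hl]] ->] :=
  last_passage_attained W (leqnn u.1) (leqnn u.2).
have := up_right_path_size hp; rewrite hl.
case: s hp hl => [|x s] _ _ /=; first by rewrite big_seq1.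
lia.
Qed.

Lemma last_passage_ge_back W u v v' :
  (u.1 <= v'.1)%N -> (u.2 <= v'.2)%N -> up_right_step v' v ->
  last_passage W u v' + W v <= last_passage W u v.
Proof.
move=> h1 h2 st; have [pi [s [-> hp hl]] ->] := last_passage_attained W h1 h2.
have hv : up_right_paths u v (rcons (u :: s) v).
  by exists (rcons s v); rewrite rcons_path hp hl st last_rcons.
by have := path_weight_le W hv; rewrite big_rcons/=.
Qed.

Lemma last_passage_back W u v : (u.1 <= v.1)%N -> (u.2 <= v.2)%N -> u != v ->
  exists v', [/\ up_right_step v' v, (u.1 <= v'.1)%N, (u.2 <= v'.2)%N &
    last_passage W u v = last_passage W u v' + W v].
Proof.
move=> h1 h2 uv; have [pi [s [-> hp hl]] e] := last_passage_attained W h1 h2.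
case/lastP: s hp hl e => [|s x] hp hl e; first by move: uv; rewrite -hl /= eqxx.
move: hl hp e; rewrite last_rcons rcons_path => -> /andP[hp st] e.
have /andP[k1 k2] := up_right_path_le hp.
exists (last u s); split=> //; apply/eqP; rewrite eq_le last_passage_ge_back//.
rewrite e -rcons_cons big_rcons/= andbT lerD2r.
by apply: path_weight_le; exists s.
Qed.

Lemma last_passage_ge_front W u u' v :
  (u'.1 <= v.1)%N -> (u'.2 <= v.2)%N -> up_right_step u u' ->
  W u + last_passage W u' v <= last_passage W u v.
Proof.
move=> h1 h2 st; have [pi [s [-> hp hl]] ->] := last_passage_attained W h1 h2.
have hv : up_right_paths u v [:: u, u' & s].
  by exists (u' :: s); rewrite /= st hp hl.
by have := path_weight_le W hv; rewrite big_cons.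
Qed.

Lemma last_passage_front W u v : (u.1 <= v.1)%N -> (u.2 <= v.2)%N -> u != v ->
  exists u', [/\ up_right_step u u', (u'.1 <= v.1)%N, (u'.2 <= v.2)%N &
    last_passage W u v = W u + last_passage W u' v].
Proof.
move=> h1 h2 uv; have [pi [s [-> hp hl]] e] := last_passage_attained W h1 h2.
case: s hp hl e => [|x s] /= hp hl e; first by move: uv; rewrite -hl /= eqxx.
move: hp e => /andP[st hp] e.
have := up_right_path_le hp; rewrite hl => /andP[k1 k2].
exists x; split=> //; apply/eqP; rewrite eq_le last_passage_ge_front//.
rewrite e big_cons/= andbT lerD2l.
by apply: path_weight_le; exists s.
Qed.

Lemma last_passage_row W a b i : (a <= i)%N ->
  last_passage W (a, b) (i.+1, b) = last_passage W (a, b) (i, b) + W (i.+1, b).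
Proof.
move=> ai; have [||/=|[c d] [/orP[] /eqP[? ?] k1 k2 ->]]//=:=
  @last_passage_back W (a, b) (i.+1, b).
- exact: leqW.
- by apply/eqP => -[]; lia.
- by subst.
- by subst; move: k2 => /=; lia.
Qed.

Lemma last_passage_col W a b j : (b <= j)%N ->
  last_passage W (a, b) (a, j.+1) = last_passage W (a, b) (a, j) + W (a, j.+1).
Proof.
move=> ai; have [||/=|[c d] [/orP[] /eqP[? ?] k1 k2 ->]]//=:=
  @last_passage_back W (a, b) (a, j.+1).
- exact: leqW.
- by apply/eqP => -[]; lia.
- by subst; move: k1 => /=; lia.
- by subst.
Qed.

Lemma last_passage_rec W a b i j : (a <= i)%N -> (b <= j)%N ->
  last_passage W (a, b) (i.+1, j.+1) =
  Num.max (last_passage W (a, b) (i, j.+1)) (last_passage W (a, b) (i.+1, j))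
  + W (i.+1, j.+1).
Proof.
move=> ai bj; apply/eqP; rewrite eq_le; apply/andP; split.
  have [||/=|[c d] [/orP[] /eqP[-> ->] k1 k2 ->]]//=:=
    @last_passage_back W (a, b) (i.+1, j.+1).
  + exact: leqW.
  + exact: leqW.
  + by apply/eqP => -[]; lia.
  + by rewrite lerD2r le_max lexx.
  + by rewrite lerD2r le_max lexx orbT.
by rewrite -lerBrDr ge_max !lerBrDr !last_passage_ge_back//=
  /up_right_step/= ?eqxx ?orbT// leqW.
Qed.

Lemma last_passage_front_row W a b i : (a < i)%N ->
  last_passage W (a, b) (i, b) = W (a, b) + last_passage W (a.+1, b) (i, b).
Proof.
move=> ai; have [||/=|[c d] [/orP[] /eqP[-> ->] k1 k2 ->]]//=:=
  @last_passage_front W (a, b) (i, b).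
- exact: ltnW.
- by apply/eqP => -[]; lia.
- by move: k2 => /=; lia.
Qed.

Lemma last_passage_front_col W a b j : (b < j)%N ->
  last_passage W (a, b) (a, j) = W (a, b) + last_passage W (a, b.+1) (a, j).
Proof.
move=> ai; have [||/=|[c d] [/orP[] /eqP[-> ->] k1 k2 ->]]//=:=
  @last_passage_front W (a, b) (a, j).
- exact: ltnW.
- by apply/eqP => -[]; lia.
- by move: k1 => /=; lia.
Qed.

Lemma last_passage_front_rec W a b i j : (a < i)%N -> (b < j)%N ->
  last_passage W (a, b) (i, j) = W (a, b) +
  Num.max (last_passage W (a.+1, b) (i, j)) (last_passage W (a, b.+1) (i, j)).
Proof.
move=> ai bj; apply/eqP; rewrite eq_le; apply/andP; split.
  have [||/=|[c d] [/orP[] /eqP[-> ->] k1 k2 ->]]//=:=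
    @last_passage_front W (a, b) (i, j).
  + exact: ltnW.
  + exact: ltnW.
  + by apply/eqP => -[]; lia.
  + by rewrite lerD2l le_max lexx.
  + by rewrite lerD2l le_max lexx orbT.
by rewrite -lerBrDl ge_max !lerBrDl !last_passage_ge_front//=
  /up_right_step/= ?eqxx ?orbT// ltnW.
Qed.

(** Induction over the sites of a quadrant, along the recursion satisfied by
  passage times. *)
Lemma quadrant_ind a b (Q : nat -> nat -> Prop) : Q a b ->
  (forall i, (a <= i)%N -> Q i b -> Q i.+1 b) ->
  (forall j, (b <= j)%N -> Q a j -> Q a j.+1) ->
  (forall i j, (a <= i)%N -> (b <= j)%N ->
     Q i j.+1 -> Q i.+1 j -> Q i.+1 j.+1) ->
  forall i j, (a <= i)%N -> (b <= j)%N -> Q i j.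
Proof.
move=> q0 qr qc qs i j /subnK <- /subnK <-.
move: (i - a)%N (j - b)%N => {i j} k l.
elim: k l => [|k IHk] l.
  by elim: l => // l IH; rewrite addSn; apply: qc => //; rewrite leq_addl.
elim: l => [|l IHl].
  by rewrite addSn; apply: qr (IHk 0%N); rewrite leq_addl.
rewrite !addSn; apply: qs; rewrite ?leq_addl//.
by have := IHk l.+1; rewrite addSn.
Qed.

Lemma last_passage_mono W W' a b i j : (a <= i)%N -> (b <= j)%N ->
  (forall k l, (a <= k <= i)%N -> (b <= l <= j)%N -> W (k, l) <= W' (k, l)) ->
  last_passage W (a, b) (i, j) <= last_passage W' (a, b) (i, j).
Proof.
move=> ai bj; move: i j ai bj; apply: quadrant_ind.
- by move=> h; rewrite !last_passage_refl h// !leqnn.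
- move=> i ai IH h; rewrite !last_passage_row// lerD//; last by apply: h; lia.
  by apply: IH => k l hk hl; apply: h; lia.
- move=> j bj IH h; rewrite !last_passage_col// lerD//; last by apply: h; lia.
  by apply: IH => k l hk hl; apply: h; lia.
- move=> i j ai bj IH1 IH2 h; rewrite !last_passage_rec// lerD//; last first.
    by apply: h; lia.
  rewrite ge_max !le_max; apply/andP; split; apply/orP; [left|right].
    by apply: IH1 => k l hk hl; apply: h; lia.
  by apply: IH2 => k l hk hl; apply: h; lia.
Qed.

Lemma last_passage_eq W W' a b i j : (a <= i)%N -> (b <= j)%N ->
  (forall k l, (a <= k <= i)%N -> (b <= l <= j)%N -> W (k, l) = W' (k, l)) ->
  last_passage W (a, b) (i, j) = last_passage W' (a, b) (i, j).
Proof.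
move=> ai bj h; apply/eqP; rewrite eq_le.
by apply/andP; split; apply: last_passage_mono => // k l hk hl; rewrite h.
Qed.

Lemma last_passage_ge0 W a b i j : (a <= i)%N -> (b <= j)%N ->
  (forall k l, (a <= k <= i)%N -> (b <= l <= j)%N -> 0 <= W (k, l)) ->
  0 <= last_passage W (a, b) (i, j).
Proof.
move=> ai bj; move: i j ai bj; apply: quadrant_ind.
- by move=> h; rewrite !last_passage_refl h// !leqnn.
- move=> i ai IH h; rewrite !last_passage_row// addr_ge0//; last by apply: h; lia.
  by apply: IH => k l hk hl; apply: h; lia.
- move=> j bj IH h; rewrite !last_passage_col// addr_ge0//; last by apply: h; lia.
  by apply: IH => k l hk hl; apply: h; lia.
- move=> i j ai bj IH1 IH2 h; rewrite !last_passage_rec// addr_ge0//; last first.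
    by apply: h; lia.
  by rewrite le_max IH1// => k l hk hl; apply: h; lia.
Qed.

Lemma last_passage_transpose W a b i j : (a <= i)%N -> (b <= j)%N ->
  last_passage (fun q => W (q.2, q.1)) (b, a) (j, i) =
  last_passage W (a, b) (i, j).
Proof.
move=> ai bj; move: i j ai bj; apply: quadrant_ind.
- by rewrite !last_passage_refl.
- by move=> i ai IH; rewrite last_passage_row// last_passage_col//= IH.
- by move=> j bj IH; rewrite last_passage_row// last_passage_col//= IH.
- by move=> i j ai bj IH1 IH2; rewrite !last_passage_rec//= IH1 IH2 maxC.
Qed.

Lemma last_passage_reverse W M N a b i j :
  (a <= i)%N -> (b <= j)%N -> (i <= M)%N -> (j <= N)%N ->
  last_passage (fun q => W (M - q.1, N - q.2)%N) (M - i, N - j)%N (M - a, N - b)%N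
  = last_passage W (a, b) (i, j).
Proof.
move=> ai bj; move: i j ai bj; apply: quadrant_ind.
- by move=> aM bN; rewrite !last_passage_refl/= !subKn.
- move=> i ai IH iM bN; rewrite last_passage_row// last_passage_front_row/=; last by lia.
  by rewrite subKn// subKn// addrC -IH// ?(ltnW iM)// -subSn// subSS.
- move=> j bj IH aM jN; rewrite last_passage_col// last_passage_front_col/=; last by lia.
  by rewrite subKn// subKn// addrC -IH// ?(ltnW jN)// -subSn// subSS.
- move=> i j ai bj IH1 IH2 iM jN; rewrite last_passage_rec//.
  rewrite last_passage_front_rec/=; [|lia|lia].
  rewrite subKn// subKn// addrC -IH1 -?IH2//; [|lia|lia].
  by rewrite -!subSn// !subSS.
Qed.

(** The indices 0, 1, 2 stand for the lower left, lower right and upper left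
  corners of a unit square: the comparison of two models passes from the lower and
  left edges to the upper and right edges. *)
Lemma increments_mono (v0 v1 v2 b0 b1 b2 w : R) :
  v1 - v0 <= b1 - b0 -> b2 - b0 <= v2 - v0 ->
  Num.max v2 v1 + w - v2 <= Num.max b2 b1 + w - b2 /\
  Num.max b2 b1 + w - b1 <= Num.max v2 v1 + w - v1.
Proof. by case: (leP v2 v1) => h1; case: (leP b2 b1) => h2; lra. Qed.

(** Starting from (0, 1) instead of (1, 1) adds a column on the left, which favours
  steps upwards: horizontal increments shrink and vertical ones grow, site by
  site. *)
Lemma last_passage_ver_increments W i j : (1 <= i)%N -> (1 <= j)%N ->
  last_passage W (0, 1)%N (i.+1, j) - last_passage W (0, 1)%N (i, j) <=
  last_passage W (1, 1)%N (i.+1, j) - last_passage W (1, 1)%N (i, j) /\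
  last_passage W (1, 1)%N (i, j.+1) - last_passage W (1, 1)%N (i, j) <=
  last_passage W (0, 1)%N (i, j.+1) - last_passage W (0, 1)%N (i, j).
Proof.
pose V i j := last_passage W (0, 1)%N (i, j).
pose B i j := last_passage W (1, 1)%N (i, j).
have Vr k l : (1 <= l)%N -> V k.+1 l.+1 = Num.max (V k l.+1) (V k.+1 l) + W (k.+1, l.+1).
  by move=> l1; rewrite /V last_passage_rec.
have Br k l : (1 <= k)%N -> (1 <= l)%N ->
    B k.+1 l.+1 = Num.max (B k l.+1) (B k.+1 l) + W (k.+1, l.+1).
  by move=> k1 l1; rewrite /B last_passage_rec.
have V1 k : V k.+1 1%N = V k 1%N + W (k.+1, 1%N) by exact: last_passage_row.
have B1 k : (1 <= k)%N -> B k.+1 1%N = B k 1%N + W (k.+1, 1%N).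
  exact: last_passage_row.
have B2 l : (1 <= l)%N -> B 1%N l.+1 = B 1%N l + W (1%N, l.+1).
  exact: last_passage_col.
have J1 l : (1 <= l)%N -> B 1%N l.+1 - B 1%N l <= V 1%N l.+1 - V 1%N l.
  move=> l1; rewrite B2// Vr//.
  have : V 1%N l <= Num.max (V 0%N l.+1) (V 1%N l) by rewrite le_max lexx orbT.
  by lra.
have I1 k : (1 <= k)%N -> V k.+1 1%N - V k 1%N <= B k.+1 1%N - B k 1%N.
  by move=> k1; rewrite V1 B1//; lra.
rewrite -!/(V _ _) -!/(B _ _); move: i j; apply: quadrant_ind.
- by split; [exact: I1|exact: J1].
- move=> k k1 [h1 h2]; split; first exact: I1.
  by rewrite Vr// Br//; exact: (increments_mono _ h1 h2).2.
- move=> l l1 [h1 h2]; split; last exact: J1.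
  by rewrite Vr// Br//; exact: (increments_mono _ h1 h2).1.
- move=> k l k1 l1 [h1 h2] [h3 h4]; rewrite !Vr// !Br//; try exact: leqW.
  split; first by have := (increments_mono (W (k.+2, l.+1)) h3 h4).1; rewrite -!Vr// -!Br.
  by have := (increments_mono (W (k.+1, l.+2)) h1 h2).2; rewrite -!Vr// -!Br.
Qed.

Lemma last_passage_ver_crossing W i m n : (1 <= i <= m)%N -> (1 <= n)%N ->
  last_passage W (0, 1)%N (m, n) - last_passage W (0, 1)%N (i, n) <=
  last_passage W (1, 1)%N (m, n) - last_passage W (1, 1)%N (i, n).
Proof.
move=> /andP[i1 /subnK <-] n1; elim: (m - i)%N => [|k IH]; first by rewrite !subrr.
have := (last_passage_ver_increments W (leq_trans i1 (leq_addl k i)) n1).1.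
by rewrite addSn; lra.
Qed.

(** The witness k is the column in which a maximal path leaves the bottom row. *)
Lemma last_passage_exit_row W a m n : (a <= m)%N -> (1 <= n)%N ->
  exists2 k, (a <= k <= m)%N & last_passage W (a, 0)%N (m, n) =
    \sum_(a <= i < k.+1) W (i, 0%N) + last_passage W (k, 1)%N (m, n).
Proof.
move=> am n1; move: am => /subnK; move: (m - a)%N => k.
elim: k a => [|k IH] a kE.
  exists a; first by rewrite -kE add0n leqnn.
  by rewrite big_nat1 -kE add0n last_passage_front_col.
rewrite last_passage_front_rec//; last by rewrite -kE addSn ltnS leq_addl.
case: leP => _.
  by exists a; rewrite ?big_nat1// -kE leqnn leq_addl.
have [|l /andP[l1 l2] ->] := IH a.+1; first by rewrite -kE addSnnS.
exists l; first by rewrite (ltnW l1).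
by rewrite addrA [in RHS](big_ltn (m := a))// ltnS ltnW.
Qed.

Lemma last_passage_ge_exit_row W a k m n : (a <= k <= m)%N -> (1 <= n)%N ->
  \sum_(a <= i < k.+1) W (i, 0%N) + last_passage W (k, 1)%N (m, n) <=
  last_passage W (a, 0)%N (m, n).
Proof.
move=> /andP[ak km] n1; move: ak => /subnK; move: (k - a)%N => l.
elim: l a => [|l IH] a kE.
  rewrite -kE add0n big_nat1; apply: last_passage_ge_front => //=.
    by rewrite -kE in km.
  by rewrite /up_right_step/= eqxx orbT.
rewrite big_ltn; last by lia.
rewrite -addrA (le_trans _ (@last_passage_ge_front _ _ (a.+1, 0%N) _ _ _ _))//=; last 2 first.
- by lia.
- by rewrite /up_right_step/= eqxx.
by rewrite lerD2l; apply: IH; lia.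
Qed.

End LastPassage.

(** * Independence tested on boxes *)

Section Independence.
Context {R : realType} d (T : measurableType d) (P : probability T R).
Context (I : eqType).
Implicit Types (s : seq I) (X : I -> T -> R) (A : I -> set R)
  (mu : I -> probability R R).

Definition box s X A : set T := \big[setI/setT]_(i <- s) (X i @^-1` A i).

(** Measurability is required on s only, so that families indexed by the whole
  lattice can be cut down to finite lists of sites. *)
Definition jointly s X mu : Prop :=
  [/\ uniq s,
      forall i, i \in s -> measurable_fun setT (X i) &
      forall A, (forall i, measurable (A i)) ->
        P (box s X A) = (\prod_(i <- s) mu i (A i))%E].

(** A pi-system, so that two measures which agree on boxes agree on the
  sigma-algebra generated by the family. *)
Definition boxes s X : set (set T) :=
  [set B | exists2 A, (forall i, measurable (A i)) & B = box s X A].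

Local Notation generated s X := (g_sigma_algebraType (boxes s X)).

Lemma measurable_box s X A :
  (forall i, i \in s -> measurable_fun setT (X i)) ->
  (forall i, measurable (A i)) -> measurable (box s X A).
Proof.
move=> mX mA; rewrite /box; elim: s mX => [|i s IH] mX; first by rewrite big_nil.
rewrite big_cons; apply: measurableI; last first.
  by apply: IH => j js; apply: mX; rewrite inE js orbT.
by rewrite -[X in measurable X]setTI; apply: mX => //; rewrite mem_head.
Qed.

Lemma boxI s X A B : box s X A `&` box s X B = box s X (fun i => A i `&` B i).
Proof.
by rewrite /box -big_split /=; apply: eq_bigr => i _; rewrite preimage_setI.
Qed.

Lemma box_setT s X : box s X (fun=> setT) = setT.
Proof. by rewrite /box big1// => i _; rewrite preimage_setT. Qed.

Lemma boxes_measurable s X : (forall i, i \in s -> measurable_fun setT (X i)) ->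
  boxes s X `<=` measurable.
Proof. by move=> mX _ [A mA ->]; exact: measurable_box. Qed.

Lemma measurable_generated_id s X :
  (forall i, i \in s -> measurable_fun setT (X i)) ->
  measurable_fun setT (fun t : T => t : generated s X).
Proof.
move=> mX; apply: (@measurability _ _ _ (generated s X) _ _ (boxes s X)) => //.
by move=> _ [_ [A mA ->] <-]; rewrite setTI preimage_id; exact: measurable_box.
Qed.


Lemma box_set1 s X i B : i \in s ->
  box s X (fun j => if j == i then B else setT) = X i @^-1` B.
Proof.
move=> si; rewrite /box; elim: s si => // j s IH; rewrite inE big_cons.
have [is_|ins] := boolP (i \in s).
  by move=> _; rewrite IH//; case: eqP => [->|_]; rewrite ?setIid// preimage_setT setTI.
rewrite orbF => /eqP <-; rewrite eqxx big1_seq ?setIT// => k /andP[_ ks].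
by case: eqP ks ins => [->->//|_ _ _]; rewrite preimage_setT.
Qed.

Lemma measurable_generated s X i : i \in s ->
  measurable_fun setT (X i : generated s X -> R).
Proof.
move=> si _ B mB; rewrite setTI; apply: sub_sigma_algebra.
exists (fun j => if j == i then B else setT); last by rewrite box_set1.
by move=> j; case: ifP.
Qed.

Section Conditioning.
Variables (i : I) (s : seq I) (X : I -> T -> R) (mu : I -> probability R R).
Hypothesis jX : jointly (i :: s) X mu.

Let mXi : measurable_fun setT (X i).
Proof. by have [_ + _] := jX; apply; rewrite mem_head. Qed.

Let mXs j : j \in s -> measurable_fun setT (X j).
Proof. by move=> js; have [_ + _] := jX; apply; rewrite inE js orbT. Qed.

(** Both sides are measures in B that agree on boxes. *)
Lemma jointly_indep_generated (A : set R) (B : set T) : measurable A ->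
  <<s boxes s X >> B -> P (X i @^-1` A `&` B) = (mu i A * P B)%E.
Proof.
move=> mA; have mXA : measurable (X i @^-1` A).
  by rewrite -[X in measurable X]setTI; exact: mXi.
have mu_fin : mu i A \is a fin_num by exact: fin_num_measure.
pose k : {nonneg R} := NngNum (fine_ge0 (measure_ge0 (mu i) A)).
have kE : (k%:num)%:E = mu i A by rewrite /k /= fineK.
pose m1 : {measure set T -> \bar R} := mrestr P mXA.
pose m2 : {measure set T -> \bar R} := mscale k P.
move=> sB; suff : m1 B = m2 B.
  by rewrite /m1 /m2 /= /mrestr /mscale kE setIC.
have bI : setI_closed (boxes s X).
  move=> _ _ [A1 mA1 ->] [A2 mA2 ->]; rewrite boxI.
  by eexists; last reflexivity => //; move=> j; exact: measurableI.
apply: (g_sigma_algebra_measure_unique (boxes s X) _ (fun=> setT)) sB => //.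
- exact: boxes_measurable.
- by move=> _; exists (fun=> setT) => //; rewrite box_setT.
- by apply/seteqP; split=> // x _; exists 0%N.
- move=> _ [C mC ->]; rewrite /m1 /m2 /= /mrestr /mscale kE.
  have mixed (D : set R) : measurable D ->
      P (box s X C `&` X i @^-1` D) = (mu i D * \prod_(j <- s) mu j (C j))%E.
    move=> mD; have [/= /andP[ins _] _ jE] := jX.
    transitivity (P (box (i :: s) X (fun j => if j == i then D else C j))).
      rewrite /box big_cons eqxx setIC; congr (P (_ `&` _)).
      by apply: eq_big_seq => j js; case: eqP ins js => // -> /negbTE ->.
    rewrite jE; last by move=> j; case: ifP.
    rewrite big_cons eqxx; congr (_ * _)%E.
    by apply: eq_big_seq => j js; case: eqP ins js => // -> /negbTE ->.
  have := mixed setT measurableT; rewrite preimage_setT setIT probability_setT.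
  by rewrite mul1e => e; rewrite mixed// -e.
- by move=> _; rewrite /m1 /= /mrestr setTI (le_lt_trans (probability_le1 P mXA))// ltry.
Qed.


(** Fubini: X i is independent of the rest of the family.  The second factor of the
  product is the sample space itself with the sigma-algebra generated by the rest. *)
Lemma jointly_integral (h : (R * generated s X)%type -> \bar R) :
  measurable_fun setT h -> (forall x, (0 <= h x)%E) ->
  (\int[P]_t h (X i t, t : generated s X) =
   \int[P]_t \int[mu i]_x h (x, t : generated s X))%E.
Proof.
move=> mh h0.
pose G := generated s X.
have mid : measurable_fun setT (fun t : T => t : G) by exact: measurable_generated_id.
pose id' : {RV P >-> G} :=
  HB.pack (fun t : T => t : G) (isMeasurableFun.Build _ _ _ _ _ mid).
have mpair : measurable_fun setT (fun t : T => (X i t, t : G)).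
  exact: measurable_fun_pair.
pose pair' : {RV P >-> (R * G)%type} :=
  HB.pack (fun t : T => (X i t, t : G)) (isMeasurableFun.Build _ _ _ _ _ mpair).
have prodE B : measurable B ->
    (mu i \x distribution P id')%E B = distribution P pair' B.
  apply: product_measure_unique => A C mA mC.
  by rewrite /distribution /pushforward /= -jointly_indep_generated.
transitivity (\int[distribution P pair']_z h z)%E.
  by rewrite ge0_integral_distribution.
rewrite (eq_measure_integral (mu i \x distribution P id')%E); last first.
  by move=> B mB _; exact: esym (prodE _ mB).
rewrite fubini_tonelli2//= ge0_integral_distribution//.
- exact: measurable_fun_fubini_tonelli_G.
- by move=> t; apply: integral_ge0.
Qed.

End Conditioning.

Lemma jointly_tail i s X mu : jointly (i :: s) X mu -> jointly s X mu.
Proof.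
move=> [/= /andP[ins us] mX jE]; split=> // [j js|A mA].
  by apply: mX; rewrite inE js orbT.
have := jE (fun j => if j == i then setT else A j).
rewrite /box !big_cons eqxx preimage_setT setTI probability_setT mul1e => h.
transitivity (P (box s X (fun j => if j == i then setT else A j))).
  congr (P _); apply: eq_big_seq => j js.
  by case: eqP ins js => // -> /negbTE ->.
rewrite h; last by move=> j; case: ifP.
apply: eq_big_seq => j js.
by case: eqP ins js => // -> /negbTE ->.
Qed.

Lemma jointly_measurable i s X mu : jointly s X mu -> i \in s ->
  measurable_fun setT (X i).
Proof. by case=> _ + _; apply. Qed.

Lemma measurable_generated_box s X A : (forall i, measurable (A i)) ->
  measurable (box s X A : set (generated s X)).
Proof. by move=> mA; apply: sub_sigma_algebra; exists A. Qed.

Lemma measurable_generated_sub_box s s' X A : {subset s <= s'} ->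
  (forall i, measurable (A i)) -> measurable (box s X A : set (generated s' X)).
Proof.
move=> ss' mA; rewrite /box; elim: s ss' => [|i s IH] ss'.
  by rewrite big_nil; exact: (@measurableT _ (generated s' X)).
rewrite big_cons; apply: (@measurableI _ (generated s' X)); last first.
  by apply: IH => j js; apply: ss'; rewrite inE js orbT.
rewrite -[X in measurable X]setTI; apply: measurable_generated => //.
by apply: ss'; rewrite mem_head.
Qed.

Lemma jointly_integral1 i s X mu A (h : R -> \bar R) :
  jointly (i :: s) X mu -> (forall i, measurable (A i)) ->
  measurable_fun setT h -> (forall x, 0 <= h x)%E ->
  (\int[P]_t (h (X i t) * (\1_(box s X A) t)%:E) =
   (\int[mu i]_x h x) * P (box s X A))%E.
Proof.
move=> jX mA mh h0.
have mB : measurable (box s X A).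
  by apply: measurable_box => // j js; apply: jointly_measurable (jointly_tail jX) js.
rewrite (jointly_integral jX (h := fun z => (h z.1 * (\1_(box s X A) z.2)%:E)%E)).
- transitivity (\int[P]_t ((\int[mu i]_x h x) * (\1_(box s X A) t)%:E))%E.
    by apply: eq_integral => t _; rewrite /= ge0_integralZr// lee_fin.
  rewrite ge0_integralZl//; [|exact/measurable_EFinP/measurable_indic|exact: integral_ge0].
  by rewrite integral_indic// setIT.
- apply: emeasurable_funM; first exact: measurableT_comp.
  apply/measurable_EFinP; apply: measurableT_comp => //.
  by apply: measurable_indic; exact: measurable_generated_box.
- by move=> z; rewrite mule_ge0// lee_fin.
Qed.

(** The three variables are integrated out one after the other; the later ones still
  belong to the generated sigma-algebra when the first is removed. *)
Lemma jointly_integral3 i j k s X mu A (h : R * (R * R) -> \bar R) :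
  jointly [:: i, j, k & s] X mu -> (forall i, measurable (A i)) ->
  measurable_fun setT h -> (forall x, 0 <= h x)%E ->
  (\int[P]_t (h (X i t, (X j t, X k t)) * (\1_(box s X A) t)%:E) =
   (\int[mu k]_o \int[mu j]_y \int[mu i]_x h (x, (y, o))) * P (box s X A))%E.
Proof.
move=> jX mA mh h0; set B := box s X A.
have jX1 := jointly_tail jX; have jX2 := jointly_tail jX1.
have mBk : measurable (B : set (generated (k :: s) X)).
  by apply: measurable_generated_sub_box => // l ls; rewrite inE ls orbT.
have mBjk : measurable (B : set (generated (j :: k :: s) X)).
  by apply: measurable_generated_sub_box => // l ls; rewrite !inE ls !orbT.
pose K1 (z : R * R) := (\int[mu i]_x h (x, z))%E.
have mK1 : measurable_fun setT K1 by exact: measurable_fun_fubini_tonelli_G.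
have K10 z : (0 <= K1 z)%E by exact: integral_ge0.
pose K2 o := (\int[mu j]_y K1 (y, o))%E.
have mK2 : measurable_fun setT K2 by exact: measurable_fun_fubini_tonelli_G.
have K20 z : (0 <= K2 z)%E by exact: integral_ge0.
transitivity (\int[P]_t (K1 (X j t, X k t) * (\1_B t)%:E))%E.
  rewrite (jointly_integral jX
    (h := fun z => (h (z.1, (X j z.2, X k z.2)) * (\1_B z.2)%:E)%E)).
  - apply: eq_integral => t _; rewrite /= ge0_integralZr// ?lee_fin//.
    by apply: measurableT_comp => //; exact: measurable_fun_pair.
  - apply: emeasurable_funM.
      apply: measurableT_comp => //; apply: measurable_fun_pair => //.
      apply: measurable_fun_pair.
        by apply: measurableT_comp => //; apply: measurable_generated; rewrite !inE eqxx ?orbT.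
      by apply: measurableT_comp => //; apply: measurable_generated; rewrite !inE eqxx ?orbT.
    by apply/measurable_EFinP; apply: measurableT_comp.
  - by move=> z; rewrite mule_ge0// lee_fin.
transitivity (\int[P]_t (K2 (X k t) * (\1_B t)%:E))%E.
  rewrite (jointly_integral jX1
    (h := fun z => (K1 (z.1, X k z.2) * (\1_B z.2)%:E)%E)).
  - apply: eq_integral => t _; rewrite /= ge0_integralZr// ?lee_fin//.
    by apply: measurableT_comp => //; exact: measurable_fun_pair.
  - apply: emeasurable_funM.
      apply: measurableT_comp => //; apply: measurable_fun_pair => //.
      by apply: measurableT_comp => //; apply: measurable_generated; rewrite !inE eqxx ?orbT.
    by apply/measurable_EFinP; apply: measurableT_comp.
  - by move=> z; rewrite mule_ge0// lee_fin.
exact: jointly_integral1.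
Qed.

End Independence.

(** * The exponential law *)

Lemma integral_density {R : realType} d (T : measurableType d)
    (nu : {finite_measure set T -> \bar R})
    (mu : {sigma_finite_measure set T -> \bar R}) (rho : T -> R) (f : T -> \bar R) :
  measurable_fun setT rho -> (forall t, 0 <= rho t) ->
  (forall A, measurable A -> nu A = \int[mu]_(t in A) (rho t)%:E)%E ->
  measurable_fun setT f -> (forall t, 0 <= f t)%E ->
  (\int[nu]_t f t = \int[mu]_t (f t * (rho t)%:E))%E.
Proof.
move=> mrho rho0 nuE mf f0.
have dom : nu `<< mu.
  apply/null_content_dominatesP => A mA A0.
  rewrite nuE//; rewrite -[RHS](@integral_abs_eq0 _ _ _ mu A (EFin \o rho))//.
    by apply: eq_integral => t _; rewrite /= ger0_norm.
  exact/measurable_EFinP/measurable_funTS.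
rewrite -(Radon_Nikodym_SigmaFinite.change_of_variables dom)//.
apply: ae_eq_integral => //.
- apply: emeasurable_funM => //.
  exact: measurable_int (Radon_Nikodym_SigmaFinite.f_integrable dom).
- by apply: emeasurable_funM => //; exact/measurable_EFinP.
- apply: ae_eqe_mul2l.
  apply: integral_ae_eq => //.
  + exact: Radon_Nikodym_SigmaFinite.f_integrable.
  + exact/measurable_EFinP.
  + by move=> E _ mE; rewrite -nuE// -Radon_Nikodym_SigmaFinite.f_integral.
Qed.

Section Exponential.
Context {R : realType}.
Implicit Types (r a y : R) (f : R -> \bar R).

(** Two measurable structures on the real line have the same measurable sets; this
  identity moves a law from one to the other. *)
Definition idTR : measurableTypeR R -> R := idfun.

HB.instance Definition _ :=
  @isMeasurableFun.Build _ _ _ _ idTR (@measurable_id _ _ setT).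

(** Defined for every rate, so that laws can be attached to sites without carrying
  positivity proofs; the point mass is a default value. *)
Definition expo r : probability R R :=
  match pselect (0 < r) with
  | left r0 => distribution
    (exponential_distribution_exponential_prob__canonical__probability_measure_Probability r0) idTR
  | right _ => \d_(0 : R)
  end.

Lemma expoE r A : 0 < r -> expo r A = exponential_prob r A.
Proof. by move=> r0; rewrite /expo; case: pselect. Qed.

Lemma integral_expo_pdf r f : 0 < r -> measurable_fun setT f ->
  (forall x, 0 <= f x)%E ->
  (\int[expo r]_x f x =
   \int[lebesgue_measure]_x (f x * (exponential_pdf r x)%:E))%E.
Proof.
move=> r0 mf f0; rewrite /expo; case: pselect => // h.
rewrite ge0_integral_distribution//.
apply: (@integral_density _ _ (measurableTypeR R)) => //.
- exact: measurable_exponential_pdf.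
- by move=> x; apply: exponential_pdf_ge0; exact: ltW.
Qed.

Lemma expo_neg r : 0 < r -> expo r `]-oo, 0[%classic = 0%E.
Proof.
move=> r0; rewrite expoE// /exponential_prob integral0_eq// => x.
by rewrite /= in_itv/= => x0; rewrite lt0_exponential_pdf.
Qed.

Lemma expo_itv0c r a : 0 < r -> 0 <= a ->
  expo r `[0, a]%classic = (1 - expR (- r * a))%:E.
Proof.
move=> r0; rewrite expoE// le_eqVlt => /orP[/eqP<-|a0].
  rewrite mulr0 expR0 subrr /exponential_prob set_itv1.
  exact: (@integral_set1 _ (EFin \o exponential_pdf r)).
by rewrite exponential_prob_itv0c// EFinB.
Qed.

Lemma expo_ray r a : 0 < r -> 0 <= a ->
  expo r `]a, +oo[%classic = (expR (- r * a))%:E.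
Proof.
move=> r0 a0; rewrite -setCitvl probability_setC//.
have -> : `]-oo, a]%classic = `]-oo, 0[ `|` `[0, a] :> set R.
  apply/seteqP; split=> x /=; rewrite !in_itv/=; last by case; lra.
  by case: (ltP x 0); lra.
have -> : expo r (`]-oo, 0[ `|` `[0, a])%classic = (1 - expR (- r * a))%:E.
  rewrite -[RHS]add0e -(expo_neg r0) -expo_itv0c//; apply: measureU => //.
  by apply/seteqP; split=> // x []/=; rewrite !in_itv/=; lra.
by rewrite -[1%E]/(1%:E) -EFinB; congr EFin; ring.
Qed.

Lemma expo_ray_neg r a : 0 < r -> a < 0 -> expo r `]a, +oo[%classic = 1%E.
Proof.
move=> r0 a0; rewrite -setCitvl probability_setC//.
suff -> : expo r `]-oo, a]%classic = 0%E by rewrite sube0.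
apply: (subset_measure0 _ _ _ (expo_neg r0)) => // x /=.
by rewrite !in_itv/=; lra.
Qed.

Lemma integral_expo_gt0 r f : 0 < r -> measurable_fun setT f ->
  (forall x, 0 <= f x)%E ->
  (\int[expo r]_x f x = \int[expo r]_(x in `]0%R, +oo[) f x)%E.
Proof.
move=> r0 mf f0; rewrite -setCitvl -setTD.
apply: ge0_negligible_integral => //.
rewrite -[LHS](@fineK _ (expo r _)); last exact: fin_num_measure.
have := probability_setC (expo r) (measurable_itv `]-oo, (0:R)]).
rewrite setCitvl expo_ray// mulr0 expR0 -[expo r _]fineK; last exact: fin_num_measure.
by rewrite -[1%E]/(1%:E) -EFinB => -[] h; congr EFin; move: h; lra.
Qed.

Lemma expo_memoryless r y f : 0 < r -> 0 <= y -> measurable_fun setT f ->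
  (forall x, 0 <= f x)%E ->
  (\int[expo r]_(x in `]y, +oo[) f x =
   (expR (- r * y))%:E * \int[expo r]_(x in `]0%R, +oo[) f (x + y)%R)%E.
Proof.
move=> r0 y0 mf f0.
have mshift : measurable_fun setT (fun x : R => x + y) by exact: measurable_funD.
pose shift : {RV (expo r) >-> R} :=
  HB.pack (fun x : R => x + y) (isMeasurableFun.Build _ _ _ _ _ mshift).
pose k : {nonneg R} := NngNum (expR_ge0 (- r * y)).
pose D : set R := `]y, +oo[%classic.
have mD : measurable D by exact: measurable_itv.
pose m1 : {measure set R -> \bar R} := mrestr (expo r) mD.
pose m2 : {measure set R -> \bar R} := mrestr (mscale k (distribution (expo r) shift)) mD.
have rays (a : R) : m1 `]a, +oo[%classic = m2 `]a, +oo[%classic.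
  have -> : m1 `]a, +oo[%classic = expo r `]Num.max a y, +oo[%classic.
    congr (expo r _); apply/seteqP; split=> x; rewrite /D /= !in_itv/= !andbT gt_max.
      by case=> -> ->.
    by move/andP.
  have -> : m2 `]a, +oo[%classic =
      ((expR (- r * y))%:E * expo r `](Num.max a y - y)%R, +oo[%classic)%E.
    congr (_ * expo r _)%E; apply/seteqP; split=> x; rewrite /D /= !in_itv/= !andbT ltrBlDr gt_max.
      by case=> -> ->.
    by move/andP.
  have h : y <= Num.max a y by rewrite le_max lexx orbT.
  rewrite !expo_ray//; [|lra|lra].
  by rewrite -EFinM -expRD; congr (expR _)%:E; ring.
have m12 A : measurable A -> m1 A = m2 A.
  apply: (@measure_unique _ R R (@RGenOInfty.G R)
    (fun n => `](- n%:R)%R, +oo[%classic)).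
  - exact: RGenOInfty.measurableE.
  - move=> _ _ [a ->] [b ->]; exists (Num.max a b).
    apply/seteqP; split=> x/=; rewrite !in_itv/= !andbT gt_max.
      by case=> -> ->.
    by move/andP.
  - by move=> n; exists (- n%:R).
  - apply/seteqP; split=> // x _; exists (Num.bound `|x|) => //=.
    rewrite in_itv/= andbT ltrNl (le_lt_trans _ (archi_boundP _))//.
    by rewrite -normrN ler_norm.
  - by move=> _ [a ->]; exact: rays.
  - by move=> n; rewrite rays -rays (le_lt_trans (probability_le1 _ _))// ?ltry//; exact: measurableI.
transitivity (\int[m1]_(x in D) f x)%E.
  by apply: eq_measure_integral => A mA AD; rewrite /m1/= /mrestr setIidl.
transitivity (\int[m2]_(x in D) f x)%E.
  by apply: eq_measure_integral => A mA AD; exact: m12.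
transitivity (\int[mscale k (distribution (expo r) shift)]_(x in D) f x)%E.
  by apply: eq_measure_integral => A mA AD; rewrite /m2/= /mrestr setIidl.
rewrite ge0_integral_mscale//; last exact: measurable_funTS.
congr (_ * _)%E; rewrite ge0_integral_pushforward//; last exact: measurable_funTS.
have -> // : shift @^-1` D = `]0%R, +oo[%classic.
by apply/seteqP; split=> x; rewrite /D /= !in_itv/= !andbT; lra.
Qed.

(** Tilting an exponential density gives an exponential density. *)
Lemma integral_expo_tilt r a f : 0 < r -> 0 < r + a -> measurable_fun setT f ->
  (forall x, 0 <= f x)%E ->
  (\int[expo r]_x ((expR (- a * x))%:E * f x) =
   (r / (r + a))%:E * \int[expo (r + a)]_x f x)%E.
Proof.
move=> r0 ra0 mf f0; have mexp : measurable_fun setT (fun x : R => expR (- a * x)).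
  by apply: measurableT_comp => //; exact: measurable_funM.
rewrite !integral_expo_pdf//; last 2 first.
- by apply: emeasurable_funM => //; exact/measurable_EFinP.
- by move=> x; rewrite mule_ge0// lee_fin expR_ge0.
rewrite -ge0_integralZl//; last 3 first.
- apply: emeasurable_funM => //; apply/measurable_EFinP.
  exact: measurable_exponential_pdf.
- by move=> x _; rewrite mule_ge0// lee_fin exponential_pdf_ge0// ltW.
- by rewrite lee_fin divr_ge0// ltW.
apply: eq_integral => x _.
rewrite -muleA [LHS]muleCA [RHS]muleCA -!EFinM; congr (_ * _%:E)%E.
have [x0|x0] := ltP x 0; first by rewrite !lt0_exponential_pdf// !(mulr0, mul0r).
rewrite !exponential_pdfE//.
have -> : - (r + a) * x = - r * x + - a * x by ring.
rewrite expRD; field; lra.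
Qed.

Lemma expo_set1 r a : 0 < r -> expo r [set a] = 0%E.
Proof.
move=> r0; rewrite expoE// /exponential_prob.
exact: (@integral_set1 _ (EFin \o exponential_pdf r)).
Qed.

(** Competing exponential clocks: after the first one rings, the other starts
  afresh, and the time of the first ring is exponential of the total rate. *)
Lemma expo_race (a b : R) (F : R * R -> \bar R) : 0 < a -> 0 < b ->
  measurable_fun setT F -> (forall z, 0 <= F z)%E ->
  (\int[expo b]_y \int[expo a]_x F (x, y) =
   (b / (a + b))%:E * \int[expo (a + b)]_o \int[expo a]_x F ((x + o)%R, o) +
   (a / (a + b))%:E * \int[expo (a + b)]_o \int[expo b]_y F (o, (y + o)%R))%E.
Proof.
move=> a0 b0 mF F0.
pose F1 (z : R * R) := (F z * (\1_[set z | z.2 < z.1] z)%:E)%E.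
pose F2 (z : R * R) := (F z * (\1_[set z | z.1 <= z.2] z)%:E)%E.
have half (c d : R) (H : R * R -> \bar R) : 0 < c -> 0 < d ->
    measurable_fun setT H -> (forall z, 0 <= H z)%E ->
    (\int[expo d]_y \int[expo c]_(x in `]y, +oo[) H (x, y) =
    (d / (c + d))%:E * \int[expo (c + d)]_y \int[expo c]_x H ((x + y)%R, y))%E.
  move=> c0 d0 mH H0.
  pose K y := (\int[expo c]_x H ((x + y)%R, y))%E.
  have mK : measurable_fun setT K.
    apply: (@measurable_fun_fubini_tonelli_G _ _ _ _ _ (expo c)
      (fun z => H ((z.1 + z.2)%R, z.2))) => //.
    by apply: measurableT_comp => //; apply: measurable_fun_pair => //;
      exact: measurable_funD.
  have K0 y : (0 <= K y)%E by exact: integral_ge0.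
  pose H' (z : R * R) := (H z * (\1_[set z | z.2 < z.1] z)%:E)%E.
  have mH' : measurable_fun setT H'.
    apply: emeasurable_funM => //; apply/measurable_EFinP/measurable_indic.
    rewrite -[X in measurable X]setTI; exact: measurable_fun_ltr.
  have H'0 z : (0 <= H' z)%E by rewrite mule_ge0// lee_fin.
  have H'E y : (\int[expo c]_(x in `]y, +oo[) H (x, y) = \int[expo c]_x H' (x, y))%E.
    rewrite integral_mkcond; apply: eq_integral => x _.
    rewrite epatch_indic /H' /= !indicE; congr (_ * (_ : bool)%:R%:E)%E.
    by rewrite !mem_setE/= in_itv/= andbT.
  transitivity (\int[expo d]_y ((expR (- c * y))%:E * K y))%E; last first.
    by rewrite integral_expo_tilt ?[d + c]addrC// addr_gt0.
  under eq_integral do rewrite H'E.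
  rewrite [LHS]integral_expo_gt0//; [|exact: (measurable_fun_fubini_tonelli_G (m1 := expo c) H' mH' H'0)|by move=> y; exact: integral_ge0].
  rewrite [RHS]integral_expo_gt0//; last 2 first.
  - apply: emeasurable_funM => //; apply/measurable_EFinP.
    by apply: measurableT_comp => //; exact: measurable_funM.
  - by move=> y; rewrite mule_ge0// lee_fin expR_ge0.
  apply: eq_integral => y; rewrite inE/= in_itv/= andbT => y0.
  rewrite -H'E expo_memoryless ?ltW//; last exact: measurableT_comp.
  congr (_ * _)%E; rewrite -integral_expo_gt0//.
  apply: measurableT_comp => //; apply: measurable_fun_pair => //.
  exact: measurable_funD.
have mlt : measurable [set z : R * R | z.2 < z.1].
  rewrite -[X in measurable X]setTI; exact: measurable_fun_ltr.
have mle : measurable [set z : R * R | z.1 <= z.2].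
  rewrite -[X in measurable X]setTI; exact: measurable_fun_ler.
have mF1 : measurable_fun setT F1.
  by apply: emeasurable_funM => //; exact/measurable_EFinP/measurable_indic.
have mF2 : measurable_fun setT F2.
  by apply: emeasurable_funM => //; exact/measurable_EFinP/measurable_indic.
have F10 z : (0 <= F1 z)%E by rewrite mule_ge0// lee_fin.
have F20 z : (0 <= F2 z)%E by rewrite mule_ge0// lee_fin.
have FE z : F z = (F1 z + F2 z)%E.
  rewrite /F1 /F2 -ge0_muleDr ?lee_fin// -EFinD !indicE.
  have [h|h] := ltP z.2 z.1.
    by rewrite mem_set// memNset ?addr0 ?mule1//=; apply/negP; rewrite -ltNge.
  by rewrite memNset ?mem_set ?add0r ?mule1//=; apply/negP; rewrite -leNgt.
transitivity (\int[expo b]_y ((\int[expo a]_x F1 (x, y)) + \int[expo a]_x F2 (x, y)))%E.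
  apply: eq_integral => y _; rewrite -ge0_integralD//; last 2 first.
  - exact: measurableT_comp.
  - exact: measurableT_comp.
  by apply: eq_integral => x _; exact: FE.
rewrite ge0_integralD//; last 4 first.
- by move=> y _; exact: integral_ge0.
- exact: (measurable_fun_fubini_tonelli_G (m1 := expo a) F1 mF1 F10).
- by move=> y _; exact: integral_ge0.
- exact: (measurable_fun_fubini_tonelli_G (m1 := expo a) F2 mF2 F20).
congr (_ + _)%E.
  rewrite -half//; apply: eq_integral => y _.
  rewrite [RHS]integral_mkcond; apply: eq_integral => x _.
  rewrite epatch_indic /F1 /= !indicE; congr (_ * (_ : bool)%:R%:E)%E.
  by rewrite !mem_setE/= in_itv/= andbT.
rewrite -(fubini_tonelli (m1 := expo a) (m2 := expo b) F2)// /fubini_F.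
rewrite [a + b]addrC -(half b a (fun z => F (z.2, z.1)))//; last first.
  by apply: measurableT_comp => //; exact: measurable_fun_pair.
apply: eq_integral => x _.
have mFx : measurable_fun setT (fun y => F (x, y)) by exact: measurableT_comp.
transitivity (\int[expo b]_(y in `[x, +oo[) F (x, y))%E.
  rewrite [RHS]integral_mkcond; apply: eq_integral => y _.
  rewrite epatch_indic /F2 /= !indicE; congr (_ * (_ : bool)%:R%:E)%E.
  by rewrite !mem_setE/= in_itv/= andbT.
rewrite (@ge0_negligible_integral _ _ _ _ _ [set x])//; last 2 first.
- exact: measurable_funTS.
- exact: expo_set1.
congr (integral _ _ _); apply/seteqP; split=> y /=; rewrite !in_itv/= !andbT.
  by move=> [xy /eqP yx]; rewrite lt_neqAle xy eq_sym yx.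
by move=> xy; split; [exact: ltW|move=> yx; rewrite yx ltxx in xy].
Qed.

End Exponential.

(** * Burke's property for three exponential variables *)

Lemma integral_probability_cst {R : realType} d (T : measurableType d)
  (Q : probability T R) (c : \bar R) : (\int[Q]_t c = c)%E.
Proof. transitivity (c * Q setT)%E; first exact: (integral_cst Q measurableT).
by rewrite [Q _]probability_setT mule1. Qed.

Section Burke.
Context {R : realType}.
Implicit Types (u : R) (A B : set R).

(** The map (x, y, o) -> (o + (x - y)^+, o + (y - x)^+) sends the increments entering
  a vertex and its weight to the increments leaving it. *)
Definition burke_indicator A B (z : R * (R * R)) : \bar R :=
  (\1_A (z.2.2 + Num.max (z.1 - z.2.1) 0) *
   \1_B (z.2.2 + Num.max (z.2.1 - z.1) 0))%:E.

Lemma measurable_burke_indicator A B : measurable A -> measurable B ->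
  measurable_fun setT (burke_indicator A B).
Proof.
move=> mA mB.
have m1A : measurable_fun setT (\1_A : R -> R) by exact: measurable_indic.
have m1B : measurable_fun setT (\1_B : R -> R) by exact: measurable_indic.
apply/measurable_EFinP; apply: measurable_funM.
  apply: (measurableT_comp m1A).
  apply: measurable_funD; first exact: measurableT_comp.
  apply: measurable_maxr => //; apply: measurable_funB => //.
  exact: measurableT_comp.
apply: (measurableT_comp m1B).
apply: measurable_funD; first exact: measurableT_comp.
apply: measurable_maxr => //; apply: measurable_funB => //.
exact: measurableT_comp.
Qed.

Lemma burke_indicator_ge0 A B z : (0 <= burke_indicator A B z)%E.
Proof. by rewrite lee_fin mulr_ge0. Qed.

(** By [expo_race], min (x, y) is exponential of rate u + (1 - u) = 1, like o, and
  independent of the excess of the larger variable.  Hence o may be exchanged for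
  min (x, y), and then o + (x - y)^+ and o + (y - x)^+ become x and y. *)
Lemma burke_integral u A B : 0 < u < 1 -> measurable A -> measurable B ->
  (\int[expo 1]_o \int[expo (1 - u)]_y \int[expo u]_x
     burke_indicator A B (x, (y, o)) = expo u A * expo (1 - u) B)%E.
Proof.
move=> /andP[u0 u1] mA mB; have v0 : 0 < 1 - u by lra.
have m1A : measurable_fun setT (\1_A : R -> R) by exact: measurable_indic.
have m1B : measurable_fun setT (\1_B : R -> R) by exact: measurable_indic.
have mh := measurable_burke_indicator mA mB.
have h0 := burke_indicator_ge0 A B.
have uv : u + (1 - u) = 1 by lra.
pose f1 o := (\int[expo u]_x (\1_A (x + o) * \1_B o : R)%:E)%E.
pose f2 o := (\int[expo (1 - u)]_y (\1_A o * \1_B (y + o) : R)%:E)%E.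
have mF1 : measurable_fun setT (fun z : R * R => (\1_A (z.1 + z.2) * \1_B z.2 : R)%:E).
  apply/measurable_EFinP; apply: measurable_funM.
    by apply: (measurableT_comp m1A); exact: measurable_funD.
  exact: (measurableT_comp m1B).
have mF2 : measurable_fun setT (fun z : R * R => (\1_A z.2 * \1_B (z.1 + z.2) : R)%:E).
  apply/measurable_EFinP; apply: measurable_funM.
    exact: (measurableT_comp m1A).
  by apply: (measurableT_comp m1B); exact: measurable_funD.
have mf1 : measurable_fun setT f1.
  by apply: (measurable_fun_fubini_tonelli_G (m1 := expo u) _ mF1) => z; rewrite lee_fin mulr_ge0.
have mf2 : measurable_fun setT f2.
  by apply: (measurable_fun_fubini_tonelli_G (m1 := expo (1 - u)) _ mF2) => z; rewrite lee_fin mulr_ge0.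
have f10 o : (0 <= f1 o)%E by apply: integral_ge0 => x _; rewrite lee_fin mulr_ge0.
have f20 o : (0 <= f2 o)%E by apply: integral_ge0 => x _; rewrite lee_fin mulr_ge0.
transitivity ((1 - u)%:E * \int[expo 1]_o f1 o + u%:E * \int[expo 1]_o f2 o)%E.
  rewrite -!ge0_integralZl//; [|by rewrite lee_fin ltW..].
  rewrite -ge0_integralD//; last 4 first.
  - by move=> o _; rewrite mule_ge0// lee_fin ltW.
  - exact: measurable_funeM.
  - by move=> o _; rewrite mule_ge0// lee_fin ltW.
  - exact: measurable_funeM.
  apply: eq_integral => o _.
  pose F (z : R * R) := burke_indicator A B (z.1, (z.2, o)).
  have mF : measurable_fun setT F.
    apply: measurableT_comp => //; apply: measurable_fun_pair => //.
    exact: measurable_fun_pair.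
  have F0 z : (0 <= F z)%E by exact: h0.
  have mFs1 (y : R) : measurable_fun setT (fun x : R => F (x + y, y)).
    apply: (measurableT_comp mF); apply: measurable_fun_pair => //.
    exact: measurable_funD.
  have mFs2 (y : R) : measurable_fun setT (fun x : R => F (y, x + y)).
    apply: (measurableT_comp mF); apply: measurable_fun_pair => //.
    exact: measurable_funD.
  have mfs1 : measurable_fun setT (fun x : R => (\1_A (x + o) * \1_B o : R)%:E).
    apply/measurable_EFinP; apply: measurable_funM => //.
    by apply: measurableT_comp => //; exact: measurable_funD.
  have mfs2 : measurable_fun setT (fun x : R => (\1_A o * \1_B (x + o) : R)%:E).
    apply/measurable_EFinP; apply: measurable_funM => //.
    by apply: measurableT_comp => //; exact: measurable_funD.
  rewrite (expo_race u0 v0 mF F0) uv !divr1; congr (_ * _ + _ * _)%E.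
    transitivity (\int[expo 1]_y (f1 o))%E; last first.
      exact: integral_probability_cst.
    apply: eq_integral => y _; rewrite /f1.
    rewrite [LHS]integral_expo_gt0//.
    rewrite [RHS]integral_expo_gt0//.
    apply: eq_integral => x; rewrite inE/= in_itv/= andbT => x0.
    rewrite /F /burke_indicator/=.
    have -> : o + Num.max (x + y - y) 0 = x + o.
      by rewrite addrK max_l; [ring|exact: ltW].
    have -> // : o + Num.max (y - (x + y)) 0 = o.
    by rewrite max_r; [ring|lra].
  transitivity (\int[expo 1]_y (f2 o))%E; last first.
    exact: integral_probability_cst.
  apply: eq_integral => y _; rewrite /f2.
  rewrite [LHS]integral_expo_gt0//.
  rewrite [RHS]integral_expo_gt0//.
  apply: eq_integral => x; rewrite inE/= in_itv/= andbT => x0.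
  rewrite /F /burke_indicator/=.
  have -> : o + Num.max (x + y - y) 0 = x + o.
    by rewrite addrK max_l; [ring|exact: ltW].
  have -> // : o + Num.max (y - (x + y)) 0 = o.
  by rewrite max_r; [ring|lra].
pose F (z : R * R) := (\1_A z.1 * \1_B z.2 : R)%:E.
have mF : measurable_fun setT F.
  apply/measurable_EFinP; apply: measurable_funM.
    exact: (measurableT_comp m1A).
  exact: (measurableT_comp m1B).
have F0 z : (0 <= F z)%E by rewrite lee_fin mulr_ge0.
have := expo_race u0 v0 mF F0; rewrite uv !divr1 => <-.
transitivity (\int[expo (1 - u)]_y ((expo u A) * (\1_B y : R)%:E))%E.
  apply: eq_integral => y _; rewrite /F/=.
  under eq_integral do rewrite EFinM.
  rewrite ge0_integralZr ?lee_fin//; last exact/measurable_EFinP.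
  by rewrite integral_indic// setIT.
rewrite ge0_integralZl//; last exact/measurable_EFinP.
by rewrite integral_indic// setIT.
Qed.

End Burke.

Section JointlyRearranged.
Context {R : realType} d (T : measurableType d) (P : probability T R).
Context (I : eqType).
Implicit Types (s : seq I) (X : I -> T -> R) (A : I -> set R)
  (mu : I -> probability R R).

Lemma jointly_perm s s' X mu : perm_eq s s' ->
  jointly P s X mu -> jointly P s' X mu.
Proof.
move=> ss' [us mX jE]; split.
- by rewrite -(perm_uniq ss').
- by move=> i; rewrite -(perm_mem ss'); exact: mX.
- move=> A mA; rewrite -(perm_big _ ss')/= -jE//.
  by congr (P _); rewrite /box (perm_big _ ss').
Qed.

Lemma jointly_sub s s' X mu : uniq s' -> {subset s' <= s} ->
  jointly P s X mu -> jointly P s' X mu.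
Proof.
move=> us' ss' jX; have us : uniq s by case: jX.
have : jointly P ([seq i <- s | i \notin s'] ++ s') X mu.
  apply: jointly_perm jX; apply: uniq_perm => //.
    rewrite cat_uniq filter_uniq//= us' andbT.
    by apply/hasPn => i is'; rewrite mem_filter/= is'.
  move=> i; rewrite mem_cat mem_filter.
  by case: (boolP (i \in s')) => [/ss' ->//|_]; rewrite orbF.
by move: [seq i <- s | i \notin s'] => r; elim: r => //= i l IH /jointly_tail/IH.
Qed.

Lemma jointly_eq s X X' mu mu' : {in s, forall i, X i = X' i} ->
  {in s, forall i, mu i = mu' i} -> jointly P s X mu -> jointly P s X' mu'.
Proof.
move=> XX' mumu' [us mX jE]; split=> //.
- by move=> i si; rewrite -XX'//; exact: mX.
- move=> A mA; transitivity (P (box s X A)).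
    by congr (P _); apply: eq_big_seq => i si; rewrite XX'.
  by rewrite jE//; apply: eq_big_seq => i si; rewrite mumu'.
Qed.

Lemma jointly_law s X mu i B : jointly P s X mu -> i \in s -> measurable B ->
  P (X i @^-1` B) = mu i B.
Proof.
move=> jX si mB.
have [_ _ jE] : jointly P [:: i] X mu.
  by apply: jointly_sub jX => // j; rewrite inE => /eqP ->.
by have := jE (fun=> B) (fun=> mB); rewrite /box !big_seq1.
Qed.

(** One vertex of the lattice: the increments entering it, together with its weight,
  are replaced by the increments leaving it, and nothing else in the family
  notices. *)
Lemma burke_flip (u : R) i j k s X X' mu : 0 < u < 1 ->
  mu i = expo u -> mu j = expo (1 - u) -> mu k = expo 1 ->
  X' i = (fun t => X k t + Num.max (X i t - X j t) 0) ->
  X' j = (fun t => X k t + Num.max (X j t - X i t) 0) ->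
  {in s, forall l, X l = X' l} ->
  jointly P [:: i, j, k & s] X mu -> jointly P [:: i, j & s] X' mu.
Proof.
move=> u01 mui muj muk Xi Xj Xs jX.
have [us mX jE] := jX.
have mXi : measurable_fun setT (X i) by apply: mX; rewrite !inE eqxx.
have mXj : measurable_fun setT (X j) by apply: mX; rewrite !inE eqxx ?orbT.
have mXk : measurable_fun setT (X k) by apply: mX; rewrite !inE eqxx ?orbT.
have mXi' : measurable_fun setT (X' i).
  rewrite Xi; apply: measurable_funD => //; apply: measurable_maxr => //.
  exact: measurable_funB.
have mXj' : measurable_fun setT (X' j).
  rewrite Xj; apply: measurable_funD => //; apply: measurable_maxr => //.
  exact: measurable_funB.
have jXs := jointly_tail (jointly_tail (jointly_tail jX)).
have [_ mXs jEs] := jXs.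
have mX' l : l \in [:: i, j & s] -> measurable_fun setT (X' l).
  by rewrite !inE => /or3P[/eqP ->|/eqP ->|ls] //; rewrite -Xs//; exact: mXs.
split=> //.
  move: us => /=; rewrite !inE !negb_or => /andP[/and3P[-> _ ->]] /andP[/andP[_ ->]].
  by case/andP.
move=> A mA.
transitivity (\int[P]_t (burke_indicator (A i) (A j) (X i t, (X j t, X k t)) *
    (\1_(box s X A) t)%:E))%E.
  transitivity (\int[P]_t (\1_(box [:: i, j & s] X' A) t)%:E)%E.
    by rewrite integral_indic ?setIT//; exact: measurable_box.
  apply: eq_integral => t _; rewrite /burke_indicator/= -EFinM; congr EFin.
  rewrite /box !big_cons !indicI /= Xi Xj mulrA; congr (_ * _ * \1_ _ _).
  by apply: eq_big_seq => l ls; rewrite Xs.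
rewrite (jointly_integral3 jX mA (measurable_burke_indicator (mA i) (mA j))
  (burke_indicator_ge0 _ _)).
rewrite mui muj muk burke_integral// !big_cons mui muj muleA.
by congr (_ * _)%E; exact: jEs.
Qed.

End JointlyRearranged.

(** * Stationarity of the model with two boundaries *)

Definition rect (m n : nat) : seq (nat * nat) :=
  [seq q <- [seq (a, b) | a <- iota 0 m.+1, b <- iota 0 n.+1] | q != (0%N, 0%N)].

Lemma mem_rect m n q :
  (q \in rect m n) = [&& (q.1 <= m)%N, (q.2 <= n)%N & q != (0%N, 0%N)].
Proof.
rewrite mem_filter andbC andbA; congr (_ && _); case: q => a b; rewrite [(a, b).1]/= [(a, b).2]/=.
apply/idP/idP.
  by move=> /allpairsPdep [x [y [+ + [-> ->]]]]; rewrite !mem_iota !ltnS /= => -> ->.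
move=> /andP[h1 h2]; apply/allpairsPdep; exists a, b.
by rewrite !mem_iota !ltnS h1 h2.
Qed.

Lemma rect_uniq m n : uniq (rect m n).
Proof.
by rewrite filter_uniq// allpairs_uniq ?iota_uniq// => -[? ?] [? ?] _ _ [-> ->].
Qed.

Section Stationary.
Context {R : realType} d (T : measurableType d) (P : probability T R).
Implicit Types (W : nat * nat -> T -> R).

Definition edge_law (a b : R) (q : nat * nat) : probability R R :=
  if q.2 == 0%N then expo a else if q.1 == 0%N then expo b else expo 1.

Definition expo_field m n (a b : R) W := jointly P (rect m n) W (edge_law a b).

Definition from_origin W v t : R :=
  last_passage (fun q => if q == (0%N, 0%N) then 0 else W q t) (0%N, 0%N) v.

Lemma from_origin0 W t : from_origin W (0%N, 0%N) t = 0.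
Proof. by rewrite /from_origin last_passage_refl eqxx. Qed.

Lemma from_origin_row W i t :
  from_origin W (i.+1, 0%N) t = from_origin W (i, 0%N) t + W (i.+1, 0%N) t.
Proof. by rewrite /from_origin last_passage_row. Qed.

Lemma from_origin_col W j t :
  from_origin W (0%N, j.+1) t = from_origin W (0%N, j) t + W (0%N, j.+1) t.
Proof. by rewrite /from_origin last_passage_col. Qed.

Lemma from_origin_rec W i j t : from_origin W (i.+1, j.+1) t =
  Num.max (from_origin W (i, j.+1) t) (from_origin W (i.+1, j) t) + W (i.+1, j.+1) t.
Proof. by rewrite /from_origin last_passage_rec. Qed.

Definition hor_increment W v t :=
  from_origin W v t - from_origin W (v.1.-1, v.2) t.

Definition ver_increment W v t :=
  from_origin W v t - from_origin W (v.1, v.2.-1) t.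

Section Sweep.
Variables (m n : nat) (W : nat * nat -> T -> R).

(** The staircase reached after j full rows and i vertices of the next one: the sites
  beyond it still carry their weights, and the sites of the two edges label the
  increments along it. *)
Definition sweep_sites i j := [seq q <- rect m n |
  [|| q.1 == 0, q.2 == 0, j.+1 < q.2 | (q.2 == j.+1) && (i < q.1)]%N].

Lemma mem_sweep_sites i j a b : ((a, b) \in sweep_sites i j) =
  [&& [|| a == 0, b == 0, j.+1 < b | (b == j.+1) && (i < a)]%N,
    (a <= m)%N, (b <= n)%N & (a != 0%N) || (b != 0%N)].
Proof. by rewrite mem_filter mem_rect xpair_eqE negb_and. Qed.

Lemma sweep_sites_uniq i j : uniq (sweep_sites i j).
Proof. by rewrite filter_uniq// rect_uniq. Qed.

Definition sweep i j (q : nat * nat) : T -> R :=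
  if q.2 == 0%N then hor_increment W (q.1, if (q.1 <= i)%N then j.+1 else j)
  else if q.1 == 0%N then
    ver_increment W (if (q.2 <= j)%N then m else if q.2 == j.+1 then i else 0%N, q.2)
  else W q.

Lemma sweep0 (q : nat * nat) : q \in rect m n -> W q = sweep 0 0 q.
Proof.
rewrite mem_rect; case: q => [[|a] [|b]] //= _; apply/funext => t.
- rewrite /sweep/= (_ : (if b.+1 == 1%N then 0%N else 0%N) = 0%N); last by case: ifP.
  by rewrite /ver_increment/= from_origin_col; ring.
- by rewrite /sweep/= /hor_increment/= !from_origin_row; ring.
Qed.

(** [burke_flip] at the vertex (i + 1, j + 1). *)
Lemma sweep_step (u : R) i j : 0 < u < 1 -> (i < m)%N -> (j < n)%N ->
  jointly P (sweep_sites i j) (sweep i j) (edge_law u (1 - u)) ->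
  jointly P (sweep_sites i.+1 j) (sweep i.+1 j) (edge_law u (1 - u)).
Proof.
move=> u01 im jn jS.
pose q1 := (i.+1, 0%N); pose q2 := (0%N, j.+1); pose q3 := (i.+1, j.+1).
pose s := [seq q <- sweep_sites i j | q \notin [:: q1; q2; q3]].
have us : uniq s by rewrite filter_uniq// sweep_sites_uniq.
have sE q : (q \in s) = (q \notin [:: q1; q2; q3]) && (q \in sweep_sites i j).
  by rewrite mem_filter.
have S1 : perm_eq (sweep_sites i j) [:: q1, q2, q3 & s].
  apply: uniq_perm.
  - exact: sweep_sites_uniq.
  - by rewrite /= us !inE !sE !inE /q1 /q2 /q3 !xpair_eqE /=; lia.
  - move=> [a b]; rewrite !inE sE !inE /q1 /q2 /q3 !xpair_eqE mem_sweep_sites.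
    lia.
have S2 : perm_eq [:: q1, q2 & s] (sweep_sites i.+1 j).
  apply: uniq_perm.
  - by rewrite /= us !inE !sE !inE /q1 /q2 /q3 !xpair_eqE /=; lia.
  - exact: sweep_sites_uniq.
  - move=> [a b]; rewrite !inE sE !inE /q1 /q2 /q3 !xpair_eqE !mem_sweep_sites.
    lia.
apply: (jointly_perm S2).
apply: (@burke_flip _ _ _ _ _ u q1 q2 q3 s (sweep i j)) => //.
- apply/funext => t; rewrite /sweep/= leqnn ltnn eqxx ltnn.
  rewrite /hor_increment /ver_increment/= from_origin_rec.
  set A := from_origin W (i, j.+1) t; set B := from_origin W (i.+1, j) t.
  set C := from_origin W (i, j) t.
  by case: (leP A B) => h; case: (leP (B - C - (A - C)) 0) => h'; lra.
- apply/funext => t; rewrite /sweep/= ltnn eqxx ltnn.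
  rewrite /hor_increment /ver_increment/= from_origin_rec.
  set A := from_origin W (i, j.+1) t; set B := from_origin W (i.+1, j) t.
  set C := from_origin W (i, j) t.
  by case: (leP A B) => h; case: (leP (A - C - (B - C)) 0) => h'; lra.
- move=> [a b]; rewrite sE mem_sweep_sites !inE /q1 /q2 /q3 !xpair_eqE /= => h.
  rewrite /sweep/=; case: eqP => b0.
    by congr hor_increment; congr pair; case: ifP; case: ifP => //; move: h; lia.
  case: eqP => // a0; congr ver_increment; congr pair.
  by case: ifP => // _; case: ifP => //; move: h; lia.
- exact: jointly_perm S1 jS.
Qed.

Lemma sweep_jointly (u : R) i j : 0 < u < 1 -> (i <= m)%N -> (j < n)%N ->
  jointly P (sweep_sites 0 j) (sweep 0 j) (edge_law u (1 - u)) ->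
  jointly P (sweep_sites i j) (sweep i j) (edge_law u (1 - u)).
Proof.
move=> u01 + jn jS; elim: i => // i IH im.
by apply: sweep_step => //; exact/IH/ltnW.
Qed.

Lemma sweep_row (u : R) j : 0 < u < 1 -> (j < n)%N ->
  jointly P (sweep_sites m j) (sweep m j) (edge_law u (1 - u)) ->
  jointly P (sweep_sites 0 j.+1) (sweep 0 j.+1) (edge_law u (1 - u)).
Proof.
move=> u01 jn jS.
have S1 : perm_eq (sweep_sites m j) (sweep_sites 0 j.+1).
  apply: uniq_perm; rewrite ?sweep_sites_uniq ?rect_uniq// => -[a b].
  by rewrite ?mem_sweep_sites ?mem_rect ?xpair_eqE /=; lia.
apply: jointly_eq (jointly_perm S1 jS) => // -[a b].
rewrite mem_sweep_sites => h.
rewrite /sweep/=; case: eqP => b0.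
  by congr hor_increment; congr pair; case: ifP; case: ifP => //; move: h; lia.
case: eqP => // a0; congr ver_increment; congr pair.
by do ![case: ifP => //]; move: h; lia.
Qed.

Lemma sweep_all (u : R) j : 0 < u < 1 -> (j <= n)%N ->
  expo_field m n u (1 - u) W ->
  jointly P (sweep_sites 0 j) (sweep 0 j) (edge_law u (1 - u)).
Proof.
move=> u01 + jW; elim: j => [_|j IH jn].
  have S1 : perm_eq (rect m n) (sweep_sites 0 0).
    apply: uniq_perm; rewrite ?sweep_sites_uniq ?rect_uniq// => -[a b].
    by rewrite ?mem_sweep_sites ?mem_rect ?xpair_eqE /=; lia.
  apply: jointly_eq (jointly_perm S1 jW) => // q.
  by rewrite mem_filter => /andP[_]; exact: sweep0.
by apply: sweep_row => //; apply: sweep_jointly => //; exact/IH/ltnW.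
Qed.

(** The staircase sweeps the rectangle one vertex at a time, from the incoming edges
  to the outgoing ones, and every step preserves independence and laws. *)
Theorem burke_stationarity (u : R) : 0 < u < 1 -> expo_field m n u (1 - u) W ->
  jointly P [seq q <- rect m n | (q.1 == 0%N) || (q.2 == 0%N)]
    (fun q => if q.2 == 0%N then hor_increment W (q.1, n)
              else ver_increment W (m, q.2)) (edge_law u (1 - u)).
Proof.
move=> u01 jW.
apply: (@jointly_sub _ _ _ _ _ (sweep_sites 0 n)).
- by rewrite filter_uniq// rect_uniq.
- by move=> [a b]; rewrite mem_filter mem_rect xpair_eqE mem_sweep_sites /=; lia.
apply: jointly_eq (sweep_all u01 (leqnn n) jW) => // -[a b].
rewrite mem_filter mem_rect /= !xpair_eqE => h.
rewrite /sweep/=; case: eqP => b0.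
  by congr hor_increment; congr pair; case: ifP => //; move: h; lia.
case: eqP => a0; last by exfalso; move: h; lia.
congr ver_increment; congr pair.
by do ![case: ifP => //]; move: h; lia.
Qed.

End Sweep.
End Stationary.

(** * The generating function of the stationary passage time *)

Lemma measurable_prod_seq {R : realType} d (T : measurableType d) (I : eqType)
    (s : seq I) (h : I -> T -> R) :
  (forall i, i \in s -> measurable_fun setT (h i)) ->
  measurable_fun setT (fun t => \prod_(i <- s) h i t).
Proof.
elim: s => [|i s IH] mh; first under eq_fun do rewrite big_nil.
  exact: measurable_cst.
under eq_fun do rewrite big_cons.
apply: measurable_funM; first by apply: mh; rewrite mem_head.
by apply: IH => j js; apply: mh; rewrite inE js orbT.
Qed.

Lemma indic_box {R : realType} d (T : measurableType d) (I : eqType) (s : seq I)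
    (X : I -> T -> R) (A : I -> set R) t :
  \1_(box s X A) t = \prod_(i <- s) \1_(A i) (X i t) :> R.
Proof.
rewrite /box; elim: s => [|i s IH]; first by rewrite !big_nil indicT.
by rewrite !big_cons indicI/= IH.
Qed.

Lemma jointly_integral_prod {R : realType} d (T : measurableType d)
    (P : probability T R) (I : eqType) (s : seq I) (X : I -> T -> R)
    (mu : I -> probability R R) (f : I -> R -> R) :
  jointly P s X mu -> (forall i, measurable_fun setT (f i)) ->
  (forall i x, 0 <= f i x) ->
  (\int[P]_t (\prod_(i <- s) f i (X i t))%:E =
   \prod_(i <- s) \int[mu i]_x (f i x)%:E)%E.
Proof.
move=> + mf f0; elim: s => [|i s IH] jX.
  under eq_integral do rewrite big_nil.
  by rewrite big_nil integral_probability_cst.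
have jXs := jointly_tail jX; rewrite big_cons -IH//.
pose g (t : g_sigma_algebraType (boxes s X)) := \prod_(j <- s) f j (X j t).
have mg : measurable_fun setT g.
  apply: measurable_prod_seq => j js; apply: measurableT_comp => //.
  exact: measurable_generated.
have g0 t : 0 <= g t by exact: prodr_ge0.
transitivity (\int[P]_t (f i (X i t) * g t)%:E)%E.
  by apply: eq_integral => t _; rewrite big_cons.
rewrite (jointly_integral jX (h := fun z => (f i z.1 * g z.2)%:E)).
- transitivity (\int[P]_t ((\int[mu i]_x (f i x)%:E) * (g t)%:E))%E.
    apply: eq_integral => t _ /=.
    under eq_integral do rewrite EFinM.
    rewrite ge0_integralZr// ?lee_fin//; first exact/measurable_EFinP.
    by move=> x _; rewrite lee_fin.
  rewrite ge0_integralZl//.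
  + apply/measurable_EFinP; rewrite /g.
    apply: measurable_prod_seq => j js; apply: measurableT_comp => //.
    exact: jointly_measurable jXs js.
  + by move=> t _; rewrite lee_fin.
  + by apply: integral_ge0 => x _; rewrite lee_fin.
- apply/measurable_EFinP; apply: measurable_funM; exact: measurableT_comp.
- by move=> z; rewrite lee_fin mulr_ge0.
Qed.

Section Tilt.
Context {R : realType} d (T : measurableType d) (P : probability T R).
Variable rho : T -> R.
Hypothesis mrho : measurable_fun setT rho.
Hypothesis rho0 : forall t, 0 <= rho t.
Hypothesis rho1 : (\int[P]_t (rho t)%:E = 1)%E.

Definition tilted (A : set T) : \bar R := (\int[P]_(t in A) (rho t)%:E)%E.

Let tilted0 : tilted set0 = 0%E.
Proof. exact: integral_set0. Qed.

Let tilted_ge0 A : (0 <= tilted A)%E.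
Proof. by apply: integral_ge0 => t _; rewrite lee_fin. Qed.

Let tilted_sigma_additive : semi_sigma_additive tilted.
Proof.
move=> F mF tF mUF; rewrite /tilted ge0_integral_bigcup//.
- apply: is_cvg_ereal_nneg_natsum_cond => n _ _.
  by apply: integral_ge0 => t _; rewrite lee_fin.
- exact/measurable_EFinP/measurable_funTS.
- by move=> t _; rewrite lee_fin.
Qed.

HB.instance Definition _ :=
  isMeasure.Build _ _ _ tilted tilted0 tilted_ge0 tilted_sigma_additive.

HB.instance Definition _ := @Measure_isProbability.Build _ _ R tilted rho1.

Definition tilted_probability : probability T R := tilted.

Lemma integral_tilted (f : T -> \bar R) : measurable_fun setT f ->
  (forall t, 0 <= f t)%E ->
  (\int[tilted_probability]_t f t = \int[P]_t (f t * (rho t)%:E))%E.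
Proof. by move=> mf f0; exact: integral_density. Qed.

End Tilt.

Section MGF.
Context {R : realType}.

Lemma integral_expo_expR (r a : R) : 0 < r -> a < r ->
  (\int[expo r]_x (expR (a * x))%:E = (r / (r - a))%:E)%E.
Proof.
move=> r0 ar.
have := @integral_expo_tilt R r (- a) (cst 1%E) r0.
rewrite integral_probability_cst mule1 => <- //; [|lra..].
by apply: eq_integral => x _; rewrite mule1 opprK.
Qed.

Section Stationary.
Context d (T : measurableType d).

Lemma measurable_from_origin (W : nat * nat -> T -> R) m n i j :
  (forall q, q \in rect m n -> measurable_fun setT (W q)) ->
  (i <= m)%N -> (j <= n)%N -> measurable_fun setT (from_origin W (i, j)).
Proof.
move=> mW; elim: i j => [|i IHi]; elim=> [|j IHj] im jn.
- have -> : from_origin W (0%N, 0%N) = (fun=> 0) by apply/funext=> t; exact: from_origin0.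
  exact: measurable_cst.
- rewrite (funext (from_origin_col W j)).
  by apply: measurable_funD; [exact/IHj/ltnW|apply: mW; rewrite mem_rect xpair_eqE jn].
- rewrite (funext (from_origin_row W i)).
  apply: measurable_funD; first exact/IHi/jn/ltnW.
  by apply: mW; rewrite mem_rect xpair_eqE im.
- rewrite (funext (from_origin_rec W i j)).
  apply: measurable_funD; last by apply: mW; rewrite mem_rect xpair_eqE im jn.
  by apply: measurable_maxr; [exact/IHi/jn/ltnW|exact/IHj/ltnW].
Qed.

Lemma from_origin_bottom (W : nat * nat -> T -> R) m t :
  from_origin W (m, 0%N) t = \sum_(1 <= a < m.+1) W (a, 0%N) t.
Proof.
elim: m => [|m IH]; first by rewrite from_origin0 big_geq.
by rewrite from_origin_row IH [RHS]big_nat_recr.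
Qed.

Lemma sum_ver_increment (W : nat * nat -> T -> R) m n t :
  \sum_(1 <= b < n.+1) ver_increment W (m, b) t =
  from_origin W (m, n) t - from_origin W (m, 0%N) t.
Proof.
elim: n => [|n IH]; first by rewrite subrr big_geq.
by rewrite big_nat_recr//= IH /ver_increment/=; ring.
Qed.

Variable P : probability T R.

Definition row_tilt (w z : R) (q : nat * nat) : R -> R :=
  if q.2 == 0%N then fun x => z / w * expR ((w - z) * x) else fun=> 1.

Lemma measurable_row_tilt w z q : measurable_fun setT (row_tilt w z q).
Proof.
rewrite /row_tilt; case: ifP => // _; apply: measurable_funM => //.
by apply: measurableT_comp => //; exact: measurable_funM.
Qed.

Lemma row_tilt_ge0 w z q x : 0 < w -> 0 < z -> 0 <= row_tilt w z q x.
Proof.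
rewrite /row_tilt; case: ifP => // _ w0 z0.
by rewrite mulr_ge0 ?expR_ge0// divr_ge0// ltW.
Qed.

(** The density is a product with one factor for each site of the bottom row, so it
  preserves independence and tilts Exp(w) into Exp(z) there. *)
Lemma tilted_expo_field m n w z (W : nat * nat -> T -> R) :
  0 < w < 1 -> 0 < z < 1 -> expo_field P m n w (1 - z) W ->
  exists Q : probability T R, expo_field Q m n z (1 - z) W /\
    forall f : T -> \bar R, measurable_fun setT f -> (forall t, 0 <= f t)%E ->
      (\int[Q]_t f t = \int[P]_t (f t *
        (\prod_(q <- rect m n) row_tilt w z q (W q t))%:E))%E.
Proof.
move=> /andP[w0 w1] /andP[z0 z1] jW.
have v0 : 0 < 1 - z by lra.
pose rho t := \prod_(q <- rect m n) row_tilt w z q (W q t).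
have r0 q x : 0 <= row_tilt w z q x by exact: row_tilt_ge0.
have mr q : measurable_fun setT (row_tilt w z q) by exact: measurable_row_tilt.
have rho0 t : 0 <= rho t by exact: prodr_ge0.
have mrho : measurable_fun setT rho.
  apply: measurable_prod_seq => q qr; apply: measurableT_comp => //.
  exact: jointly_measurable jW qr.
have tilt_law q A : measurable A ->
    (\int[edge_law w (1 - z) q]_x (\1_A x * row_tilt w z q x)%:E =
     edge_law z (1 - z) q A)%E.
  move=> mA; rewrite /edge_law /row_tilt; case: eqP => _; last first.
    under eq_integral do rewrite mulr1.
    by rewrite integral_indic// setIT.
  have h : w + (z - w) = z by ring.
  have := @integral_expo_tilt R w (z - w) (fun x => (\1_A x * (z / w))%:E) w0.
  rewrite h; move=> /(_ z0) H.
  transitivity (\int[expo w]_x ((expR (- (z - w) * x))%:E * (\1_A x * (z / w))%:E))%E.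
    apply: eq_integral => x _; rewrite -EFinM; congr EFin.
    by rewrite opprB; ring.
  rewrite {}H; last by move=> x; rewrite lee_fin mulr_ge0// divr_ge0// ltW.
    under eq_integral do rewrite EFinM.
    rewrite ge0_integralZr//; last 2 first.
    - exact/measurable_EFinP.
    - by rewrite lee_fin divr_ge0// ltW.
    rewrite integral_indic// setIT muleCA -EFinM.
    rewrite (_ : w / z * (z / w) = 1) ?mule1//; field; lra.
  apply/measurable_EFinP; exact: measurable_funM.
have rho1 : (\int[P]_t (rho t)%:E = 1)%E.
  rewrite (jointly_integral_prod jW)// big1// => q _.
  have := tilt_law q setT measurableT.
  rewrite probability_setT => <-; apply: eq_integral => x _.
  by rewrite indicT mul1r.
exists (tilted_probability mrho rho0 rho1); split; last first.
  by move=> f mf f0; rewrite integral_tilted.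
split; [exact: rect_uniq|by move=> q; exact: jointly_measurable jW|move=> A mA].
rewrite /= /tilted integral_mkcond.
transitivity (\int[P]_t (\prod_(q <- rect m n)
    (\1_(A q) (W q t) * row_tilt w z q (W q t)))%:E)%E.
  apply: eq_integral => t _; rewrite epatch_indic.
  transitivity ((rho t)%:E * (\prod_(q <- rect m n) \1_(A q) (W q t))%:E)%E.
    by congr (_ * _%:E)%E; exact: indic_box.
  by rewrite -EFinM big_split/= mulrC.
rewrite (@jointly_integral_prod _ _ _ _ _ _ _ _
  (fun q x => \1_(A q) x * row_tilt w z q x) jW).
- by apply: eq_bigr => q _; exact: tilt_law.
- by move=> q; apply: measurable_funM => //; exact: measurable_indic.
- by move=> q x; rewrite mulr_ge0.
Qed.

(** The change of measure of [tilted_expo_field] produces the stationary model of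
  rate z and cancels the contribution of the bottom row; what is left is a moment of
  the sum of the independent increments along the last column. *)
Theorem from_origin_mgf m n w z (W : nat * nat -> T -> R) :
  0 < w < 1 -> 0 < z < 1 -> expo_field P m n w (1 - z) W ->
  (\int[P]_t (expR ((w - z) * from_origin W (m, n) t))%:E =
   ((w / z) ^+ m * ((1 - z) / (1 - w)) ^+ n)%:E)%E.
Proof.
move=> w01 z01 jW; have [Q [jQ QP]] := tilted_expo_field w01 z01 jW.
have {w01} /andP[w0 w1] := w01; have /andP[z0 z1] := z01.
pose s := [seq (0%N, b) | b <- index_iota 1 n.+1].
pose f (q : nat * nat) x := expR ((w - z) * x).
have mf q : measurable_fun setT (f q).
  by apply: measurableT_comp => //; exact: measurable_funM.
have mW q : q \in rect m n -> measurable_fun setT (W q) by exact: jointly_measurable jW.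
have jS : jointly Q s (fun q => ver_increment W (m, q.2)) (edge_law z (1 - z)).
  apply: (jointly_eq _ _ (jointly_sub _ _ (burke_stationarity z01 jQ))).
  - by move=> _ /mapP[b + ->]; rewrite mem_index_iota; case: b.
  - by [].
  - by rewrite map_inj_uniq ?iota_uniq// => a b [].
  - move=> _ /mapP[b + ->]; rewrite mem_index_iota mem_filter mem_rect xpair_eqE /=; lia.
have sumV t : \prod_(q <- s) f q (ver_increment W (m, q.2) t) =
    expR ((w - z) * (from_origin W (m, n) t - from_origin W (m, 0%N) t)).
  by rewrite big_map /f -expR_sum -mulr_sumr sum_ver_increment.
have QV : (\int[Q]_t (expR ((w - z) *
    (from_origin W (m, n) t - from_origin W (m, 0%N) t)))%:E =
    (((1 - z) / (1 - w)) ^+ n)%:E)%E.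
  under eq_integral do rewrite -sumV.
  rewrite (@jointly_integral_prod _ _ _ _ _ _ _ _ f jS)//; last first.
    by move=> q x; exact: expR_ge0.
  rewrite big_map (eq_big_seq (fun=> ((1 - z) / (1 - w))%:E)); last first.
    move=> b; rewrite mem_index_iota => /andP[b1 _]; rewrite /edge_law/= gtn_eqF//.
    rewrite integral_expo_expR; [congr (_ / _)%:E; ring|lra|lra].
  by rewrite prodEFin prodr_const_nat subn1.
move: QV; rewrite QP; last 2 first.
- apply/measurable_EFinP; apply: measurableT_comp => //; apply: measurable_funM => //.
  by apply: measurable_funB; apply: (measurable_from_origin mW).
- by move=> t; rewrite lee_fin expR_ge0.
have prodT t : \prod_(q <- rect m n) row_tilt w z q (W q t) =
    (z / w) ^+ m * expR ((w - z) * from_origin W (m, 0%N) t).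
  pose row := [seq (a, 0%N) | a <- index_iota 1 m.+1].
  have hperm : perm_eq (rect m n) (row ++ [seq q <- rect m n | q.2 != 0%N]).
    apply: uniq_perm; first exact: rect_uniq.
      rewrite cat_uniq filter_uniq ?rect_uniq// andbT.
      rewrite map_inj_uniq ?iota_uniq//=; last by move=> a b [].
      by apply/hasPn => q; rewrite mem_filter => /andP[q2 _]; apply/mapP => -[a _ qE]; rewrite qE in q2.
    move=> [a b]; rewrite mem_cat [X in _ = _ || X]mem_filter !mem_rect xpair_eqE.
    have -> : ((a, b) \in row) = [&& (0 < a)%N, (a <= m)%N & b == 0%N].
      apply/mapP/and3P => [[c + [-> ->]]|[a0 am /eqP ->]].
        by rewrite mem_index_iota => /andP[].
      by exists a; rewrite ?mem_index_iota ?a0.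
    by move=> /=; lia.
  rewrite (perm_big _ hperm)/= big_cat/= [X in _ * X]big1_seq ?mulr1; last first.
    move=> q /andP[_]; rewrite mem_filter => /andP[/negbTE q2 _].
    by rewrite /row_tilt q2.
  rewrite big_map /row_tilt/= big_split/= prodr_const_nat subn1.
  by rewrite -expR_sum -mulr_sumr from_origin_bottom.
move=> QV; transitivity (((w / z) ^+ m)%:E * (((1 - z) / (1 - w)) ^+ n)%:E)%E; last first.
  by rewrite -EFinM.
rewrite -QV -ge0_integralZl//.
- apply: eq_integral => t _; rewrite prodT -!EFinM; congr EFin.
  rewrite [in RHS](mulrCA (expR _)) -expRD mulrA -exprMn.
  have -> : w / z * (z / w) = 1 by field; lra.
  by rewrite expr1n mul1r; congr expR; ring.
- apply: emeasurable_funM; apply/measurable_EFinP.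
    apply: measurableT_comp => //; apply: measurable_funM => //.
    by apply: measurable_funB; apply: (measurable_from_origin mW).
  apply: measurable_prod_seq => q qr; apply: measurableT_comp; last exact: mW.
  exact: measurable_row_tilt.
- by move=> t _; rewrite mule_ge0// lee_fin ?expR_ge0// prodr_ge0// => q _; exact: row_tilt_ge0.
- by rewrite lee_fin exprn_ge0// divr_ge0// ltW.
Qed.

End Stationary.

End MGF.

(** * The rate of the generating function *)

Section Exponent.
Context {R : realType}.
Implicit Types (zt u w z c q : R).

(** With m = gamma zt^2 and n = gamma (1 - zt)^2, the right side of [from_origin_mgf]
  multiplied by exp (- (w - z) gamma) is exp (gamma (exponent zt w - exponent zt z)). *)
Definition exponent zt u : R :=
  zt ^+ 2 * ln u - (1 - zt) ^+ 2 * ln (1 - u) - u.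

Lemma is_derive_exponent zt c u : 0 < u < 1 ->
  is_derive u (1:R) (fun x => exponent zt x - c * (x - zt) ^+ 3)
    ((u - zt) ^+ 2 / (u * (1 - u)) - 3 * c * (u - zt) ^+ 2).
Proof.
move=> /andP[u0 u1].
have d1 : is_derive u 1 (@ln R) u^-1 by exact: is_derive1_ln.
have d2 : is_derive u 1 (cst 1 - id : R -> R) (0 - 1) by exact: is_deriveB.
have d3 : is_derive u 1 (@ln R \o (cst 1 - id : R -> R)) ((1 - u)^-1 * (0 - 1)).
  apply: is_derive1_comp; apply: is_derive1_ln.
  by rewrite /GRing.add/= subr_gt0.
have d4 : is_derive u 1 (id - cst zt : R -> R) (1 - 0) by exact: is_deriveB.
have := is_deriveB (is_deriveB (is_deriveB (is_deriveZ (zt ^+ 2) d1)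
  (is_deriveZ ((1 - zt) ^+ 2) d3)) (is_derive_id u 1)) (is_deriveZ c (is_deriveX 3 d4)).
set F := (X in is_derive _ _ X _); set D := (X in is_derive _ _ _ X) => h.
have FE : (fun x => exponent zt x - c * (x - zt) ^+ 3) = F.
  apply/funext => x; rewrite /F /exponent !fctE /=; reflexivity.
rewrite FE; suff -> : (u - zt) ^+ 2 / (u * (1 - u)) - 3 * c * (u - zt) ^+ 2 = D by [].
rewrite /D /GRing.scale/= (_ : (id - cst zt : R -> R) u = u - zt)//.
by field; apply/andP; split; apply/eqP; lra.
Qed.

(** The derivative of the exponent is (u - zt)^2 / (u (1 - u)); subtracting
  c (u - zt)^3 first leaves a remainder whose sign is that of 1 / (u (1 - u)) - 3 c. *)
Lemma exponent_MVT zt c w z : 0 < z -> z <= w -> w < 1 ->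
  exists2 u, z <= u <= w &
    exponent zt w - exponent zt z = c * ((w - zt) ^+ 3 - (z - zt) ^+ 3) +
    ((u - zt) ^+ 2 * ((u * (1 - u))^-1 - 3 * c)) * (w - z).
Proof.
move=> z0 zw w1.
have hd u : z <= u <= w -> is_derive u (1:R) (fun x => exponent zt x - c * (x - zt) ^+ 3)
    ((u - zt) ^+ 2 / (u * (1 - u)) - 3 * c * (u - zt) ^+ 2).
  by move=> /andP[zu uw]; apply: is_derive_exponent; apply/andP; split; lra.
have [||u] := @MVT_segment R (fun x => exponent zt x - c * (x - zt) ^+ 3)
    (fun u => (u - zt) ^+ 2 / (u * (1 - u)) - 3 * c * (u - zt) ^+ 2) z w zw.
- by move=> x; rewrite in_itv/= => /andP[h1 h2]; apply: hd; rewrite !ltW.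
- apply: derivable_within_continuous => x; rewrite in_itv/= => h.
  by have [] := hd _ h.
rewrite in_itv/= => uin e; exists u => //; move: e.
set A := (u - zt) ^+ 2; set B := (u * (1 - u))^-1; lra.
Qed.

(** Because u (1 - u) <= 1 / 4. *)
Lemma exponent_ge zt w z : 0 < z -> z <= w -> w < 1 ->
  4 / 3 * ((w - zt) ^+ 3 - (z - zt) ^+ 3) <= exponent zt w - exponent zt z.
Proof.
move=> z0 zw w1; have [u /andP[zu uw] ->] := exponent_MVT zt (4 / 3) z0 zw w1.
rewrite lerDl mulr_ge0 ?subr_ge0//; apply: mulr_ge0; first exact: sqr_ge0.
have h : 0 < u * (1 - u) by apply: mulr_gt0; lra.
rewrite subr_ge0 (_ : 3 * (4 / 3) = (4^-1)^-1); last by field.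
rewrite lef_pV2 ?posrE//; have := sqr_ge0 (u - 1 / 2); lra.
Qed.

(** Because u (1 - u) >= q / 4 between q / 2 and 1 - q / 2. *)
Lemma exponent_le zt q w z : 0 < q -> q <= 1 -> q / 2 <= z -> z <= w ->
  w <= 1 - q / 2 ->
  exponent zt w - exponent zt z <= 4 / (3 * q) * ((w - zt) ^+ 3 - (z - zt) ^+ 3).
Proof.
move=> q0 q1 z0 zw w1; have [||u /andP[zu uw] ->] := @exponent_MVT zt (4 / (3 * q)) w z _ zw _; [lra|lra|].
rewrite gerDl; apply: mulr_le0_ge0; last lra.
apply: mulr_ge0_le0; first exact: sqr_ge0.
have h : q / 4 <= u * (1 - u).
  have h1 : 0 <= (u - q / 2) * (1 - q / 2 - u) by apply: mulr_ge0; lra.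
  have h2 : 0 <= q * (1 - q) by apply: mulr_ge0; lra.
  nra.
rewrite subr_le0 (_ : 3 * (4 / (3 * q)) = (q / 4)^-1); last by field; lra.
rewrite lef_pV2 ?posrE//; lra.
Qed.

End Exponent.

(** * Transport of independent families *)

Section Transport.
Context {R : realType} d (T : measurableType d) (P : probability T R).

Lemma jointly_map (I : eqType) (s : seq I) (X : I -> T -> R)
    (mu mu' : I -> probability R R) (phi : I -> R -> R) :
  (forall i, i \in s -> measurable_fun setT (phi i)) ->
  (forall i A, i \in s -> measurable A -> mu i (phi i @^-1` A) = mu' i A) ->
  jointly P s X mu -> jointly P s (fun i => phi i \o X i) mu'.
Proof.
move=> mphi mumu' [us mX jE]; split=> //.
  by move=> i si; apply: measurableT_comp; [exact: mphi|exact: mX].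
move=> A mA.
transitivity (P (box s X (fun i => if i \in s then phi i @^-1` A i else setT))).
  by congr (P _); apply: eq_big_seq => i ->.
rewrite jE; last first.
  move=> i; case: ifP => // si; rewrite -[X in measurable X]setTI.
  exact: mphi.
by apply: eq_big_seq => i si; rewrite si; exact: mumu'.
Qed.

Lemma jointly_reindex (I J : eqType) (s : seq J) (sigma : J -> I) (tau : I -> J)
    (X : I -> T -> R) (mu : I -> probability R R) :
  {in s, cancel sigma tau} -> jointly P (map sigma s) X mu ->
  jointly P s (fun j => X (sigma j)) (fun j => mu (sigma j)).
Proof.
move=> st [us mX jE]; split.
- exact: map_uniq us.
- by move=> j js; apply: mX; exact: map_f.
- move=> A mA; have := jE (fun i => A (tau i)) (fun i => mA _).
  rewrite /box !big_map => h; transitivity (P (\big[setI/setT]_(j <- s)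
      (X (sigma j) @^-1` A (tau (sigma j))))).
    by congr (P _); apply: eq_big_seq => j js; rewrite st.
  by rewrite h; apply: eq_big_seq => j js; rewrite st.
Qed.

(** Rays generate the Borel sets, so tails determine the law of phi. *)
Lemma expo_map (r s : R) (phi : R -> R) (A : set R) : measurable_fun setT phi ->
  (forall a, expo r (phi @^-1` `]a, +oo[) = expo s `]a, +oo[%classic) ->
  measurable A -> expo r (phi @^-1` A) = expo s A.
Proof.
move=> mphi rays mA.
pose phi' : {RV (expo r) >-> R} :=
  HB.pack phi (isMeasurableFun.Build _ _ _ _ _ mphi).
move: A mA; apply: (@measure_unique _ R R (@RGenOInfty.G R)
    (fun n => `](- n%:R)%R, +oo[%classic) _ _ _ _ (distribution (expo r) phi') (expo s)).
- exact: RGenOInfty.measurableE.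
- move=> _ _ [a ->] [b ->]; exists (Num.max a b).
  apply/seteqP; split=> x/=; rewrite !in_itv/= !andbT gt_max.
    by case=> -> ->.
  by move/andP.
- by move=> n; exists (- n%:R).
- apply/seteqP; split=> // x _; exists (Num.bound `|x|) => //=.
  rewrite in_itv/= andbT ltrNl (le_lt_trans _ (archi_boundP _))//.
  by rewrite -normrN ler_norm.
- by move=> _ [a ->]; exact: rays.
- by move=> n; rewrite (le_lt_trans (probability_le1 _ _))// ltry.
Qed.

Lemma expo_scale (r s : R) (A : set R) : 0 < r -> 0 < s -> measurable A ->
  expo r ((fun x => r * x / s) @^-1` A) = expo s A.
Proof.
move=> r0 s0 mA; apply: expo_map => // [|a].
  by apply: measurable_funM => //; exact: measurable_funM.
have -> : (fun x => r * x / s) @^-1` `]a, +oo[ = `](a * s / r), +oo[%classic.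
  apply/seteqP; split=> x /=; rewrite !in_itv/= !andbT.
    by rewrite ltr_pdivlMr// ltr_pdivrMr// [x * r]mulrC.
  by rewrite ltr_pdivlMr// ltr_pdivrMr// [x * r]mulrC.
have [a0|a0] := leP 0 a.
  have h : 0 <= a * s / r by rewrite divr_ge0 ?mulr_ge0// ltW.
  by rewrite !expo_ray//; congr (expR _)%:E; field; lra.
rewrite !expo_ray_neg// -mulrA nmulr_rlt0// divr_gt0//.
Qed.

Lemma expo_pos (r : R) (A : set R) : 0 < r -> measurable A ->
  expo r ((fun x => Num.max 0 x) @^-1` A) = expo r A.
Proof.
move=> r0 mA; apply: expo_map => // [|a]; first exact: measurable_maxr.
have [a0|a0] := leP 0 a.
  congr (expo r _); apply/seteqP; split=> x /=; rewrite !in_itv/= !andbT lt_max.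
    by case/orP => //; lra.
  by move=> ->; rewrite orbT.
rewrite expo_ray_neg// -(probability_setT (expo r)); congr (expo r _).
by apply/seteqP; split=> x //= _; rewrite in_itv/= andbT lt_max a0.
Qed.

Lemma markov_expR (Y : T -> R) (c : R) : measurable_fun setT Y ->
  (\int[P]_t (expR (Y t))%:E <= c%:E)%E -> (P [set t | (0 <= Y t)%R] <= c%:E)%E.
Proof.
move=> mY; apply: le_trans.
have mD : measurable [set t | (0 <= Y t)%R].
  rewrite -[X in measurable X]setTI; exact: measurable_fun_ler.
rewrite -(setIT [set t | _]) -integral_indic//.
apply: ge0_le_integral => //.
- exact/measurable_EFinP/measurable_indic.
- by apply/measurable_EFinP; exact: measurableT_comp.
- move=> t _; rewrite lee_fin indicE; case: (boolP (t \in _)) => [|_]; last exact: expR_ge0.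
  by rewrite inE/= => h; rewrite -[1%:R]expR0 ler_expR.
Qed.

End Transport.

(** * Passage times with boundary weights, and their Chernoff bounds *)

Section Shape.
Context {R : realType}.
Variables (m n : nat).
Hypotheses (m0 : (0 < m)%N) (n0 : (0 < n)%N).
Let x : R * R := toR2 (m, n).

Let s0 : 0 < Num.sqrt (m%:R : R). Proof. by rewrite sqrtr_gt0 ltr0n. Qed.
Let r0 : 0 < Num.sqrt (n%:R : R). Proof. by rewrite sqrtr_gt0 ltr0n. Qed.

Lemma zeta_gamma1 : zeta x ^+ 2 * gamma x = m%:R.
Proof.
rewrite /zeta /gamma /x /= -exprMn divfK ?sqr_sqrtr//; last by rewrite gt_eqF// addr_gt0.
Qed.

Lemma zeta_gamma2 : (1 - zeta x) ^+ 2 * gamma x = n%:R.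
Proof.
rewrite /zeta /gamma /x /= -exprMn.
have -> : (1 - Num.sqrt m%:R / (Num.sqrt m%:R + Num.sqrt n%:R)) *
   (Num.sqrt m%:R + Num.sqrt n%:R) = Num.sqrt n%:R :> R by field; rewrite gt_eqF// addr_gt0.
by rewrite sqr_sqrtr.
Qed.

Lemma l1norm_toR2 : l1norm x = m%:R + n%:R.
Proof. by rewrite /l1norm /= !ger0_norm. Qed.

Lemma gamma_bounds : l1norm x <= gamma x <= 2 * l1norm x.
Proof.
rewrite l1norm_toR2 /gamma /x/=.
have hm : Num.sqrt m%:R ^+ 2 = m%:R :> R by rewrite sqr_sqrtr.
have hn : Num.sqrt n%:R ^+ 2 = n%:R :> R by rewrite sqr_sqrtr.
have h1 := sqr_ge0 (Num.sqrt m%:R - Num.sqrt n%:R : R).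
have h2 : 0 <= Num.sqrt m%:R * Num.sqrt n%:R :> R by rewrite mulr_ge0// ltW.
by apply/andP; split; nra.
Qed.

Lemma l1norm_ge1 : 1 <= l1norm x.
Proof.
rewrite l1norm_toR2; have : 1 <= m%:R :> R by rewrite ler1n.
by have : 0 <= n%:R :> R by []; lra.
Qed.

End Shape.

Section Deterministic.
Context {R : realType}.
Implicit Types (u : nat * nat -> R).

(** Boundary weights of all rates are realised on one field of rate one variables, so
  that passage times of different rates can be compared at each outcome. *)
Definition edge_weights (a b : R) u (q : nat * nat) : R :=
  if q.2 == 0%N then u q / a else if q.1 == 0%N then u q / b else u q.

Definition hor_passage a u v := last_passage (edge_weights a 1 u) (1%N, 0%N) v.
Definition ver_passage b u v := last_passage (edge_weights 1 b u) (0%N, 1%N) v.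

Lemma last_passage_bulk a b u k i j : (0 < k <= i)%N -> (0 < j)%N ->
  last_passage (edge_weights a b u) (k, 1%N) (i, j) = last_passage u (k, 1%N) (i, j).
Proof.
move=> /andP[k0 ki] j0; apply: last_passage_eq => // c e hc he.
rewrite /edge_weights/= !gtn_eqF//; lia.
Qed.

Lemma hor_passageE a b u i j : (0 < i)%N ->
  last_passage (edge_weights a b u) (1%N, 0%N) (i, j) = hor_passage a u (i, j).
Proof.
move=> i0; apply: last_passage_eq => // c e /andP[c0 _] _.
by rewrite /edge_weights/= (gtn_eqF c0).
Qed.

Lemma ver_passageE a b u i j : (0 < j)%N ->
  last_passage (edge_weights a b u) (0%N, 1%N) (i, j) = ver_passage b u (i, j).
Proof.
move=> j0; apply: last_passage_eq => // c e _ /andP[e0 _].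
by rewrite /edge_weights/= (gtn_eqF e0).
Qed.

Lemma last_passage_origin a b u i j : (0 < i)%N -> (0 < j)%N ->
  last_passage (fun q => if q == (0%N, 0%N) then 0 else edge_weights a b u q)
    (0%N, 0%N) (i, j) = Num.max (hor_passage a u (i, j)) (ver_passage b u (i, j)).
Proof.
move=> i0 j0; rewrite last_passage_front_rec// eqxx add0r.
rewrite -(hor_passageE a b)// -(ver_passageE a b)//.
congr Num.max; apply: last_passage_eq => // c e hc he.
  by rewrite xpair_eqE gtn_eqF//; lia.
by rewrite xpair_eqE andbC gtn_eqF//; lia.
Qed.

Lemma hor_passage_le a a' u i j : (forall q, 0 <= u q) -> 0 < a -> a <= a' ->
  (0 < i)%N -> hor_passage a' u (i, j) <= hor_passage a u (i, j).
Proof.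
move=> u0 a0 aa' i0; apply: last_passage_mono => // c e _ _.
rewrite /edge_weights/=; case: ifP => // _.
by rewrite ler_wpM2l// lef_pV2 ?posrE//; lra.
Qed.

Lemma ver_passage_transpose b u i j : (0 < j)%N ->
  ver_passage b u (i, j) = hor_passage b (fun q => u (q.2, q.1)) (j, i).
Proof.
move=> j0; rewrite /ver_passage -last_passage_transpose//.
apply: last_passage_eq => // c e hc he; rewrite /edge_weights/=.
by rewrite (gtn_eqF (_ : (0 < c)%N))//; lia.
Qed.

End Deterministic.

Lemma measurable_last_passage {R : realType} d (T : measurableType d)
    (W : nat * nat -> T -> R) a b i j : (a <= i)%N -> (b <= j)%N ->
  (forall k l, (a <= k <= i)%N -> (b <= l <= j)%N -> measurable_fun setT (W (k, l))) ->
  measurable_fun setT (fun t => last_passage (W^~ t) (a, b) (i, j)).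
Proof.
move=> ai bj; move: i j ai bj; apply: quadrant_ind.
- move=> h; under eq_fun do rewrite last_passage_refl.
  by apply: h; rewrite !leqnn.
- move=> i ai IH h; under eq_fun do rewrite last_passage_row//.
  apply: measurable_funD; last by apply: h; lia.
  by apply: IH => k l hk hl; apply: h; lia.
- move=> j bj IH h; under eq_fun do rewrite last_passage_col//.
  apply: measurable_funD; last by apply: h; lia.
  by apply: IH => k l hk hl; apply: h; lia.
- move=> i j ai bj IH1 IH2 h; under eq_fun do rewrite last_passage_rec//.
  apply: measurable_funD; last by apply: h; lia.
  apply: measurable_maxr; [apply: IH1|apply: IH2] => k l hk hl; apply: h; lia.
Qed.

Section UnitField.
Context {R : realType} d (T : measurableType d) (P : probability T R).
Implicit Types (U : nat * nat -> T -> R).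

Definition unit_field m n U := jointly P (rect m n) U (fun=> expo 1).

Lemma unit_field_edge m n (a b : R) U : 0 < a -> 0 < b -> unit_field m n U ->
  expo_field P m n a b (fun q t => edge_weights a b (U^~ t) q).
Proof.
move=> a0 b0 jU.
pose phi (q : nat * nat) (x : R) := 1 * x /
  (if q.2 == 0%N then a else if q.1 == 0%N then b else 1).
have pos q : 0 < (if q.2 == 0%N then a else if q.1 == 0%N then b else 1).
  by case: ifP => // _; case: ifP.
apply: (jointly_eq (X := fun q => phi q \o U q) (mu := edge_law a b)) => //.
  move=> q _; apply/funext => t; rewrite /phi /edge_weights /= mul1r.
  by case: ifP => // _; case: ifP => // _; rewrite divr1.
apply: jointly_map jU => [q _|q A _ mA].
  by apply: measurable_funM => //; exact: measurable_funM.
rewrite /phi expo_scale// /edge_law.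
by case: ifP => // _; case: ifP.
Qed.

Lemma chernoff_bound (Y : T -> R) (c k : R) : measurable_fun setT Y ->
  (\int[P]_t (expR (Y t))%:E <= (expR c)%:E)%E ->
  (P [set t | (0 <= Y t + k)%R] <= (expR (c + k))%:E)%E.
Proof.
move=> mY hY; apply: markov_expR; first exact: measurable_funD.
rewrite addrC expRD EFinM; under eq_integral do rewrite addrC expRD EFinM.
have h : (0%:E <= (expR k)%:E)%E by rewrite lee_fin expR_ge0.
rewrite ge0_integralZl//; first exact: lee_wpmul2l.
by apply/measurable_EFinP; exact: measurableT_comp.
Qed.

Section Tails.
Variables (m n : nat) (U : nat * nat -> T -> R).
Hypotheses (m0 : (0 < m)%N) (n0 : (0 < n)%N) (jU : unit_field m n U).
Local Notation gam := (@gamma R (toR2 (m, n))).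
Local Notation zt := (@zeta R (toR2 (m, n))).
Local Notation F w z := (from_origin (fun q t => edge_weights w (1 - z) (U^~ t) q) (m, n)).

(** The centring is exact: gamma (toR2 (m, n)) times zeta^2 and (1 - zeta)^2 gives m
  and n. *)
Lemma centered_mgf (w z : R) : 0 < w < 1 -> 0 < z < 1 ->
  (\int[P]_t (expR ((w - z) * (F w z t - gam)))%:E =
   (expR (gam * (exponent zt w - exponent zt z)))%:E)%E.
Proof.
move=> w01 z01; have /andP[w0 w1] := w01; have /andP[z0 z1] := z01.
have v0 : 0 < 1 - z by lra.
have jW := unit_field_edge w0 v0 jU.
have mF : measurable_fun setT (F w z).
  apply: (@measurable_from_origin _ _ _ _ m n) => // q qr.
  exact: (jointly_measurable jW qr).
transitivity ((expR (- (w - z) * gam))%:E *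
    \int[P]_t (expR ((w - z) * F w z t))%:E)%E.
  rewrite -ge0_integralZl//.
  - by apply: eq_integral => t _; rewrite -EFinM -expRD; congr (expR _)%:E; ring.
  - apply/measurable_EFinP; apply: measurableT_comp => //; exact: measurable_funM.
rewrite from_origin_mgf// -EFinM; congr EFin.
have pw : (w / z) ^+ m = expR (m%:R * (ln w - ln z)).
  by rewrite expRM_natl expRB !lnK.
have pz : ((1 - z) / (1 - w)) ^+ n = expR (n%:R * (ln (1 - z) - ln (1 - w))).
  by rewrite expRM_natl expRB !lnK// posrE; lra.
rewrite pw pz -!expRD; congr expR; rewrite /exponent.
have hm := @zeta_gamma1 R _ _ m0 n0; have hn := @zeta_gamma2 R _ _ m0 n0.
by rewrite -[in LHS]hm -[in LHS]hn; ring.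
Qed.

Lemma measurable_from_origin_edge (w z : R) i j : 0 < w -> z < 1 ->
  (i <= m)%N -> (j <= n)%N ->
  measurable_fun setT (from_origin (fun q t => edge_weights w (1 - z) (U^~ t) q) (i, j)).
Proof.
move=> w0 z1 im jn; have v0 : 0 < 1 - z by lra.
have jW := unit_field_edge w0 v0 jU.
apply: (@measurable_from_origin _ _ _ _ m n) => // q qr.
exact: (jointly_measurable jW qr).
Qed.

Lemma from_origin_lower (w z x : R) : 0 < w -> w <= z -> z < 1 ->
  (P [set t | (F w z t <= gam + x)%R] <=
   (expR (gam * (exponent zt w - exponent zt z) + (z - w) * x))%:E)%E.
Proof.
move=> w0 wz z1; have w01 : 0 < w < 1 by lra.
have z01 : 0 < z < 1 by lra.
have mF := measurable_from_origin_edge w0 z1 (leqnn m) (leqnn n).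
have [wz'|wz'] := eqVneq w z.
  subst z; rewrite !subrr mulr0 mul0r addr0 expR0; apply: probability_le1.
  rewrite -[X in measurable X]setTI; exact: measurable_fun_ler.
pose Y t := (w - z) * (F w z t - gam).
have -> : [set t | F w z t <= gam + x] = [set t | 0 <= Y t + (z - w) * x].
  apply/seteqP; split => t /=; rewrite /Y;
    have -> : (w - z) * (F w z t - gam) + (z - w) * x =
      (z - w) * (gam + x - F w z t) by ring.
    by move=> h; apply: mulr_ge0; lra.
  by rewrite pmulr_rge0 ?subr_ge0// subr_gt0 lt_neqAle wz' wz.
apply: chernoff_bound; last by rewrite centered_mgf.
by apply: measurable_funM => //; exact: measurable_funB.
Qed.

Lemma measurable_hor_passage (w : R) i j : 0 < w -> (0 < i <= m)%N -> (j <= n)%N ->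
  measurable_fun setT (fun t => hor_passage w (U^~ t) (i, j)).
Proof.
move=> w0 /andP[i0 im] jn; have jW := unit_field_edge w0 ltr01 jU.
apply: (@measurable_last_passage _ _ _ (fun q t => edge_weights w 1 (U^~ t) q)) => //.
move=> k l hk hl; apply: (jointly_measurable jW).
by rewrite mem_rect xpair_eqE /=; lia.
Qed.

(** Adding the vertical edge only increases the passage time, so the bound for the
  model with two boundaries applies. *)
Lemma hor_passage_upper (w z x : R) : 0 < z -> z < w -> w < 1 ->
  (P [set t | (gam + x <= hor_passage w (U^~ t) (m, n))%R] <=
   (expR (gam * (exponent zt w - exponent zt z) - (w - z) * x))%:E)%E.
Proof.
move=> z0 zw w1; have w01 : 0 < w < 1 by lra.
have z01 : 0 < z < 1 by lra.
have w0 : 0 < w by lra.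
have z1 : z < 1 by lra.
have mF := measurable_from_origin_edge w0 z1 (leqnn m) (leqnn n).
pose Y t := (w - z) * (F w z t - gam).
have mY : measurable_fun setT Y.
  by apply: measurable_funM => //; exact: measurable_funB.
have hY := @chernoff_bound Y _ (- ((w - z) * x)) mY.
apply: le_trans (hY (gam * (exponent zt w - exponent zt z)) _); last by rewrite centered_mgf.
apply: le_measure; rewrite ?inE.
- rewrite -[X in measurable X]setTI; apply: measurable_fun_ler => //.
  by apply: measurable_hor_passage; rewrite // m0 leqnn.
- by rewrite -[X in measurable X]setTI; apply: measurable_fun_ler => //; exact: measurable_funD.
- move=> t /= h; rewrite /Y -mulrBr mulr_ge0//; first lra.
  by rewrite subr_ge0 /from_origin last_passage_origin// lerBrDl le_max h.
Qed.

End Tails.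
End UnitField.

(** * Maximal inequality for exponential walks *)

Section WalkMax.
Context {R : realType} (I : eqType).

(** The running maximum of the partial sums of Z along s, started from 0, written as
  Lindley's recursion on the first step. *)
Fixpoint walk_max (s : seq I) (Z : I -> R) : R :=
  if s is i :: s' then Num.max 0 (Z i + walk_max s' Z) else 0.

Lemma walk_max_ge_prefix s Z k : \sum_(i <- take k s) Z i <= walk_max s Z.
Proof.
elim: s k => [|i s IH] [|k] /=; rewrite ?big_nil ?le_max ?lexx//.
by rewrite big_cons lerD2l IH orbT.
Qed.

Context d (T : measurableType d) (P : probability T R).

Lemma measurable_walk_max d' (T' : measurableType d') s (X : I -> T' -> R) (xi : R -> R) :
  measurable_fun setT xi ->
  (forall i, i \in s -> measurable_fun setT (X i)) ->
  measurable_fun setT (fun t => walk_max s (fun i => xi (X i t))).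
Proof.
move=> mxi; elim: s => [|i s IH] mX /=; first exact: measurable_cst.
apply: measurable_maxr => //; apply: measurable_funD.
  by apply: measurableT_comp => //; apply: mX; rewrite mem_head.
by apply: IH => j js; apply: mX; rewrite inE js orbT.
Qed.

(** The maximal inequality for the supermartingale of exponentials of theta times the
  partial sums, by induction on the steps: given the first step y, the remaining
  walk has to exceed x - xi y. *)
Lemma walk_max_tail s (X : I -> T -> R) mu (xi : R -> R) (theta x : R) :
  jointly P s X mu -> measurable_fun setT xi -> 0 <= theta ->
  (forall i, i \in s -> (\int[mu i]_y (expR (theta * xi y))%:E <= 1)%E) ->
  (P [set t | (x < walk_max s (fun i => xi (X i t)))%R] <= (expR (- (theta * x)))%:E)%E.
Proof.
move=> + mxi theta0; elim: s x => [|i s IH] x jX hmu; have [x0|x0] := ltP x 0.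
- apply: (@le_trans _ _ 1%E).
    rewrite (_ : [set t | _] = setT) ?probability_setT//.
    by apply/seteqP; split => t.
  by rewrite lee_fin -[leLHS]expR0 ler_expR oppr_ge0 mulr_ge0_le0// ltW.
- rewrite (_ : [set t | _] = set0) ?measure0 ?lee_fin ?expR_ge0//.
  by apply/seteqP; split => t //=; rewrite ltNge x0.
- apply: (@le_trans _ _ 1%E).
    apply: probability_le1; rewrite -[X in measurable X]setTI.
    apply: measurable_fun_ltr => //.
    by apply: measurable_walk_max => // j; exact: (jointly_measurable jX).
  by rewrite lee_fin -[leLHS]expR0 ler_expR oppr_ge0 mulr_ge0_le0// ltW.
have jXs := jointly_tail jX.
have mXs j : j \in s -> measurable_fun setT (X j) by move=> js; exact: (jointly_measurable jXs js).
have mXi : measurable_fun setT (X i) by apply: (jointly_measurable jX); rewrite mem_head.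
pose M t := walk_max s (fun i => xi (X i t)).
have mM : measurable_fun setT M by exact: measurable_walk_max.
have mset : measurable [set t | x < walk_max (i :: s) (fun i => xi (X i t))].
  rewrite -[X in measurable X]setTI; apply: measurable_fun_ltr => //.
  by apply: measurable_walk_max => // j; exact: (jointly_measurable jX).
pose h d' (T' : measurableType d') (M' : T' -> R) (z : R * T') : \bar R :=
  (\1_[set z : R * T' | x < xi z.1 + M' z.2] z)%:E.
have mh d' (T' : measurableType d') (M' : T' -> R) : measurable_fun setT M' ->
    measurable_fun setT (h _ T' M').
  move=> mM'; apply/measurable_EFinP; apply: measurable_indic.
  rewrite -[X in measurable X]setTI; apply: measurable_fun_ltr => //.
  by apply: measurable_funD; exact: measurableT_comp.
have h0 d' (T' : measurableType d') (M' : T' -> R) z : (0 <= h _ T' M' z)%E by rewrite lee_fin.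
have hs : {in s, forall j, (\int[mu j]_y (expR (theta * xi y))%:E <= 1)%E}.
  by move=> j js; apply: hmu; rewrite inE js orbT.
have -> : P [set t | x < walk_max (i :: s) (fun i => xi (X i t))] =
    (\int[P]_t \int[mu i]_y h _ T M (y, t))%E.
  rewrite -(setIT [set t | _]) -integral_indic//.
  have mMg : measurable_fun setT (M : g_sigma_algebraType (boxes s X) -> R).
    by apply: measurable_walk_max => // j js; exact: measurable_generated.
  rewrite -[RHS](jointly_integral jX (mh _ _ _ mMg) (h0 _ _ _)).
  apply: eq_integral => t _; rewrite /h/=; congr (_ : bool)%:R%:E.
  apply/idP/idP; rewrite !inE/= lt_max => h1; last by rewrite h1 orbT.
  by case/orP: h1 => //; rewrite ltNge x0.
rewrite -(fubini_tonelli (m1 := mu i) (m2 := P) (h _ T M))//=; last exact: mh.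
have mE : measurable_fun setT (fun y => (expR (theta * xi y))%:E).
  apply/measurable_EFinP; apply: measurableT_comp => //; exact: measurable_funM.
have e0 : (0 <= (expR (- (theta * x)))%:E)%E by rewrite lee_fin expR_ge0.
apply: (@le_trans _ _ (\int[mu i]_y ((expR (- (theta * x)))%:E * (expR (theta * xi y))%:E))%E).
  apply: ge0_le_integral => //.
  - by move=> y _; exact: integral_ge0.
  - by apply: (measurable_fun_fubini_tonelli_F (m2 := P) (h _ T M)) => //; exact: mh.
  - exact: measurable_funeM.
  move=> y _; rewrite -EFinM -expRD.
  have -> : - (theta * x) + theta * xi y = - (theta * (x - xi y)) by ring.
  rewrite /fubini_F /h/=.
  apply: le_trans (IH (x - xi y) jXs hs).
  have mD : measurable [set t | x - xi y < M t].
    rewrite -[X in measurable X]setTI; exact: measurable_fun_ltr.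
  rewrite (_ : P _ = \int[P]_t (\1_[set t | (x - xi y < M t)%R] t)%:E)%E; last first.
    by rewrite integral_indic// setIT.
  rewrite le_eqVlt; apply/orP; left; apply/eqP; apply: eq_integral => t _.
  congr (_ : bool)%:R%:E; apply/idP/idP; rewrite !inE/=; lra.
rewrite ge0_integralZl//.
rewrite -[leRHS]mule1; apply: lee_wpmul2l => //.
by apply: hmu; rewrite mem_head.
Qed.

Lemma measurable_sum_seq s (X : I -> T -> R) :
  (forall i, i \in s -> measurable_fun setT (X i)) ->
  measurable_fun setT (fun t => \sum_(i <- s) X i t).
Proof.
elim: s => [|i l IH] mX; first by under eq_fun do rewrite big_nil; exact: measurable_cst.
under eq_fun do rewrite big_cons.
apply: measurable_funD; first by apply: mX; rewrite mem_head.
by apply: IH => j jl; apply: mX; rewrite inE jl orbT.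
Qed.

(** Chernoff's bound with parameter 1: the moment of exp (- x) is 1 / 2, which is less
  than exp (- 1 / 2). *)
Lemma sum_lower_tail s (X : I -> T -> R) : jointly P s X (fun=> expo 1) ->
  (P [set t | (\sum_(i <- s) X i t <= (size s)%:R / 4)%R] <=
   (expR (- ((size s)%:R / 4)))%:E)%E.
Proof.
move=> jX; have mX j : j \in s -> measurable_fun setT (X j).
  by move=> js; exact: (jointly_measurable jX js).
pose Y t := - \sum_(i <- s) X i t.
have mS := measurable_sum_seq mX.
have -> : [set t | \sum_(i <- s) X i t <= (size s)%:R / 4] =
    [set t | 0 <= Y t + (size s)%:R / 4].
  by apply/seteqP; split => t; rewrite /Y/=; lra.
have -> : - ((size s)%:R / 4) = - ((size s)%:R / 2) + (size s)%:R / 4 :> R by field.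
apply: chernoff_bound; first exact: measurableT_comp.
have := @jointly_integral_prod _ _ _ _ _ s X _ (fun _ x => expR (- x)) jX.
have mN : measurable_fun setT (fun x : R => expR (- x)) by exact: measurableT_comp.
move=> /(_ (fun=> mN) (fun _ x => expR_ge0 _)) e.
rewrite (_ : \int[P]_t (expR (Y t))%:E = \int[P]_t (\prod_(i <- s) expR (- X i t))%:E)%E; last first.
  by apply: eq_integral => t _; rewrite -expR_sum sumrN.
rewrite e.
have half : (\int[expo 1]_x (expR (- x))%:E = (1 / 2)%:E :> \bar R)%E.
  have h : -1 < 1 :> R by lra.
  have := @integral_expo_expR R 1 (-1) ltr01 h.
  rewrite opprK (_ : 1 + 1 = 2)// => <-.
  by apply: eq_integral => x _; rewrite mulN1r.
rewrite (eq_bigr (fun=> (1 / 2)%:E)); last by move=> i _; exact: half.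
rewrite prodEFin big_const_seq count_predT iter_mulr_1 lee_fin.
rewrite -mulrN expRM_natl lerXn2r ?nnegrE ?expR_ge0//.
by have := expR_ge1Dx (- 2^-1 : R); lra.
Qed.

(** The moment of exp (theta x) is 1 / (1 - theta / w), and the drift 1 / (w - theta),
  larger than the mean 1 / w, is what compensates it. *)
Lemma expo_walk_up (w theta : R) : 0 <= theta < w ->
  (\int[expo w]_x (expR (theta * (x - (w - theta)^-1)))%:E <= 1)%E.
Proof.
move=> /andP[t0 tw]; have w0 : 0 < w by lra.
rewrite (_ : \int[expo w]_x (expR (theta * (x - (w - theta)^-1)))%:E =
  (expR (- (theta / (w - theta))))%:E * \int[expo w]_x (expR (theta * x))%:E)%E; last first.
  rewrite -ge0_integralZl//.
  - by apply: eq_integral => x _; rewrite -EFinM -expRD; congr (expR _)%:E; ring.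
  - by apply/measurable_EFinP; apply: measurableT_comp => //; exact: measurable_funM.
rewrite integral_expo_expR// -EFinM lee_fin.
have -> : w / (w - theta) = 1 + theta / (w - theta) by field; lra.
rewrite expRN mulrC ler_pdivrMr ?expR_gt0// mul1r; exact: expR_ge1Dx.
Qed.

(** The mirror image of [expo_walk_up] for negative exponents. *)
Lemma expo_walk_down (u theta : R) : 0 <= theta -> 0 < u ->
  (\int[expo u]_x (expR (theta * ((u + theta)^-1 - x)))%:E <= 1)%E.
Proof.
move=> t0 u0.
rewrite (_ : \int[expo u]_x (expR (theta * ((u + theta)^-1 - x)))%:E =
  (expR (theta / (u + theta)))%:E * \int[expo u]_x (expR ((- theta) * x))%:E)%E; last first.
  rewrite -ge0_integralZl//.
  - by apply: eq_integral => x _; rewrite -EFinM -expRD; congr (expR _)%:E; ring.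
  - by apply/measurable_EFinP; apply: measurableT_comp => //; exact: measurable_funM.
rewrite integral_expo_expR//; last lra.
rewrite -EFinM lee_fin opprK.
have -> : u / (u + theta) = 1 + (- (theta / (u + theta))) by field; lra.
rewrite -ler_pdivlMl ?expR_gt0// -expRN mulr1; exact: expR_ge1Dx.
Qed.

End WalkMax.

(** * From a boundary passage time to the bulk *)

Section UnitFieldSymmetries.
Context {R : realType} d (T : measurableType d) (P : probability T R).
Implicit Types (U : nat * nat -> T -> R).

(** The point reflection that exchanges (1, 1) and (m, n); the row and the column of
  index 0 of the new field are the sites just beyond (m, n). *)
Definition reversed {S} m n (U : nat * nat -> S) (q : nat * nat) : S :=
  U (m.+1 - q.1, n.+1 - q.2)%N.

Definition transposed {S} (U : nat * nat -> S) (q : nat * nat) : S := U (q.2, q.1).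

Lemma unit_field_sub m n m' n' U : (m <= m')%N -> (n <= n')%N ->
  unit_field P m' n' U -> unit_field P m n U.
Proof.
move=> mm nn; apply: jointly_sub; first exact: rect_uniq.
by move=> q; rewrite !mem_rect => /and3P[h1 h2 ->]; lia.
Qed.

Lemma unit_field_reversed m n U :
  unit_field P m.+1 n.+1 U -> unit_field P m n (reversed m n U).
Proof.
move=> jU; pose sigma (q : nat * nat) := (m.+1 - q.1, n.+1 - q.2)%N.
have sigmaK : {in rect m n, cancel sigma sigma}.
  move=> [a b]; rewrite mem_rect => /and3P[h1 h2 _].
  by rewrite /sigma /= !subKn ?leqW.
apply: (@jointly_reindex _ _ _ _ _ _ _ sigma sigma U (fun=> expo 1)) => //.
move: jU; apply: jointly_sub.
  by rewrite (map_inj_in_uniq (can_in_inj sigmaK)) rect_uniq.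
move=> _ /mapP[[a b] + ->]; rewrite !mem_rect !xpair_eqE /= => /and3P[h1 h2 _]; lia.
Qed.

Lemma unit_field_transposed m n U :
  unit_field P m n U -> unit_field P n m (transposed U).
Proof.
move=> jU; apply: (@jointly_reindex _ _ _ _ _ _ _
  (fun q => (q.2, q.1)) (fun q => (q.2, q.1)) U (fun=> expo 1)).
  by case.
move: jU; apply: jointly_sub.
  by rewrite map_inj_in_uniq ?rect_uniq// => -[a b] [a' b'] _ _ [-> ->].
move=> _ /mapP[[a b] + ->]; rewrite !mem_rect !xpair_eqE /=; lia.
Qed.

End UnitFieldSymmetries.

Section HorToBulk.
Context {R : realType}.
Variables (m n : nat) (u : nat * nat -> R).
Hypotheses (m0 : (0 < m)%N) (n0 : (0 < n)%N) (u0 : forall q, 0 <= u q).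

Definition row_sites := [seq (i, 0%N) | i <- iota 1 m].
(** Listed from right to left, so that the increments of a prefix telescope to one
  that ends in column m. *)
Definition row_sites_rev := [seq (m - j, 0)%N | j <- iota 0 m].

Lemma telescope_row_rev (F : nat -> R) k : (k <= m)%N ->
  \sum_(q <- take k row_sites_rev) (F q.1 - F q.1.-1) = F m - F (m - k)%N.
Proof.
rewrite /row_sites_rev -map_take take_iota => /minn_idPl ->.
rewrite big_map /=; elim: k => [|k IH]; first by rewrite big_nil subn0 subrr.
rewrite -(addn1 k) iotaD big_cat/= IH big_seq1 add0n addn1 subnS; ring.
Qed.

(** Let k be the exit column at rate w, S the row sums of u and B k the bulk passage
  time from (k, 1).  If k > K, the path gains at least y when the rate drops to w2,
  against the bound on hor_passage w2.  Otherwise the row segment S k / w is at most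
  k rho1 + x.  The difference B 1 - B k is, in the reversed field, an increment of
  the bulk passage time along the top row; it dominates the increment of the vertical
  passage time ([last_passage_ver_crossing]) and, since the vertical passage time is
  the larger one at (m, n), the increment of F, which is at least
  (k - 1) rho2 - x. *)
Lemma hor_to_bulk (g y x w w2 a' b' rho1 rho2 : R) (K : nat) :
  let u' := reversed m n u in
  let F i := last_passage (fun q => if q == (0%N, 0%N) then 0
                                    else edge_weights a' b' u' q) (0%N, 0%N) (i, n) in
  0 < w2 -> w2 <= w -> rho2 <= rho1 ->
  g < hor_passage w u (m, n) ->
  hor_passage w2 u (m, n) < g + y ->
  ((K < m)%N -> K%:R / 4 < \sum_(q <- take K row_sites) u q) ->
  y <= (w2^-1 - w^-1) * (K%:R / 4) ->
  hor_passage a' u' (m, n) <= ver_passage b' u' (m, n) ->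
  walk_max row_sites (fun q => u q / w - rho1) <= x ->
  walk_max row_sites_rev (fun q => rho2 - (F q.1 - F q.1.-1)) <= x ->
  g - 2 * x - K%:R * (rho1 - rho2) - rho2 < last_passage u (1%N, 1%N) (m, n).
Proof.
move=> u' F w20 ww rr gw h2 hK hy hver hx1 hx2.
have w0 : 0 < w by lra.
pose B k := last_passage u (k, 1%N) (m, n).
pose S k := \sum_(1 <= i < k.+1) u (i, 0%N).
have hexit r : 0 < r -> exists2 k, (1 <= k <= m)%N &
    hor_passage r u (m, n) = S k / r + B k.
  move=> r0; have [k k1 e] := @last_passage_exit_row R (edge_weights r 1 u) 1 m n m0 n0.
  exists k => //; rewrite /hor_passage e last_passage_bulk//; congr (_ + _).
  by rewrite /S mulr_suml.
have hexit_ge r k : 0 < r -> (1 <= k <= m)%N -> S k / r + B k <= hor_passage r u (m, n).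
  move=> r0 k1; have := @last_passage_ge_exit_row R (edge_weights r 1 u) 1 k m n k1 n0.
  rewrite last_passage_bulk//; apply: le_trans; rewrite lerD2r /S mulr_suml.
  by [].
have rowS k : (k <= m)%N -> \sum_(q <- take k row_sites) u q = S k.
  move=> km; rewrite /row_sites -map_take take_iota (minn_idPl km) big_map /S.
  by rewrite /index_iota subn1.
have [k /andP[k1 km] e] := hexit w w0.
have [Kk|kK] := ltnP K k.
  have Km : (K < m)%N by exact: leq_trans km.
  have := hexit_ge w2 k w20 (_ : (1 <= k <= m)%N); rewrite k1 km => /(_ isT) h.
  have SKk : S K <= S k.
    rewrite /S [leRHS](big_cat_nat (n := K.+1))//=; last exact: ltnW.
    by rewrite lerDl sumr_ge0.
  have := hK Km; rewrite (rowS _ (ltnW Km)) => h3.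
  have winv : 0 <= w2^-1 - w^-1 by rewrite subr_ge0 lef_pV2 ?posrE.
  have : (w2^-1 - w^-1) * (K%:R / 4) <= (w2^-1 - w^-1) * S k.
    by apply: ler_wpM2l => //; lra.
  rewrite mulrBl; move: gw; rewrite e; lra.
have Brev k' : (1 <= k' <= m)%N -> B k' = last_passage u' (1%N, 1%N) ((m.+1 - k')%N, n).
  move=> /andP[k1' km'].
  have := @last_passage_reverse R u m.+1 n.+1 k' 1 m n km' n0 (leqnSn m) (leqnSn n).
  by rewrite !subSnn subSS subn0 /B => <-.
have cross : F m - F (m.+1 - k)%N <= B 1%N - B k.
  have i1 : (1 <= m.+1 - k <= m)%N by clear -k1 km; lia.
  rewrite (Brev k) ?k1// (Brev 1%N) ?m0// subSS subn0.
  have := @last_passage_ver_crossing R (edge_weights 1 b' u') (m.+1 - k) m n i1 n0.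
  rewrite !(@last_passage_bulk _ 1 b' u' 1%N) ?m0//; last by case/andP: i1.
  apply: le_trans; rewrite /F !last_passage_origin//; last by case/andP: i1.
  rewrite -!/(ver_passage b' u' _) (max_r hver).
  by rewrite lerB// le_max lexx orbT.
have hup : S k / w - k%:R * rho1 <= x.
  apply: le_trans hx1; apply: le_trans (walk_max_ge_prefix row_sites _ k).
  rewrite sumrB -mulr_suml rowS// lerD2l lerN2 big_const_seq count_predT.
  by rewrite size_takel ?size_map ?size_iota// iter_addr_0 mulr_natl.
have hdown : (k.-1)%:R * rho2 - (F m - F (m.+1 - k)%N) <= x.
  apply: le_trans hx2; apply: le_trans (walk_max_ge_prefix row_sites_rev _ k.-1).
  rewrite sumrB telescope_row_rev; last by clear -k1 km; lia.
  rewrite (_ : (m - k.-1 = m.+1 - k)%N); last by clear -k1 km; lia.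
  rewrite lerD2r big_const_seq count_predT size_takel; last first.
    by rewrite size_map size_iota; clear -k1 km; lia.
  by rewrite iter_addr_0 mulr_natl.
have krho : k%:R * (rho1 - rho2) <= K%:R * (rho1 - rho2).
  by rewrite ler_wpM2r ?ler_nat// subr_ge0.
have kpred : (k.-1)%:R = k%:R - 1 :> R by rewrite -subn1 natrB.
move: hdown hup cross krho gw; rewrite e kpred -/(B 1%N).
clear; move: (S k / w) => Sk; lra.
Qed.

End HorToBulk.

(** * The exceptional events *)

Section Rare.
Context {R : realType} d (T : measurableType d) (P : probability T R).

Definition rare (c : R) (E : set T) := measurable E /\ (P E <= c%:E)%E.

Lemma rareU c c' E E' : rare c E -> rare c' E' -> rare (c + c') (E `|` E').
Proof.
move=> [mE hE] [mE' hE']; split; first exact: measurableU.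
by rewrite EFinD; apply: le_trans (leeD hE hE'); exact: measureU2.
Qed.

Lemma rare0 c : 0 <= c -> rare c set0.
Proof. by move=> c0; split => //; rewrite measure0 lee_fin. Qed.

Lemma rare_le c c' E : c <= c' -> rare c E -> rare c' E.
Proof.
by move=> cc [mE hE]; split => //; apply: le_trans hE _; rewrite lee_fin.
Qed.

End Rare.

Section RowSites.
Context {R : realType}.
Implicit Types (m n : nat) (q : nat * nat).

Lemma eq_walk_max (I : eqType) (s : seq I) (Z Z' : I -> R) :
  {in s, Z =1 Z'} -> walk_max s Z = walk_max s Z'.
Proof.
elim: s => //= i s IH h; rewrite h ?mem_head// IH// => j js.
by apply: h; rewrite inE js orbT.
Qed.

Lemma mem_row_sites m q : (q \in row_sites m) = (0 < q.1 <= m)%N && (q.2 == 0%N).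
Proof.
case: q => i j; apply/mapP/idP => /= [[k] + [-> ->]|/andP[h /eqP->]].
  by rewrite mem_iota add1n ltnS eqxx andbT.
by exists i => //; rewrite mem_iota add1n ltnS.
Qed.

Lemma mem_row_sites_rev m q :
  (q \in row_sites_rev m) = (0 < q.1 <= m)%N && (q.2 == 0%N).
Proof.
case: q => i j; apply/mapP/idP => /= [[k] + [-> ->]|/andP[h /eqP->]].
  by rewrite mem_iota add0n eqxx andbT; lia.
by exists (m - i)%N; [rewrite mem_iota; lia|rewrite subKn//; case/andP: h].
Qed.

Lemma row_in_rect m n q : (0 < q.1 <= m)%N && (q.2 == 0%N) -> q \in rect m n.
Proof.
by case: q => i j /andP[/andP[i0 im] /eqP /= ->]; rewrite mem_rect xpair_eqE/= im (gtn_eqF i0).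
Qed.

Lemma row_sites_uniq m : uniq (row_sites m).
Proof. by rewrite map_inj_uniq ?iota_uniq// => i j []. Qed.

Lemma row_sites_rev_uniq m : uniq (row_sites_rev m).
Proof.
rewrite map_inj_in_uniq ?iota_uniq// => i j.
by rewrite !mem_iota => hi hj []; lia.
Qed.

End RowSites.

Section HorBad.
Context {R : realType} d (T : measurableType d) (P : probability T R).
Variables (m n : nat) (U : nat * nat -> T -> R).
Hypotheses (m0 : (0 < m)%N) (n0 : (0 < n)%N) (jU' : unit_field P m.+1 n.+1 U).
Local Notation gam := (@gamma R (toR2 (m, n))).
Local Notation zt := (@zeta R (toR2 (m, n))).
Local Notation N := (@l1norm R (toR2 (m, n))).
Variables (q a : R).
Hypothesis U0 : forall p t, 0 <= U p t.
Hypotheses (q0 : 0 < q) (q1 : q < 1) (qz : q <= zt) (zq : zt <= 1 - q).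
Hypotheses (a0 : 0 < a) (aq : a <= q / 8).

Let jU : unit_field P m n U := unit_field_sub (leqnSn m) (leqnSn n) jU'.
Let jV : unit_field P m n (reversed m n U) := unit_field_reversed jU'.
Let D := a ^+ 3 * N.
Let r := expR (- (q / 8 * D)).
Let x := a ^+ 2 * N.

Let N1 : 1 <= N. Proof. exact: l1norm_ge1. Qed.
Let gN : N <= gam <= 2 * N. Proof. exact: gamma_bounds. Qed.
Let D0 : 0 <= D.
Proof. by rewrite mulr_ge0 ?exprn_ge0 ?(ltW a0)//; apply: le_trans N1. Qed.

Let tail_le k y : q / 8 <= k -> y <= - (k * D) -> expR y <= r.
Proof.
move=> hk hy; rewrite ler_expR; apply: le_trans hy _; rewrite lerN2.
by apply: ler_wpM2r.
Qed.

Let gam_mul_le E e : E <= e -> 0 <= e -> gam * E <= 2 * N * e.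
Proof.
move=> Ee e0; case/andP: gN => g1 g2; have hN := N1; apply: (@le_trans _ _ (gam * e)).
  by apply: ler_wpM2l => //; lra.
exact: ler_wpM2r.
Qed.

Let gam_mul_ge E e : e <= E -> 0 <= e -> gam * - E <= - (N * e).
Proof.
move=> Ee e0; case/andP: gN => g1 g2; have hN := N1; rewrite mulrN lerN2.
apply: (@le_trans _ _ (N * E)); first by apply: ler_wpM2l => //; lra.
by apply: ler_wpM2r => //; lra.
Qed.

Let inv3q : 4 / (3 * q) = 4 / 3 * q^-1. Proof. by rewrite invfM mulrA. Qed.
Let iD0 : 0 <= q^-1 * D. Proof. by rewrite mulr_ge0 ?invr_ge0 ?(ltW q0). Qed.

(** Chernoff's bound with the second rate zt - 3 a. *)
Lemma rare_hor_high :
  rare P r [set t | (gam + (52 / q + 1) * x <= hor_passage (zt - 2 * a) (U^~ t) (m, n))%R].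
Proof.
move: (q0) (q1) (qz) (zq) (a0) (aq) (D0) (N1) (gN) => p0 p1 pz zp b0 bq hD hN hg.
split.
  rewrite -[X in measurable X]setTI; apply: measurable_fun_ler => //.
  by apply: (measurable_hor_passage m0 n0 jU); rewrite ?m0 ?leqnn//; lra.
apply: le_trans (hor_passage_upper (z := zt - 3 * a) m0 n0 jU _ _ _ _) _; [lra|lra|lra|].
rewrite lee_fin; apply: (@tail_le 1); first lra.
(* The cubes contribute 27 - 8 = 19; with gamma <= 2 N the exponent difference is
   at most 152 / (3 q) times D, which 52 / q exceeds. *)
have e1 := @exponent_le R zt q (zt - 2 * a) (zt - 3 * a) q0 (ltW q1) ltac:(lra) ltac:(lra) ltac:(lra).
have a3 : 0 <= a ^+ 3 by rewrite exprn_ge0// ltW.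
have ia3 : 0 <= q^-1 * a ^+ 3 by rewrite mulr_ge0// invr_ge0 ltW.
have := gam_mul_le e1; rewrite inv3q /x; move: iD0 D0; rewrite /D => h1 h2 h3.
have := h3 ltac:(lra).
set X := gam * _; move: h1 h2; lra.
Qed.

Lemma rare_row_sum K : D <= K%:R / 4 ->
  rare P r [set t | (K < m)%N /\ (\sum_(q <- take K (row_sites m)) U q t <= K%:R / 4)%R].
Proof.
move: (q0) (q1) (qz) (zq) (a0) (aq) (D0) (N1) (gN) => p0 p1 pz zp b0 bq hD hN hg.
move=> DK; have [Km|mK] := ltnP K m; last first.
  rewrite (_ : [set t | _] = set0); last by apply/seteqP; split => // t [].
  by apply: rare0; exact: expR_ge0.
have jS : jointly P (take K (row_sites m)) U (fun=> expo 1).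
  move: jU; apply: jointly_sub; first by rewrite take_uniq// row_sites_uniq.
  by move=> p /mem_take; rewrite mem_row_sites; exact: row_in_rect.
have sK : size (take K (row_sites m)) = K.
  by rewrite size_takel// size_map size_iota ltnW.
rewrite (_ : [set t | _] =
    [set t | (\sum_(q <- take K (row_sites m)) U q t <= K%:R / 4)%R]); last first.
  by apply/seteqP; split => t //= [].
split.
  rewrite -[X in measurable X]setTI; apply: measurable_fun_ler => //.
  by apply: measurable_sum_seq => p ps; exact: (jointly_measurable jS).
have := sum_lower_tail jS; rewrite sK => h; apply: le_trans h _.
by rewrite lee_fin; apply: (@tail_le 1); lra.
Qed.

(** If the vertical passage time of rate 1 - (zt + a) is the smaller one, then either
  the horizontal passage time of rate zt is large or the maximum of the two, with
  rates zt and zt + a, is small; gamma + x separates the two typical regimes. *)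
Lemma rare_not_ver :
  rare P (r + r) [set t | (ver_passage (1 - (zt + a)) (reversed m n U ^~ t) (m, n) <
    hor_passage (zt + a) (reversed m n U ^~ t) (m, n))%R].
Proof.
move: (q0) (q1) (qz) (zq) (a0) (aq) (D0) (N1) (gN) => p0 p1 pz zp b0 bq hD hN hg.
pose V := reversed m n U.
have hV1 : rare P r [set t | (gam + x <= hor_passage zt (V ^~ t) (m, n))%R].
  split.
    rewrite -[X in measurable X]setTI; apply: measurable_fun_ler => //.
    by apply: (measurable_hor_passage m0 n0 jV); rewrite ?m0 ?leqnn//; lra.
  have qa0 : 0 < q / 4 * a by rewrite mulr_gt0// divr_gt0.
  have qa1 : q / 4 * a <= q / 32.
    by rewrite (_ : q / 32 = q / 4 * 8^-1); [rewrite ler_pM2l ?divr_gt0//; lra|lra].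
  apply: le_trans (hor_passage_upper (z := zt - q / 4 * a) m0 n0 jV _ _ _ _) _; [lra|lra|lra|].
  rewrite lee_fin; apply: (@tail_le (q / 8)); first lra.
  have e1 := @exponent_le R zt q zt (zt - q / 4 * a) q0 (ltW q1) ltac:(lra) ltac:(lra) ltac:(lra).
  have a3 : 0 <= q ^+ 2 * a ^+ 3 by rewrite mulr_ge0 ?exprn_ge0// ltW.
  have e2 : 4 / (3 * q) * ((zt - zt) ^+ 3 - (zt - q / 4 * a - zt) ^+ 3) =
      q ^+ 2 * a ^+ 3 / 48 by field; rewrite gt_eqF.
  have := gam_mul_le e1; rewrite e2 /x => /(_ ltac:(lra)); set X := gam * _.
  have qD : q ^+ 2 * D <= q * D.
    have qq : 0 <= q * (1 - q) by apply: mulr_ge0; lra.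
    by apply: ler_wpM2r => //; lra.
  have : 0 <= q * D by rewrite mulr_ge0// ltW.
  by move: qD; rewrite /D; lra.
have hV2 : rare P r [set t | (from_origin
    (fun q t => edge_weights zt (1 - (zt + a)) (V ^~ t) q) (m, n) t <= gam + x)%R].
  split.
    rewrite -[X in measurable X]setTI; apply: measurable_fun_ler => //.
    by apply: (measurable_from_origin_edge jV) => //; lra.
  apply: le_trans (from_origin_lower m0 n0 jV x _ _ _) _; [lra|lra|lra|].
  rewrite lee_fin; apply: (@tail_le 3^-1); first lra.
  have e1 := @exponent_ge R zt (zt + a) zt ltac:(lra) ltac:(lra) ltac:(lra).
  have a3 : 0 <= a ^+ 3 by rewrite exprn_ge0// ltW.
  have := gam_mul_ge e1; rewrite opprB /x => /(_ ltac:(lra)); set X := gam * _.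
  by move: D0; rewrite /D; lra.
have mver : measurable_fun setT (fun t => ver_passage (1 - (zt + a)) (V^~ t) (m, n)).
  apply: (@measurable_last_passage _ _ _
    (fun q t => edge_weights 1 (1 - (zt + a)) (V ^~ t) q)) => //.
  move=> k l hk hl; apply: (jointly_measurable (unit_field_edge _ _ jV)) => //; first lra.
  case/andP: hk => _ km; case/andP: hl => l0 ln.
  by rewrite mem_rect xpair_eqE/= km ln (gtn_eqF l0) andbF.
have mbad : measurable [set t | (ver_passage (1 - (zt + a)) (V ^~ t) (m, n) <
    hor_passage (zt + a) (V ^~ t) (m, n))%R].
  rewrite -[X in measurable X]setTI; apply: measurable_fun_ltr => //.
  by apply: (measurable_hor_passage m0 n0 jV); rewrite ?m0 ?leqnn//; lra.
have [mE hE] := rareU hV1 hV2; split => //.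
apply: le_trans hE; apply: le_measure; rewrite ?inE//.
move=> t /= hv; have V0 p : 0 <= V p t by exact: U0.
have hle : hor_passage (zt + a) (V^~ t) (m, n) <= hor_passage zt (V^~ t) (m, n).
  by apply: hor_passage_le => //; lra.
have [h|h] := leP (gam + x) (hor_passage zt (V^~ t) (m, n)); [by left|right].
rewrite /from_origin last_passage_origin// ge_max (ltW h)/=.
exact: le_trans (ltW hv) (le_trans hle (ltW h)).
Qed.

Lemma rare_walk_up :
  rare P r [set t | (x < walk_max (row_sites m)
    (fun p => U p t / (zt - a) - (zt - 2 * a)^-1))%R].
Proof.
move: (q0) (q1) (qz) (zq) (a0) (aq) (D0) (N1) (gN) => p0 p1 pz zp b0 bq hD hN hg.
have w0 : 0 < zt - a by lra.
pose X p t := edge_weights (zt - a) 1 (U^~ t) p.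
have jX : jointly P (row_sites m) X (edge_law (zt - a) 1).
  apply: jointly_sub (unit_field_edge w0 ltr01 jU); first exact: row_sites_uniq.
  by move=> p; rewrite mem_row_sites; exact: row_in_rect.
pose xi (y : R) := y - (zt - 2 * a)^-1.
have mxi : measurable_fun setT xi by exact: measurable_funB.
rewrite (_ : [set t | _] =
    [set t | (x < walk_max (row_sites m) (fun p => xi (X p t)))%R]); last first.
  congr mkset; apply/funext => t; congr (is_true (x < _)%R).
  by apply: eq_walk_max => p; rewrite mem_row_sites /xi /X /edge_weights => /andP[_ ->].
split.
  rewrite -[X in measurable X]setTI; apply: measurable_fun_ltr => //.
  by apply: measurable_walk_max => // p ps; exact: (jointly_measurable jX).
apply: le_trans (@walk_max_tail _ _ _ _ _ _ _ _ _ a _ jX mxi (ltW a0) _) _.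
  move=> p; rewrite mem_row_sites /edge_law => /andP[_ ->].
  rewrite /xi (_ : zt - 2 * a = (zt - a) - a); last by ring.
  by apply: expo_walk_up; lra.
by rewrite lee_fin; apply: (@tail_le 1); [lra|rewrite /x /D; lra].
Qed.

(** By stationarity of the reversed model, the increments along its top row are
  independent Exp(zt + a) variables. *)
Lemma rare_walk_down :
  let W := fun p t => edge_weights (zt + a) (1 - (zt + a)) (reversed m n U ^~ t) p in
  rare P r [set t | (x < walk_max (row_sites_rev m) (fun p => (zt + 2 * a)^-1 -
    (from_origin W (p.1, n) t - from_origin W (p.1.-1, n) t)))%R].
Proof.
move: (q0) (q1) (qz) (zq) (a0) (aq) (D0) (N1) (gN) => p0 p1 pz zp b0 bq hD hN hg.
move=> W; have u0 : 0 < zt + a by lra.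
have u1 : 0 < zt + a < 1 by lra.
pose X p := if p.2 == 0%N then hor_increment W (p.1, n) else ver_increment W (m, p.2).
have jX : jointly P (row_sites_rev m) X (edge_law (zt + a) (1 - (zt + a))).
  have v0 : 0 < 1 - (zt + a) by lra.
  apply: jointly_sub (burke_stationarity u1 (unit_field_edge u0 v0 jV)).
    exact: row_sites_rev_uniq.
  move=> p; rewrite mem_row_sites_rev mem_filter => hp.
  by rewrite row_in_rect// andbT; case/andP: hp => _ ->; rewrite orbT.
pose xi (y : R) := (zt + 2 * a)^-1 - y.
have mxi : measurable_fun setT xi by exact: measurable_funB.
rewrite (_ : [set t | _] =
    [set t | (x < walk_max (row_sites_rev m) (fun p => xi (X p t)))%R]); last first.
  congr mkset; apply/funext => t; congr (is_true (x < _)%R).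
  by apply: eq_walk_max => p; rewrite mem_row_sites_rev /xi /X => /andP[_ ->].
split.
  rewrite -[X in measurable X]setTI; apply: measurable_fun_ltr => //.
  by apply: measurable_walk_max => // p ps; exact: (jointly_measurable jX).
apply: le_trans (@walk_max_tail _ _ _ _ _ _ _ _ _ a _ jX mxi (ltW a0) _) _.
  move=> p; rewrite mem_row_sites_rev /edge_law => /andP[_ ->].
  rewrite /xi (_ : zt + 2 * a = (zt + a) + a); last by ring.
  by apply: expo_walk_down; lra.
by rewrite lee_fin; apply: (@tail_le 1); [lra|rewrite /x /D; lra].
Qed.


(** [hor_to_bulk] with K of order a N.  The rates zt - 2 a and zt + 2 a of the two
  slopes make the loss K (1 / (zt - 2 a) - 1 / (zt + 2 a)) of order a^2 N, the size of
  all other errors, and each exceptional event has probability exp (- c a^3 N). *)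
Lemma hor_large_bulk_large : 1 <= D ->
  let C := 2 + (4 * (52 / q + 1) + 1) * (6 / q ^+ 2) + q^-1 in
  exists2 E, rare P (6 * r) E & forall t, ~ E t ->
    gam < hor_passage (zt - a) (U^~ t) (m, n) ->
    gam - C * x < last_passage (U^~ t) (1%N, 1%N) (m, n).
Proof.
move: (q0) (q1) (qz) (zq) (a0) (aq) (D0) (N1) (gN) => p0 p1 pz zp b0 bq hD hN hg.
move=> D1 C; pose C3 := 52 / q + 1.
have z2 : 0 < zt - 2 * a by lra.
have z1 : 0 < zt - a by lra.
have z3 : 0 < zt + 2 * a by lra.
have z21 : zt - 2 * a <= zt - a by lra.
have z23 : zt - 2 * a <= zt + 2 * a by lra.
have zle : (zt - 2 * a <= 1) * (zt - a <= 1) by split; lra.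
have qz2 : 3 / 4 * q <= zt - 2 * a by lra.
have qz3 : q <= zt + 2 * a by lra.
have iq0 : 0 < q^-1 by rewrite invr_gt0.
have C30 : 0 < C3 by rewrite /C3; lra.
have aN : 1 <= a * N.
  apply: le_trans D1 _; rewrite /D exprS -mulrA ler_wpM2l ?(ltW a0)//.
  rewrite ler_piMl//; first lra.
  by rewrite expr_le1//; lra.
(* With this K the gain (1 / (zt - 2 a) - 1 / (zt - a)) K / 4 >= a K / 4 is at
   least C3 a^2 N. *)
pose K := (Num.truncn (4 * C3 * (a * N))).+1.
have KC : 4 * C3 * (a * N) < K%:R by exact: truncnS_gt.
have KC4 : C3 * (a * N) <= K%:R / 4 by lra.
have aN0 : 0 <= C3 * (a * N) by apply: mulr_ge0; lra.
have CK : K%:R <= (4 * C3 + 1) * (a * N).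
  rewrite /K -natr1; have : (Num.truncn (4 * C3 * (a * N)))%:R <= 4 * C3 * (a * N).
    by rewrite truncn_le// mulr_ge0//; lra.
  lra.
have a1 : a < 1 by lra.
have D_aN : D <= a * N.
  rewrite /D exprS -mulrA ler_wpM2l ?(ltW a0)// ler_piMl//; first lra.
  by rewrite expr_le1//; lra.
have x1 : 1 <= x.
  apply: le_trans D1 _; rewrite /D /x exprS -mulrA ler_piMl//; last lra.
  by rewrite mulr_ge0 ?sqr_ge0//; lra.
have DK : D <= K%:R / 4.
  have : a * N <= C3 * (a * N) by rewrite ler_peMl//; rewrite /C3; lra.
  lra.
have rho1_le : (zt - 2 * a)^-1 <= 4 / 3 * q^-1.
  rewrite (_ : 4 / 3 * q^-1 = (3 / 4 * q)^-1); last by rewrite invfM invf_div.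
  by rewrite lef_pV2 ?posrE// mulr_gt0.
have rho2_le : (zt + 2 * a)^-1 <= q^-1 by rewrite lef_pV2 ?posrE.
have rho1_ge : 0 <= (zt - 2 * a)^-1 by rewrite invr_ge0 ltW.
have rho2_ge : 0 <= (zt + 2 * a)^-1 by rewrite invr_ge0 ltW.
have rhoB : (zt - 2 * a)^-1 - (zt + 2 * a)^-1 <= 6 / q ^+ 2 * a.
  have -> : (zt - 2 * a)^-1 - (zt + 2 * a)^-1 =
      4 * a * ((zt - 2 * a)^-1 * (zt + 2 * a)^-1).
    by field; apply/andP; split; rewrite gt_eqF.
  have h := ler_pM rho1_ge rho2_ge rho1_le rho2_le.
  apply: (@le_trans _ _ (4 * a * (4 / 3 * q^-1 * q^-1))).
    by apply: ler_wpM2l => //; lra.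
  rewrite -exprVn; have : 0 <= a * q^-1 ^+ 2 by rewrite mulr_ge0 ?sqr_ge0// ltW.
  lra.
have rhoB0 : 0 <= 6 / q ^+ 2 * a by rewrite mulr_ge0 ?divr_ge0 ?sqr_ge0//; lra.
have loss : K%:R * ((zt - 2 * a)^-1 - (zt + 2 * a)^-1) + (zt + 2 * a)^-1 <=
    ((4 * C3 + 1) * (6 / q ^+ 2) + q^-1) * x.
  apply: (@le_trans _ _ ((4 * C3 + 1) * (a * N) * (6 / q ^+ 2 * a) + q^-1)).
    apply: lerD => //; apply: (@le_trans _ _ (K%:R * (6 / q ^+ 2 * a))).
      exact: ler_wpM2l.
    exact: ler_wpM2r.
  rewrite [leRHS]mulrDl; apply: lerD; last by rewrite ler_peMr// ltW.
  by rewrite le_eqVlt; apply/orP; left; apply/eqP; rewrite /x; ring.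
have hy : C3 * x <= ((zt - 2 * a)^-1 - (zt - a)^-1) * (K%:R / 4).
  apply: (@le_trans _ _ (a * (C3 * (a * N)))).
    by rewrite le_eqVlt; apply/orP; left; apply/eqP; rewrite /x; ring.
  apply: ler_pM => //; first exact: ltW.
  have -> : (zt - 2 * a)^-1 - (zt - a)^-1 = a * ((zt - 2 * a) * (zt - a))^-1.
    by field; apply/andP; split; rewrite gt_eqF.
  have zz0 : 0 < (zt - 2 * a) * (zt - a) by exact: mulr_gt0.
  rewrite ler_peMr ?(ltW a0)// invr_ge1 ?unitfE ?gt_eqF//.
  by rewrite mulr_ile1 ?zle// ltW.
have hE := rareU (rareU (rareU (rareU rare_hor_high (rare_row_sum DK)) rare_not_ver)
  rare_walk_up) rare_walk_down.
eexists; first by apply: rare_le hE; rewrite le_eqVlt; apply/orP; left; apply/eqP; ring.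
move=> t nE hg1.
have e1 : hor_passage (zt - 2 * a) (U^~ t) (m, n) < gam + C3 * x.
  by rewrite ltNge; apply/negP => h; apply: nE; do 4 left.
have e2 : (K < m)%N -> K%:R / 4 < \sum_(q <- take K (row_sites m)) U q t.
  by move=> Km; rewrite ltNge; apply/negP => h; apply: nE; do 3 left; right.
have e3 : hor_passage (zt + a) (reversed m n (U^~ t)) (m, n) <=
    ver_passage (1 - (zt + a)) (reversed m n (U^~ t)) (m, n).
  by rewrite leNgt; apply/negP => h; apply: nE; do 2 left; right.
have e4 : walk_max (row_sites m) (fun p => U p t / (zt - a) - (zt - 2 * a)^-1) <= x.
  by rewrite leNgt; apply/negP => h; apply: nE; left; right.
have := @hor_to_bulk R m n (U^~ t) m0 n0 (U0^~ t) gam (C3 * x) x (zt - a) (zt - 2 * a)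
  (zt + a) (1 - (zt + a)) (zt - 2 * a)^-1 (zt + 2 * a)^-1 K.
move=> /(_ z2 z21).
have rr : (zt + 2 * a)^-1 <= (zt - 2 * a)^-1 by rewrite lef_pV2 ?posrE.
move=> /(_ rr hg1 e1 e2 hy e3 e4) h.
have := h ltac:(by rewrite leNgt; apply/negP => h'; apply: nE; right).
move: loss; rewrite /C mulrDl; rewrite -/C3; lra.
Qed.

End HorBad.

(** * The lower tail of the bulk passage time *)

Lemma gamma_swap {R : realType} m n : gamma (toR2 (n, m)) = gamma (toR2 (m, n)) :> R.
Proof. by rewrite /gamma addrC. Qed.

Lemma l1norm_swap {R : realType} m n : l1norm (toR2 (n, m)) = l1norm (toR2 (m, n)) :> R.
Proof. by rewrite /l1norm addrC. Qed.

Lemma zeta_swap {R : realType} m n : (0 < m)%N -> (0 < n)%N ->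
  zeta (toR2 (n, m)) = 1 - zeta (toR2 (m, n)) :> R.
Proof.
move=> m0 n0; rewrite /zeta /=.
have hm : 0 < Num.sqrt m%:R :> R by rewrite sqrtr_gt0 ltr0n.
have hn : 0 < Num.sqrt n%:R :> R by rewrite sqrtr_gt0 ltr0n.
by field; rewrite ?andbT ?gt_eqF // addr_gt0.
Qed.

Section LowerTail.
Context {R : realType}.

Lemma measurable_bulk d (T : measurableType d) (P : probability T R) m n
    (U : nat * nat -> T -> R) : (0 < m)%N -> (0 < n)%N -> unit_field P m n U ->
  measurable_fun setT (fun t => last_passage (U^~ t) (1%N, 1%N) (m, n)).
Proof.
move=> m0 n0 jU; apply: (@measurable_last_passage _ _ _ U) => // k l /andP[k0 km] /andP[l0 ln].
by apply: (jointly_measurable jU); rewrite mem_rect xpair_eqE/= km ln (gtn_eqF k0).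
Qed.

(** Outside an event of probability exp (- c a^3 N) one of the two boundary passage
  times of rates zeta - a and 1 - (zeta + a) exceeds gamma; [hor_large_bulk_large] for
  the field or for its transpose carries this over to the bulk.  The constants are
  such that the bound is trivial for a^3 N < 1 and the event empty for a > q / 8. *)
Lemma bulk_lower_tail (q : R) : 0 < q -> q < 1 -> exists2 C1, 0 < C1 &
  forall d (T : measurableType d) (P : probability T R) m n (U : nat * nat -> T -> R) a,
    (0 < m)%N -> (0 < n)%N -> unit_field P m.+1 n.+1 U -> (forall p t, 0 <= U p t) ->
    q <= zeta (toR2 (m, n)) -> zeta (toR2 (m, n)) <= 1 - q -> 0 < a ->
    (P [set t | (last_passage (U^~ t) (1%N, 1%N) (m, n) <=
        gamma (toR2 (m, n)) - C1 * (a ^+ 2 * l1norm (toR2 (m, n))))%R] <=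
     (13 * expR (- (q / 8 * (a ^+ 3 * l1norm (toR2 (m, n))))))%:E)%E.
Proof.
move=> q0 q1; pose C := 2 + (4 * (52 / q + 1) + 1) * (6 / q ^+ 2) + q^-1.
have iq0 : 0 < q^-1 by rewrite invr_gt0.
have iq20 : 0 < (q ^+ 2)^-1 by rewrite invr_gt0 exprn_gt0.
have C0 : 0 < C.
  rewrite /C !addr_gt0// mulr_gt0//; last by rewrite mulr_gt0.
  by rewrite addr_gt0// mulr_gt0// addr_gt0// mulr_gt0.
(* The second term makes the level negative for a > q / 8, because 192 / 64 = 3
   exceeds the 2 in gamma <= 2 N. *)
exists (C + 192 / q ^+ 2); first by rewrite addr_gt0// mulr_gt0.
move=> d T P m n U a m0 n0 jU' U0 qz zq a0.
set N := l1norm _; set gam := gamma _; set D := a ^+ 3 * N; set x := a ^+ 2 * N.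
have N1 : 1 <= N by exact: l1norm_ge1.
have /andP[gN1 gN2] : N <= gam <= 2 * N by exact: gamma_bounds.
have jU : unit_field P m n U := unit_field_sub (leqnSn m) (leqnSn n) jU'.
have mB := measurable_bulk m0 n0 jU.
have mS y : measurable [set t | (last_passage (U^~ t) (1%N, 1%N) (m, n) <= y)%R].
  by rewrite -[X in measurable X]setTI; apply: measurable_fun_ler.
have D0 : 0 <= D by rewrite mulr_ge0 ?exprn_ge0 ?(ltW a0)//; lra.
have x0 : 0 <= x by rewrite mulr_ge0 ?exprn_ge0 ?(ltW a0)//; lra.
have [D1|D1] := ltP D 1.
  apply: (@le_trans _ _ 1%E); first by apply: probability_le1; exact: mS.
  rewrite lee_fin; have h := expR_ge1Dx (- (q / 8 * D)).
  have : q / 8 * D <= 1 / 8 by rewrite -(mulr1 (1 / 8)); apply: ler_pM => //; lra.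
  lra.
have [qa|aq] := ltP (q / 8) a.
  rewrite (_ : [set t | _] = set0); last first.
    apply/seteqP; split => // t /=; apply/negP; rewrite -ltNge.
    apply: (@lt_le_trans _ _ 0); last by apply: last_passage_ge0 => //.
    have a2 : q ^+ 2 / 64 <= a ^+ 2.
      rewrite (_ : q ^+ 2 / 64 = (q / 8) ^+ 2); last by field.
      by rewrite lerXn2r// ?nnegrE; lra.
    have : 192 / q ^+ 2 * (q ^+ 2 / 64 * N) <= 192 / q ^+ 2 * x.
      by apply: ler_wpM2l; [rewrite mulr_ge0// ltW|apply: ler_wpM2r => //; lra].
    rewrite (_ : 192 / q ^+ 2 * (q ^+ 2 / 64 * N) = 3 * N); last by field; rewrite gt_eqF.
    have : 0 <= C * x by rewrite mulr_ge0// ltW.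
    rewrite [(C + _) * x]mulrDl; lra.
  by rewrite measure0 lee_fin mulr_ge0// expR_ge0.
have [E hE badE] := hor_large_bulk_large m0 n0 jU' U0 q0 q1 qz zq a0 aq D1.
have zsw := @zeta_swap R m n m0 n0.
have jT : unit_field P n.+1 m.+1 (transposed U) := unit_field_transposed jU'.
have [E' hE' badE'] := @hor_large_bulk_large _ _ _ _ n m (transposed U) n0 m0 jT
  q a (fun p => U0 (p.2, p.1)) q0 q1 ltac:(rewrite zsw; lra) ltac:(rewrite zsw; lra)
  a0 aq ltac:(by rewrite l1norm_swap).
rewrite -/N -/gam in hE badE; rewrite l1norm_swap gamma_swap -/N -/gam zsw in hE' badE'.
set zt := zeta _ in qz zq zsw badE badE'.
pose F := from_origin (fun q t => edge_weights (zt - a) (1 - (zt + a)) (U^~ t) q) (m, n).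
have hF : rare P (expR (- (q / 8 * D))) [set t | F t <= gam].
  split.
    rewrite -[X in measurable X]setTI; apply: measurable_fun_ler => //.
    by apply: (measurable_from_origin_edge jU) => //; lra.
  have := @from_origin_lower _ _ _ P m n U m0 n0 jU (zt - a) (zt + a) 0.
  rewrite addr0 mulr0 addr0 => /(_ ltac:(lra) ltac:(lra) ltac:(lra)) h.
  apply: le_trans h _; rewrite lee_fin ler_expR.
  have := @exponent_ge R zt (zt + a) (zt - a) ltac:(lra) ltac:(lra) ltac:(lra).
  rewrite (_ : _ * _ = 8 / 3 * a ^+ 3); last by field.
  rewrite -/zt -/gam; set e1 := exponent _ (zt + a); set e2 := exponent _ (zt - a) => he.
  have a3 : 0 <= 8 / 3 * a ^+ 3 by rewrite mulr_ge0// exprn_ge0// ltW.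
  have h1 : N * (8 / 3 * a ^+ 3) <= gam * (e1 - e2).
    by apply: ler_pM => //; lra.
  have : q / 8 * D <= D by rewrite ler_piMl//; lra.
  by move: h1 D0; rewrite /D; lra.
have [mG hG] := rareU (rareU hE hE') hF.
apply: le_trans (le_trans hG _); last first.
  by rewrite lee_fin le_eqVlt; apply/orP; left; apply/eqP; rewrite -/D; ring.
apply: le_measure; rewrite ?inE//.
move=> t /=; set B := last_passage _ _ _ => hB.
have {}hB : B <= gam - C * x.
  have : 0 <= 192 / q ^+ 2 * x by rewrite mulr_ge0// mulr_ge0// ltW.
  by move: hB; rewrite [(C + _) * x]mulrDl; lra.
have [Et|nE] := pselect (E t); first by left; left.
have [Et'|nE'] := pselect (E' t); first by left; right.
right; rewrite /= leNgt; apply/negP; rewrite /F /from_origin last_passage_origin// lt_max.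
case/orP => h.
  by have := badE t nE h; rewrite -/C -/x -/B; lra.
have := badE' t nE'; rewrite (_ : 1 - zt - a = 1 - (zt + a)); last by ring.
rewrite -(ver_passage_transpose _ (U^~ t))// => /(_ h).
by rewrite /transposed (last_passage_transpose (U^~ t))// -/B -/C -/x; lra.
Qed.

End LowerTail.

(** * Moments from tails *)

Section Moments.
Context {R : realType} d (T : measurableType d) (P : probability T R).

(** From s <= exp s at s = l y / p. *)
Lemma powR_max_le_expR (p l y : R) : 0 < p -> 0 < l ->
  (Num.max 0 y) `^ p <= (p / l) `^ p * expR (l * y).
Proof.
move=> p0 l0; have [y0|y0] := leP y 0.
  by rewrite powR0 ?gt_eqF// mulr_ge0 ?powR_ge0 ?expR_ge0.
have pl0 : 0 < p / l by exact: divr_gt0.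
have -> : y = p / l * (l * y / p) by field; rewrite !gt_eqF.
rewrite powRM ?(ltW pl0)//; last by rewrite !mulr_ge0 ?invr_ge0 ?ltW.
apply: ler_wpM2l; first exact: powR_ge0.
rewrite (_ : l * (p / l * (l * y / p)) = l * y / p * p); last by field; rewrite !gt_eqF.
have z0 : 0 <= l * y / p by rewrite !mulr_ge0 ?invr_ge0 ?ltW.
rewrite expRM ge0_ler_powR ?nnegrE ?expR_ge0 ?(ltW p0)//.
by have := expR_ge1Dx (l * y / p); lra.
Qed.

(** Y is cut at the levels 4^k r0.  Raising the cut from level k to k + 1 costs at
  most (4^(k + 1) r0)^p times the tail at level k, and exp (- c 8^k) <= 1 / (c 8^k)
  turns these costs into a geometric series of ratio at most 1 / 2. *)
Lemma shell_moment (Y : T -> R) (b r0 c p A : R) :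
  measurable_fun setT Y -> (forall t, 0 <= Y t <= b) ->
  0 < r0 -> 0 < c -> c <= 1 -> 1 <= p -> 0 <= A ->
  (forall k, P [set t | (4 ^+ k * r0 <= Y t)%R] <= (A * expR (- (c * 8 ^+ k * p)))%:E)%E ->
  (\int[P]_t ((Y t) `^ p)%:E <= (((1 + 2 * A) * (4 / c) * r0) `^ p)%:E)%E.
Proof.
move=> mY Yb r00 c0 c1 p1 A0 tail.
have p0 : 0 < p by lra.
pose r k := 4 ^+ k * r0.
have rgt0 k : 0 < r k by rewrite mulr_gt0// exprn_gt0.
have rS k : r k <= r k.+1 
  by rewrite /r exprS ler_pM2r// ler_peMl ?exprn_ge0//; lra.
pose Z k t := Num.min (Y t) (r k).
have Z0 k t : 0 <= Z k t by rewrite /Z le_min (ltW (rgt0 k)) andbT; case/andP: (Yb t).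
have mZ k : measurable_fun setT (fun t => Z k t `^ p).
  by apply: (measurableT_comp (measurable_powR p)); exact: measurable_minr.
have mS k : measurable [set t | (r k <= Y t)%R].
  by rewrite -[X in measurable X]setTI; apply: measurable_fun_ler.
have key M : (\int[P]_t ((Z M t) `^ p)%:E <=
    (r0 `^ p + A * (4 / c * r0) `^ p * (2 - 2 * 2^-1 ^+ M))%:E)%E.
  elim: M => [|M IH].
    rewrite expr0 mulr1 subrr mulr0 addr0.
    apply: (@le_trans _ _ (\int[P]_t (r0 `^ p)%:E)%E); last by rewrite integral_probability_cst.
    apply: ge0_le_integral => //.
    - by move=> t _; rewrite lee_fin powR_ge0.
    - exact/measurable_EFinP.
    move=> t _; rewrite lee_fin ge0_ler_powR ?nnegrE ?(ltW r00)//; first lra.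
    by rewrite /Z /r expr0 mul1r ge_min lexx orbT.
  apply: (@le_trans _ _ (\int[P]_t ((Z M t `^ p)%:E +
      (r M.+1 `^ p)%:E * (\1_[set t | (r M <= Y t)%R] t)%:E))%E).
    apply: ge0_le_integral => //.
    - by move=> t _; rewrite lee_fin powR_ge0.
    - exact/measurable_EFinP.
    - apply: emeasurable_funD; first exact/measurable_EFinP.
      by apply/measurable_EFinP; apply: measurable_funM => //; exact: measurable_indic.
    move=> t _; rewrite -EFinM -EFinD lee_fin indicE.
    have [h|h] := leP (r M) (Y t).
      rewrite mem_set// mulr1 (@le_trans _ _ (r M.+1 `^ p))//.
        rewrite ge0_ler_powR ?nnegrE ?(ltW (rgt0 _))//; first lra.
        by rewrite /Z ge_min lexx orbT.
      by rewrite lerDr powR_ge0.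
    rewrite memNset; last by rewrite /= => h'; move: h; rewrite ltNge h'.
    rewrite mulr0 addr0 /Z (min_l (ltW h)) min_l//.
    exact: le_trans (ltW h) (rS M).
  rewrite ge0_integralD//; first last.
  - by apply/measurable_EFinP; apply: measurable_funM => //; exact: measurable_indic.
  - by move=> t _; rewrite -EFinM lee_fin mulr_ge0 ?powR_ge0.
  - exact/measurable_EFinP.
  - by move=> t _; rewrite lee_fin powR_ge0.
  rewrite ge0_integralZl//; first last.
  - by rewrite lee_fin powR_ge0.
  - by apply/measurable_EFinP; exact: measurable_indic.
  rewrite integral_indic// setIT.
  have hP : ((r M.+1 `^ p)%:E * P [set t | (r M <= Y t)%R] <=
      (A * (4 / c * r0) `^ p * 2^-1 ^+ M)%:E)%E.
    apply: (@le_trans _ _ ((r M.+1 `^ p)%:E * (A * expR (- (c * 8 ^+ M * p)))%:E)%E).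
      by apply: lee_wpmul2l; [rewrite lee_fin powR_ge0|exact: tail].
    rewrite -EFinM lee_fin mulrCA -[leRHS]mulrA ler_wpM2l//.
    have c8 : 0 < c * 8 ^+ M by rewrite mulr_gt0// exprn_gt0.
    have he : expR (- (c * 8 ^+ M * p)) <= (c * 8 ^+ M)^-1 `^ p.
      rewrite -mulNr expRM ge0_ler_powR ?nnegrE ?expR_ge0 ?invr_ge0 ?(ltW c8)//; first lra.
      rewrite expRN lef_pV2 ?posrE ?expR_gt0//.
      by have := expR_ge1Dx (c * 8 ^+ M); lra.
    apply: (@le_trans _ _ (r M.+1 `^ p * (c * 8 ^+ M)^-1 `^ p)).
      by apply: ler_wpM2l => //; exact: powR_ge0.
    rewrite -powRM ?(ltW (rgt0 _)) ?invr_ge0 ?(ltW c8)//.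
    rewrite (_ : r M.+1 * (c * 8 ^+ M)^-1 = 4 / c * r0 * 2^-1 ^+ M); last first.
      rewrite /r exprS (_ : 8 = 4 * 2 :> R); last by ring.
      rewrite exprMn exprVn; field.
      by rewrite !expf_neq0// gt_eqF.
    rewrite powRM; [|by rewrite !mulr_ge0 ?invr_ge0 ?ltW|by rewrite exprn_ge0].
    apply: ler_wpM2l; first exact: powR_ge0.
    have h2 : 2^-1 ^+ M <= 1 :> R by rewrite exprn_ile1//; lra.
    by apply: ge1r_powR; rewrite // h2 exprn_gt0.
  apply: le_trans (leeD IH hP) _; rewrite -EFinD lee_fin exprS; lra.
have [M hM] : exists M, b <= r M.
  exists (Num.truncn (b / r0)).+1; rewrite /r -ler_pdivrMr//.
  apply: le_trans (ltW (truncnS_gt _)) _; by rewrite -natrX ler_nat ltnW// ltn_expl.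
rewrite (_ : \int[P]_t (Y t `^ p)%:E = \int[P]_t (Z M t `^ p)%:E)%E; last first.
  apply: eq_integral => t _; rewrite /Z min_l//.
  by apply: le_trans hM; case/andP: (Yb t).
apply: le_trans (key M) _; rewrite lee_fin.
have c40 : 1 <= 4 / c by rewrite ler_pdivlMr//; lra.
have cr : 0 <= 4 / c * r0 by rewrite mulr_ge0// ltW//; lra.
apply: (@le_trans _ _ ((1 + 2 * A) * (4 / c * r0) `^ p)).
  rewrite [leRHS]mulrDl mul1r; apply: lerD.
    rewrite ge0_ler_powR ?nnegrE ?(ltW r00)//; first lra.
    by rewrite ler_peMl// ltW.
  have V0 : 0 <= (4 / c * r0) `^ p by exact: powR_ge0.
  set V := _ `^ p in V0 *; have e0 : 0 <= 2^-1 ^+ M :> R by rewrite exprn_ge0.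
  by have := mulr_ge0 (mulr_ge0 A0 V0) e0; lra.
rewrite -[((1 + 2 * A) * _ * _)]mulrA [leRHS]powRM//; last lra.
apply: ler_wpM2r; first exact: powR_ge0.
rewrite -[leLHS]powRr1; last lra.
by apply: ler_powR => //; lra.
Qed.

End Moments.

(** * Moments of the horizontal passage time *)

Section HorMoment.
Context {R : realType}.

Lemma bulk_le_hor_passage w (u : nat * nat -> R) m n : (0 < m)%N -> (0 < n)%N ->
  0 < w -> (forall p, 0 <= u p) ->
  last_passage u (1%N, 1%N) (m, n) <= hor_passage w u (m, n).
Proof.
move=> m0 n0 w0 u0.
have m1 : (1 <= 1 <= m)%N by rewrite m0.
have := @last_passage_ge_exit_row R (edge_weights w 1 u) 1 1 m n m1 n0.
rewrite last_passage_bulk//; apply: le_trans.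
by rewrite lerDr big_nat1 /edge_weights/= divr_ge0// ltW.
Qed.

(** The scale a is the one at which the tail exponent a^3 N equals p.  The positive
  part is controlled by the stationary model with rates at distance q h / 4 and
  q h / 2 below zeta, the negative part by [shell_moment] with r0 of order
  a^2 N = p / a <= p / h. *)
Lemma hor_moment (q : R) : 0 < q -> q < 1 -> exists2 C0, 0 < C0 &
  forall d (T : measurableType d) (P : probability T R) m n (U : nat * nat -> T -> R) w p a h,
    (0 < m)%N -> (0 < n)%N -> unit_field P m.+1 n.+1 U -> (forall q t, 0 <= U q t) ->
    q <= zeta (toR2 (m, n)) -> zeta (toR2 (m, n)) <= 1 - q ->
    1 <= p -> 0 < a -> a ^+ 3 * l1norm (toR2 (m, n)) = p -> h = Num.min a 1 ->
    0 < w -> zeta (toR2 (m, n)) - q / 4 * h <= w ->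
    (\int[P]_t (`|hor_passage w (U^~ t) (m, n) - gamma (toR2 (m, n))| `^ p)%:E <=
      ((C0 * (p / h)) `^ p)%:E)%E.
Proof.
move=> q0 q1; have [C1 C10 tail] := bulk_lower_tail q0 q1.
pose Cu := 4 / q * expR 1; pose Cl := (1 + 2 * 13) * (4 / (q / 8)) * C1.
have Cu0 : 0 < Cu by rewrite /Cu mulr_gt0 ?divr_gt0 ?expR_gt0.
have Cl0 : 0 < Cl by rewrite /Cl mulr_gt0// mulr_gt0 ?divr_gt0//; lra.
exists (2 * (Cu + Cl)); first by rewrite mulr_gt0// addr_gt0.
move=> d T P m n U w p a h m0 n0 jU' U0 qz zq p1 a0 aN hE w0 hw.
set gam := gamma _; set zt := zeta _ in qz zq hw *; set N := l1norm _ in aN *.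
have N1 : 1 <= N by exact: l1norm_ge1.
have /andP[gN1 gN2] : N <= gam <= 2 * N by exact: gamma_bounds.
have jU : unit_field P m n U := unit_field_sub (leqnSn m) (leqnSn n) jU'.
have p0 : 0 < p by lra.
have h0 : 0 < h by rewrite hE lt_min a0 ltr01.
have h1 : h <= 1 by rewrite hE ge_min lexx orbT.
have ha : h <= a by rewrite hE ge_min lexx.
have hN : h ^+ 3 * N <= p.
  by rewrite -aN; apply: ler_wpM2r; [lra|rewrite lerXn2r// ?nnegrE; lra].
pose G t := hor_passage w (U^~ t) (m, n).
have mG : measurable_fun setT G.
  by apply: (measurable_hor_passage m0 n0 jU); rewrite ?m0 ?leqnn.
pose B t := last_passage (U^~ t) (1%N, 1%N) (m, n).
have mB : measurable_fun setT B := measurable_bulk m0 n0 jU.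
pose X t := Num.max 0 (G t - gam).
pose Y t := Num.max 0 (gam - B t).
have mX : measurable_fun setT X by apply: measurable_maxr => //; exact: measurable_funB.
have mY : measurable_fun setT Y by apply: measurable_maxr => //; exact: measurable_funB.
have hX : (\int[P]_t (X t `^ p)%:E <= ((Cu * (p / h)) `^ p)%:E)%E.
  pose l := q / 4 * h; pose w1 := zt - l; pose z1 := w1 - l.
  have l0 : 0 < l by rewrite /l mulr_gt0// divr_gt0.
  have lq : l <= q / 4 by rewrite /l ler_piMr//; lra.
  have w1w : w1 <= w by [].
  pose F := from_origin (fun q t => edge_weights w1 (1 - z1) (U^~ t) q) (m, n).
  have w10 : 0 < w1 by rewrite /w1; lra.
  have z11 : z1 < 1 by rewrite /z1 /w1; lra.
  have mF : measurable_fun setT F by apply: (measurable_from_origin_edge jU).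
  have GF t : G t <= F t.
    apply: (@le_trans _ _ (hor_passage w1 (U^~ t) (m, n))).
      by apply: hor_passage_le.
    by rewrite /F /from_origin last_passage_origin// le_max lexx.
  apply: (@le_trans _ _ (\int[P]_t (((p / l) `^ p)%:E * (expR (l * (F t - gam)))%:E))%E).
    apply: ge0_le_integral => //.
    - by move=> t _; rewrite lee_fin powR_ge0.
    - by apply/measurable_EFinP; apply: (measurableT_comp (measurable_powR p)).
    - apply/measurable_EFinP; apply: measurable_funM => //; apply: measurableT_comp => //.
      by apply: measurable_funM => //; exact: measurable_funB.
    move=> t _; rewrite -EFinM lee_fin; apply: le_trans (powR_max_le_expR _ p0 l0) _.
    by apply: ler_wpM2l; [exact: powR_ge0|rewrite ler_expR ler_wpM2l ?(ltW l0)// lerB].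
  rewrite ge0_integralZl//; first last.
  - by rewrite lee_fin powR_ge0.
  - apply/measurable_EFinP; apply: measurableT_comp => //.
    by apply: measurable_funM => //; exact: measurable_funB.
  have w101 : 0 < w1 < 1 by rewrite /w1; lra.
  have z101 : 0 < z1 < 1 by rewrite /z1 /w1; lra.
  have := @centered_mgf _ _ _ P m n U m0 n0 jU w1 z1 w101 z101.
  rewrite (_ : w1 - z1 = l); last by rewrite /z1; ring.
  move=> ->; rewrite -EFinM lee_fin -/gam -/zt.
  have e1 := @exponent_le R zt q w1 z1 q0 (ltW q1) ltac:(rewrite /z1 /w1; lra)
    ltac:(rewrite /z1; lra) ltac:(rewrite /w1; lra).
  have e2 : 4 / (3 * q) * ((w1 - zt) ^+ 3 - (z1 - zt) ^+ 3) = 7 / 48 * (q ^+ 2 * h ^+ 3).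
    by rewrite /z1 /w1 /l; field; rewrite gt_eqF.
  rewrite e2 in e1; have h30 : 0 <= h ^+ 3 by rewrite exprn_ge0// ltW.
  have qh : q ^+ 2 * h ^+ 3 <= h ^+ 3 by apply: ler_piMl => //; rewrite expr_le1//; lra.
  have qh0 : 0 <= q ^+ 2 * h ^+ 3 by rewrite mulr_ge0// sqr_ge0.
  have e3 : gam * (exponent zt w1 - exponent zt z1) <= p.
    apply: (@le_trans _ _ (gam * (7 / 48 * (q ^+ 2 * h ^+ 3)))).
      by apply: ler_wpM2l => //; lra.
    apply: le_trans hN; rewrite mulrC.
    apply: (@le_trans _ _ (7 / 48 * (q ^+ 2 * h ^+ 3) * (2 * N))).
      by apply: ler_wpM2l => //; lra.
    have : (q ^+ 2 * h ^+ 3) * N <= h ^+ 3 * N by apply: ler_wpM2r => //; lra.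
    have : 0 <= h ^+ 3 * N by apply: mulr_ge0 => //; lra.
    lra.
  apply: (@le_trans _ _ ((p / l) `^ p * expR p)).
    by apply: ler_wpM2l; [exact: powR_ge0|rewrite ler_expR].
  rewrite -[expR p](_ : expR 1 `^ p = _); last by rewrite -expRM mul1r.
  rewrite -powRM ?expR_ge0//; last by rewrite divr_ge0// ltW.
  rewrite ge0_ler_powR ?nnegrE ?(ltW p0)//.
  - by rewrite mulr_ge0 ?expR_ge0// divr_ge0// ltW.
  - by rewrite mulr_ge0 ?divr_ge0// ltW.
  rewrite (_ : p / l = 4 / q * (p / h)); last by rewrite /l; field; rewrite !gt_eqF.
  by rewrite /Cu mulrAC.
pose r0 := C1 * (a ^+ 2 * N).
have r00 : 0 < r0 by rewrite /r0 mulr_gt0// mulr_gt0 ?exprn_gt0//; lra.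
have hY : (\int[P]_t (Y t `^ p)%:E <= ((Cl * (p / h)) `^ p)%:E)%E.
  apply: le_trans (@shell_moment _ _ _ P Y gam r0 (q / 8) p 13 mY _ r00 _ _ p1 _ _) _.
  - move=> t; rewrite /Y le_max lexx ge_max/= lerBlDr lerDl.
    by apply/andP; split; [lra|apply: last_passage_ge0].
  - lra.
  - lra.
  - by [].
  - move=> k; have ak : 0 < 2 ^+ k * a by rewrite mulr_gt0// exprn_gt0.
    have := tail _ _ P m n U (2 ^+ k * a) m0 n0 jU' U0 qz zq ak.
    have e2k : (2 ^+ k) ^+ 2 = 4 ^+ k :> R by rewrite exprAC -natrX.
    have e3k : (2 ^+ k) ^+ 3 = 8 ^+ k :> R by rewrite exprAC -natrX.
    rewrite -/N -/gam !exprMn e2k e3k.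
    rewrite (_ : C1 * (4 ^+ k * a ^+ 2 * N) = 4 ^+ k * r0); last by rewrite /r0; ring.
    rewrite (_ : q / 8 * (8 ^+ k * a ^+ 3 * N) = q / 8 * 8 ^+ k * p); last by rewrite -aN; ring.
    rewrite (_ : [set t | _] = [set t | (4 ^+ k * r0 <= Y t)%R])//.
    have kr0 : 0 < 4 ^+ k * r0 by rewrite mulr_gt0// exprn_gt0.
    apply/seteqP; split => t /=; rewrite /Y le_max; first by move=> hB; apply/orP; right; rewrite -/(B t) in hB; lra.
    by rewrite leNgt kr0/= -/(B t); lra.
  rewrite lee_fin ge0_ler_powR ?nnegrE ?(ltW p0)//.
  - by rewrite !mulr_ge0 ?invr_ge0//; lra.
  - by rewrite mulr_ge0 ?divr_ge0// ltW.
  rewrite /Cl -[leRHS]mulrA; apply: ler_wpM2l; first by rewrite mulr_ge0 ?divr_ge0//; lra.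
  rewrite /r0; apply: ler_wpM2l; first exact: ltW.
  have aN0 : 0 <= a ^+ 2 * N by apply: mulr_ge0; [exact: sqr_ge0|lra].
  by rewrite ler_pdivlMr// -aN; have := ler_wpM2r aN0 ha; lra.
apply: (@le_trans _ _ (\int[P]_t ((X t `^ p)%:E + (Y t `^ p)%:E))%E).
  have mpow (Z : T -> R) : measurable_fun setT Z ->
      measurable_fun setT (fun t => (Z t `^ p)%:E).
    by move=> mZ; apply/measurable_EFinP; exact: (measurableT_comp (measurable_powR p) mZ).
  apply: ge0_le_integral => //.
  - by apply: (mpow (fun t => `|G t - gam|)); apply: measurableT_comp => //; exact: measurable_funB.
  - by apply: emeasurable_funD; exact: mpow.
  move=> t _; rewrite -EFinD lee_fin -/(G t); have [Gg|Gg] := leP gam (G t).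
    rewrite ger0_norm ?subr_ge0// {1}/X (max_r (_ : 0 <= G t - gam)) ?subr_ge0//.
    by rewrite lerDl powR_ge0.
  apply: (@le_trans _ _ (Y t `^ p)); last by rewrite lerDr powR_ge0.
  have BG : B t <= G t by exact: bulk_le_hor_passage.
  rewrite ltr0_norm ?subr_lt0// ge0_ler_powR ?nnegrE ?(ltW p0)//.
  - lra.
  - by rewrite /Y le_max lexx.
  - by rewrite /Y le_max; apply/orP; right; lra.
rewrite ge0_integralD//; first last.
- by apply/measurable_EFinP; apply: (measurableT_comp (measurable_powR p)).
- by move=> t _; rewrite lee_fin powR_ge0.
- by apply/measurable_EFinP; apply: (measurableT_comp (measurable_powR p)).
- by move=> t _; rewrite lee_fin powR_ge0.
apply: le_trans (leeD hX hY) _; rewrite -EFinD lee_fin.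
have ph0 : 0 <= p / h by rewrite divr_ge0// ltW.
have mono C : 0 <= C -> C <= Cu + Cl -> (C * (p / h)) `^ p <= ((Cu + Cl) * (p / h)) `^ p.
  move=> c0 cc; apply: (ge0_ler_powR (ltW p0)); rewrite ?nnegrE.
  - exact: mulr_ge0.
  - by apply: mulr_ge0 => //; lra.
  - exact: ler_wpM2r.
have hu := mono Cu (ltW Cu0) ltac:(lra); have hl := mono Cl (ltW Cl0) ltac:(lra).
rewrite -[2 * _ * _]mulrA [leRHS]powRM//; last by rewrite mulr_ge0//; lra.
have two : 2 <= 2 `^ p :> R by rewrite le1r_powR//; lra.
have V0 : 0 <= ((Cu + Cl) * (p / h)) `^ p by exact: powR_ge0.
have := ler_wpM2r V0 two; lra.
Qed.

End HorMoment.

(** * Weights of the model and conclusion *)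

Section BoundaryWeights.
Context {R : realType} d (T : measurableType d) (P : probability T R).

Lemma expo_field_boundary_weights (w z : R) (omega : nat * nat -> {RV P >-> R}) m n :
  0 < w -> z < 1 -> boundary_weights w z omega ->
  expo_field P m n w (1 - z) (fun q => omega q).
Proof.
move=> w0 z1 [indep bulk hor ver _].
have v0 : 0 < 1 - z by lra.
have law q A : q \in rect m n -> measurable A ->
    P (omega q @^-1` A) = edge_law w (1 - z) q A.
  case: q => i j; rewrite mem_rect xpair_eqE /edge_law/= => /and3P[_ _ ij] mA.
  case: j ij => [|j] /=; first by rewrite andbT -lt0n => i0; rewrite expoE//; exact: hor.
  by case: i => [|i] _; rewrite expoE//; [exact: ver|exact: bulk].
split; [exact: rect_uniq|by []|move=> A mA].
have pe : perm_eq [fset q in rect m n]%fset (rect m n).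
  by apply: uniq_perm; [exact: fset_uniq|exact: rect_uniq|move=> q; rewrite inE].
rewrite /box -(perm_big _ pe)/= -bigcap_fset.
have := indep [fset q in rect m n]%fset A mA; rewrite /= => ->.
rewrite (perm_big _ pe)/= big_seq [RHS]big_seq.
by apply: eq_bigr => q qr; exact: law.
Qed.

Lemma expo_field_transposed (a b : R) (W : nat * nat -> T -> R) m n :
  expo_field P m n a b W -> expo_field P n m b a (transposed W).
Proof.
move=> jW; have : jointly P (rect n m) (transposed W) (fun q => edge_law a b (q.2, q.1)).
  apply: (@jointly_reindex _ _ _ _ _ _ _ (fun q => (q.2, q.1)) (fun q => (q.2, q.1)) W _).
    by case.
  move: jW; apply: jointly_sub.
    by rewrite map_inj_in_uniq ?rect_uniq// => -[? ?] [? ?] _ _ [-> ->].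
  move=> _ /mapP[[i j] + ->]; rewrite !mem_rect !xpair_eqE /=.
  by move=> /and3P[-> ->]; rewrite andbC.
move=> jT; apply: jointly_eq jT => // -[i j]; rewrite mem_rect xpair_eqE /edge_law/=.
by case: i j => [|i] [|j] //= /and3P[].
Qed.

(** Rescaling brings all rates to one.  Taking positive parts makes the field
  nonnegative at every outcome, as the comparisons of passage times require, and
  alters it on a null set only. *)
Lemma unit_field_of_expo_field (a b : R) (W : nat * nat -> T -> R) m n :
  0 < a -> 0 < b -> expo_field P m n a b W ->
  let rate q := if q.2 == 0%N then a else if q.1 == 0%N then b else 1 in
  unit_field P m n (fun q t => Num.max 0 (rate q * W q t)).
Proof.
move=> a0 b0 jW rate.
have -> : (fun q t => Num.max 0 (rate q * W q t)) =
    (fun q t => Num.max 0 (rate q * W q t / 1)).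
  by apply/funext => q; apply/funext => t; rewrite divr1.
have rate0 q : 0 < rate q.
  by rewrite /rate; case: ifP => // _; case: ifP.
apply: (@jointly_map _ _ _ P _ (rect m n) W (edge_law a b) (fun=> expo 1)
  (fun q x => Num.max 0 (rate q * x / 1))) jW.
- move=> q _; apply: measurable_maxr => //; exact: measurable_funM.
- move=> q A qr mA.
  have -> : edge_law a b q = expo (rate q).
    by rewrite /edge_law /rate; case: ifP => // _; case: ifP.
  have mB : measurable ((fun x : R => Num.max 0 x) @^-1` A).
    rewrite -[X in measurable X]setTI; exact: (measurable_maxr _ _ measurableT).
  rewrite -[RHS](expo_pos ltr01 mA) -[RHS](expo_scale (rate0 q) ltr01 mB).
  by [].
Qed.

Lemma expo_field_ge0 (a b : R) (W : nat * nat -> T -> R) m n :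
  0 < a -> 0 < b -> expo_field P m n a b W ->
  {ae P, forall t, {in rect m n, forall q, 0 <= W q t}}.
Proof.
move=> a0 b0 jW.
have nonneg q : q \in rect m n -> {ae P, forall t, 0 <= W q t}.
  move=> qr; exists (W q @^-1` `]-oo, 0[%classic); split.
  - by rewrite -[X in measurable X]setTI; apply: (jointly_measurable jW qr).
  - rewrite (jointly_law jW qr)//.
    by rewrite /edge_law; case: ifP => _; [|case: ifP => _]; exact: expo_neg.
  - by move=> t /= /negP; rewrite -ltNge in_itv.
have : {in rect m n, forall q, {ae P, forall t, 0 <= W q t}} by [].
elim: (rect m n) => [|q s IH] h; first by apply: filterE => t q.
have hq := h q (mem_head _ _).
have hs := IH (fun q' q's => h q' (mem_behead (q's : q' \in behead (q :: s)))).
apply: filterS2 hq hs => t h1 h2 q'; rewrite inE => /predU1P[->//|]; exact: h2.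
Qed.

End BoundaryWeights.

Section Rescaling.
Context {R : realType}.

Lemma cube_rootK (x : R) : 0 <= x -> (x `^ (1 / 3)) ^+ 3 = x.
Proof.
by move=> x0; rewrite -powR_mulrn ?powR_ge0// -powRrM divfK ?powRr1// pnatr_eq0.
Qed.

(** With x^3 = p and y^3 = N both sides are the p-th power of C0 x^2 max (x, y). *)
Lemma scale_identity (p N C0 : R) : 0 < p -> 0 < N -> 0 < C0 ->
  let h := Num.min (p `^ (1 / 3) * N `^ (- (1 / 3))) 1 in
  (C0 * (p / h)) `^ p = C0 `^ p * p `^ (2 * p / 3) * Num.max p N `^ (p / 3).
Proof.
move=> p0 N0 C00 h.
pose x := p `^ (1 / 3); pose y := N `^ (1 / 3).
have x0 : 0 < x by exact: powR_gt0.
have y0 : 0 < y by exact: powR_gt0.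
have px : p = x ^+ 3 by rewrite cube_rootK// ltW.
have Ny : N = y ^+ 3 by rewrite cube_rootK// ltW.
have hE : h = Num.min (x / y) 1 by rewrite /h powRN.
have -> : p / h = p `^ (2 / 3) * Num.max p N `^ (1 / 3).
  have -> : p `^ (2 / 3) = x ^+ 2.
    by rewrite -powR_mulrn ?ltW// -powRrM; congr (_ `^ _); field.
  have [pN|Np] := leP p N.
    have xy : x <= y by rewrite ge0_ler_powR ?nnegrE ?(ltW p0) ?(ltW N0)//; lra.
    rewrite -/y hE min_l; last by rewrite ler_pdivrMr// mul1r.
    by rewrite [in LHS]px; field; rewrite !gt_eqF.
  have yx : y <= x by rewrite ge0_ler_powR ?nnegrE ?(ltW p0) ?(ltW N0) ?(ltW Np)//; lra.
  rewrite -/x hE min_r; last by rewrite ler_pdivlMr// mul1r.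
  by rewrite divr1 [LHS]px; ring.
rewrite powRM ?(ltW C00) ?mulr_ge0 ?powR_ge0// powRM ?powR_ge0// -!powRrM mulrA.
by congr (_ * _ `^ _ * _ `^ _); field.
Qed.

Lemma cone_zeta (delta q : R) m n :
  q = Num.sqrt delta / (1 + Num.sqrt delta) -> 0 < delta -> (0 < m)%N -> (0 < n)%N ->
  cone delta (toR2 (m, n)) -> q <= zeta (toR2 (m, n)) <= 1 - q.
Proof.
move=> qE d0 m0 n0 [_ _ /= h1 h2].
have hm : 0 < Num.sqrt m%:R :> R by rewrite sqrtr_gt0 ltr0n.
have hn : 0 < Num.sqrt n%:R :> R by rewrite sqrtr_gt0 ltr0n.
have hd : 0 < Num.sqrt delta by rewrite sqrtr_gt0.
have k1 : Num.sqrt delta * Num.sqrt n%:R <= Num.sqrt m%:R.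
  by rewrite -sqrtrM ?ler_sqrt// ltW.
have k2 : Num.sqrt delta * Num.sqrt m%:R <= Num.sqrt n%:R.
  by rewrite -sqrtrM ?ler_sqrt// ltW.
rewrite /zeta qE /=; set sm := Num.sqrt m%:R in hm k1 k2 *.
set sn := Num.sqrt n%:R in hn k1 k2 *; set sd := Num.sqrt delta in hd k1 k2 *.
apply/andP; split.
  by rewrite ler_pdivrMr ?addr_gt0// mulrAC ler_pdivlMr ?addr_gt0//; lra.
have -> : 1 - sd / (1 + sd) = 1 / (1 + sd) by field; rewrite gt_eqF// addr_gt0.
by rewrite ler_pdivrMr ?addr_gt0// mulrAC ler_pdivlMr ?addr_gt0//; lra.
Qed.

End Rescaling.

(** The field W coincides almost surely with the edge weights built from a
  nonnegative field of rate one, to which [hor_moment] applies. *)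
Lemma hor_passage_moment (R : realType) (delta : R) : 0 < delta ->
  exists C0 eps0 : R, [/\ 0 < C0, 0 < eps0 &
    forall (m n : nat) (p w b : R) d (T : measurableType d) (P : probability T R)
      (W : nat * nat -> T -> R),
      (0 < m)%N -> (0 < n)%N -> cone delta (toR2 (m, n)) -> 1 <= p -> 0 < w -> 0 < b ->
      expo_field P m.+1 n.+1 w b W ->
      let x : R * R := toR2 (m, n) in
      zeta x - eps0 * Num.min (p `^ (1 / 3) * l1norm x `^ (- (1 / 3))) 1 <= w ->
      (\int[P]_t (`|last_passage (W^~ t) (1%N, 0%N) (m, n) - gamma x| `^ p)%:E <=
       (C0 `^ p * p `^ (2 * p / 3) * Num.max p (l1norm x) `^ (p / 3))%:E)%E].
Proof.
move=> d0; pose q := Num.sqrt delta / (1 + Num.sqrt delta).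
have sd0 : 0 < Num.sqrt delta by rewrite sqrtr_gt0.
have q0 : 0 < q by rewrite divr_gt0// addr_gt0.
have q1 : q < 1 by rewrite ltr_pdivrMr ?addr_gt0// mul1r ltrDr.
have [C0 C00 moment] := hor_moment q0 q1.
exists C0, (q / 4); split => //; first by rewrite divr_gt0.
move=> m n p w b d T P W m0 n0 /(cone_zeta (erefl q) d0 m0 n0) /andP[qz zq] p1 w0 b0 jW x hw.
have N1 : 1 <= l1norm x by exact: l1norm_ge1.
have N0 : 0 < l1norm x by lra.
have p0 : 0 < p by lra.
pose rate (q : nat * nat) := if q.2 == 0%N then w else if q.1 == 0%N then b else 1.
pose V q t := Num.max 0 (rate q * W q t).
have jV : unit_field P m.+1 n.+1 V := unit_field_of_expo_field w0 b0 jW.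
have V0 q' t : 0 <= V q' t by rewrite le_max lexx.
pose a := p `^ (1 / 3) * l1norm x `^ (- (1 / 3)).
have a0 : 0 < a by rewrite mulr_gt0 ?powR_gt0.
have aN : a ^+ 3 * l1norm x = p.
  rewrite /a powRN exprMn exprVn !cube_rootK ?(ltW p0) ?(ltW N0)//.
  by field; rewrite gt_eqF.
have := moment _ _ P m n V w p a _ m0 n0 jV V0 qz zq p1 a0 aN erefl w0 hw.
rewrite (scale_identity p0 N0 C00); apply: le_trans.
have mem_hor k l : (1 <= k <= m)%N -> (0 <= l <= n)%N -> (k, l) \in rect m.+1 n.+1.
  move=> /andP[k0 km] /andP[_ ln].
  by rewrite mem_rect xpair_eqE/= (leqW km) (leqW ln) (gtn_eqF k0).
have mp (Z : T -> R) : measurable_fun setT Z ->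
    measurable_fun setT (fun t => (`|Z t - gamma x| `^ p)%:E).
  move=> mZ; apply/measurable_EFinP; apply: (measurableT_comp (measurable_powR p)).
  by apply: measurableT_comp => //; exact: measurable_funB.
rewrite le_eqVlt; apply/orP; left; apply/eqP; apply: ge0_ae_eq_integral => //.
- apply: (mp (fun t => last_passage (W^~ t) (1%N, 0%N) (m, n))).
  apply: (@measurable_last_passage _ _ _ W) => // k l hk hl.
  exact: (jointly_measurable jW (mem_hor _ _ hk hl)).
- apply: (mp (fun t => hor_passage w (V^~ t) (m, n))).
  by apply: (measurable_hor_passage _ _ jV) => //; rewrite m0 leqW.
have pos := expo_field_ge0 w0 b0 jW.
apply: filterS pos => t post _; congr ((`|_ - _| `^ p)%:E).
apply: last_passage_eq => // k l hk hl.
have k0 : k != 0%N by case/andP: hk; case: k.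
have W0 := post _ (mem_hor k l hk hl).
rewrite /edge_weights /V /rate /= (negbTE k0).
move: (W (k, l) t) W0 => y y0; have [_|_] := eqVneq l 0%N.
  by rewrite max_r; [field; rewrite gt_eqF|rewrite mulr_ge0// ltW].
by rewrite mul1r max_r.
Qed.

Theorem theorem2p8 (R : realType) (delta : R) (hdelta : 0 < delta) :
  exists C0 eps0 : R, [/\ 0 < C0, 0 < eps0 &
    forall (v : nat * nat) (p w z : R),
      (0 < v.1)%N -> (0 < v.2)%N -> cone delta (toR2 v) ->
      1 <= p -> 0 < w -> z < 1 ->
    forall (d : measure_display) (T : measurableType d) (P : probability T R)
      (omega : nat * nat -> {RV P >-> R}),
      boundary_weights w z omega ->
      let x : R * R := toR2 v in
      let eps : R :=
        eps0 * Num.min (p `^ (1 / 3) * l1norm x `^ (- (1 / 3))) 1 in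
      let bound : R :=
        C0 `^ p * p `^ (2 * p / 3) * Num.max p (l1norm x) `^ (p / 3) in
      (zeta x - eps <= w ->
        ('E_P[fun t => (`|G_hor omega v t - gamma x| `^ p)%R] <= bound%:E)%E) /\
      (z <= zeta x + eps ->
        ('E_P[fun t => (`|G_ver omega v t - gamma x| `^ p)%R] <= bound%:E)%E)].
Proof.
have [C0 [eps0 [C00 eps00 hor]]] := hor_passage_moment hdelta.
exists C0, eps0; split => // -[m n] p w z m0 n0 cn p1 w0 z1 d T P omega bw x eps bound.
have b0 : 0 < 1 - z by lra.
have jW := expo_field_boundary_weights m.+1 n.+1 w0 z1 bw.
split => h; rewrite unlock; first exact: hor jW h.
have cn' : cone delta (toR2 (n, m)) by case: cn.
have := hor n m p _ _ _ _ P _ n0 m0 cn' p1 b0 w0 (expo_field_transposed jW).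
rewrite /= l1norm_swap gamma_swap (zeta_swap m0 n0).
move=> /(_ ltac:(move: h; rewrite /eps /x /=; lra)); apply: le_trans.
rewrite le_eqVlt; apply/orP; left; apply/eqP; apply: eq_integral => t _.
congr ((`|_ - _| `^ p)%:E).
by rewrite /G_ver -(last_passage_transpose (fun q => omega q t)).
Qed.
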